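(* Let $N$ be a Riemannian symmetric space, let $M$ be a simply connected Riemannian symmetric space which is isometric to a Riemannian product $M_1\times\cdots\times M_k$ of irreducible symmetric spaces $M_i$, and let $f:M\to N$ be a parallel isometric immersion. (a) There exists a natural action $\alpha:\mathrm{Sym}(M)\times\mathcal{O}f\to\mathcal{O}f$ where $\mathrm{Sym}(M)$ acts through isometric, parallel (with respect to $\nabla^{\mathcal{O}f}$) vector bundle isomorphisms, characterized as follows: for each point $p\in M$ and all $v\in\mathcal{O}_pf$ one has $\alpha(\sigma^M_p,v)=\Sigma_p(v)$. (b) $\alpha$ splits into two actions $\alpha^\top$ on $TM$ and $\alpha^\bot$ on $\bot^1f$, i.e. $\alpha(g,x+\xi)=\alpha^\top(g,x)+\alpha^\bot(g,\xi)\in TM\oplus\bot^1f$ for all $g\in\mathrm{Sym}(M)$, $x+\xi\in T_pM\oplus\bot^1_pf$, $p\in M$; and $\alpha^\top(g,x)=T_pg\,x$ for all $g\in\mathrm{Sym}(M)$, $x\in T_pM$, $p\in M$. Furthermore, the second fundamental form $h$ is $\alpha$-invariant in the following sense: $\alpha^\bot(g,h(x,y))=h(\alpha(g,x),\alpha(g,y))$ for all $g\in\mathrm{Sym}(M)$, $x,y\in T_pM$, $p\in M$. (c) $\bot^1f$ is a homogeneous vector bundle over $M$ via the action of $\alpha^\bot$ restricted to $\mathrm{I}(M)^0$. (d) The normal connection on $\bot^1f$ is the canonical connection induced by the Cartan decomposition $\mathfrak{i}(M)=\mathfrak{k}^M\oplus\mathfrak{p}^M$.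
   Context: For an isometric immersion $f:M\to N$ identify $T_pM$ with its image in $T_{f(p)}N$; $\bot f$ is the normal bundle with normal connection $\nabla^\bot$, $\nabla^M$ and $\nabla^N$ are the Levi-Civita connections, and $h$ is the second fundamental form. $f$ is parallel if $\nabla^\bot_X(h(Y,Z))=h(\nabla^M_XY,Z)+h(Y,\nabla^M_XZ)$ for all vector fields $X,Y,Z$ on $M$. Put $\bot^1_pf:=\mathrm{span}_{\mathbb R}\{h(x,y)\mid x,y\in T_pM\}$ and $\mathcal{O}_pf:=T_pM\oplus\bot^1_pf$. For parallel $f$, $\bot^1f\subset\bot f$ is a $\nabla^\bot$-parallel vector subbundle (so $\nabla^\bot$ restricts to a connection on it, the normal connection on $\bot^1f$), and $\mathcal{O}f=TM\oplus\bot^1f\subset f^*TN$ is a $\nabla^N$-parallel subbundle, with induced connection $\nabla^{\mathcal{O}f}$. $\mathrm{I}(M)$ is the isometry group of $M$ with Lie algebra $\mathfrak{i}(M)$, $\mathrm{I}(M)^0$ its identity component, $\sigma^M_p$ the geodesic symmetry of $M$ at $p$, and $\mathrm{Sym}(M)$ the subgroup of $\mathrm{I}(M)$ generated by all $\sigma^M_p$, $p\in M$; it is a Lie subgroup of $\mathrm{I}(M)$ with $\mathrm{I}(M)^0\subset\mathrm{Sym}(M)$. For each $p\in M$, $\Sigma_p:\mathcal{O}f\to\mathcal{O}f$ is the unique involutive map which is a fibrewise isometric vector bundle homomorphism along $\sigma^M_p$, is $\nabla^{\mathcal{O}f}$-parallel (maps parallel sections along curves $c$ to parallel sections along $\sigma^M_p\circ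 c$), and restricts on $\mathcal{O}_pf$ to the linear reflection in $\bot^1_pf$ ($+\mathrm{id}$ on $\bot^1_pf$, $-\mathrm{id}$ on $T_pM$); its existence and uniqueness is known for parallel $f$ on simply connected symmetric $M$. A vector bundle $\mathbb{E}$ over $M$ is called homogeneous if there is an action $\mathrm{I}(M)^0\times\mathbb{E}\to\mathbb{E}$ by vector bundle isomorphisms such that the bundle projection of $\mathbb{E}$ is equivariant. Fix an origin $o\in M$. In the Cartan decomposition $\mathfrak{i}(M)=\mathfrak{k}^M\oplus\mathfrak{p}^M$, $\mathfrak{k}^M$ is the Lie algebra of the isotropy group at $o$ and $\mathfrak{p}^M$ is the $-1$-eigenspace of $\mathrm{Ad}(\sigma^M_o)$. The canonical connection that it induces on a homogeneous vector bundle $\mathbb{E}$ with action $\alpha$ of $\mathrm{I}(M)^0$ is the linear connection for which, for all $g\in\mathrm{I}(M)^0$, $X\in\mathfrak{p}^M$ and $v\in\mathbb{E}_o$, the curve $t\mapsto\alpha(g\exp(tX),v)$ is a parallel section of $\mathbb{E}$ along $t\mapsto g\exp(tX)(o)$. *)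

(* Defs.v *)
From HB Require Import structures.
From mathcomp Require Import all_boot all_order all_algebra.
From mathcomp Require Import all_classical all_reals all_analysis.

Set Implicit Arguments.
Unset Strict Implicit.
Unset Printing Implicit Defensive.

Import Order.TTheory GRing.Theory Num.Theory.
Import numFieldNormedType.Exports.
Local Open Scope classical_set_scope.
Local Open Scope ring_scope.

(* g is of class C^k on U; only used for open sets U. *)
Fixpoint Ck (R : realType) (V W : normedModType R) (k : nat) (U : set V)
    (g : V -> W) : Prop :=
  match k with
  | 0 => forall x, U x -> {for x, continuous g}
  | j.+1 => (forall x, U x -> differentiable g x) /\
            forall v : V, Ck j U (fun x => ('D_v g x : W))
  end.

Definition Cinfty (R : realType) (V W : normedModType R) (U : set V)
  (g : V -> W) : Prop := forall k, Ck k U g.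

(* A smooth manifold modelled on 'rV_dim.  The atlas is indexed by the points:
   every point p has a preferred chart  chart p : dom p -> 'rV_dim  around it,
   with inverse  chartV p.  The tangent space at p is represented by 'rV_dim,
   a tangent vector being given by its components in the preferred chart
   of its own base point. *)
Record manifold (R : realType) := Manifold {
  points :> topologicalType;
  dim : nat;
  dom : points -> set points;
  chart : points -> points -> 'rV[R]_dim;
  chartV : points -> 'rV[R]_dim -> points;
  manifold_hausdorff : hausdorff_space points;
  manifold_second_countable : @second_countable points;
  dom_open : forall p, open (dom p);
  dom_self : forall p, dom p p;
  chart_image_open : forall p, open (chart p @` dom p);
  chartK : forall p, {in dom p, cancel (chart p) (chartV p)};
  chart_continuous : forall p q, dom p q -> {for q, continuous (chart p)};
  chartV_continuous : forall p x, (chart p @` dom p) x ->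
    {for x, continuous (chartV p)};
  transition_smooth : forall p q,
    Cinfty (chart p @` (dom p `&` dom q)) (chart q \o chartV p)
}.

Section SmoothMaps.
Variable R : realType.

Definition smooth (M N : manifold R) (F : M -> N) : Prop :=
  continuous F /\
  forall p q, Cinfty (chart p @` (dom p `&` F @^-1` dom q))
                     (chart q \o F \o chartV p).

Definition tmap (M N : manifold R) (F : M -> N) (p : M) (v : 'rV[R]_(dim M))
    : 'rV[R]_(dim N) :=
  'D_v (chart (F p) \o F \o chartV p) (chart p p).

(* components in the chart at p of the vector v tangent at q (q in dom p) *)
Definition tcoord (M : manifold R) (p q : M) (v : 'rV[R]_(dim M))
    : 'rV[R]_(dim M) :=
  'D_v (chart p \o chartV q) (chart q q).

(* the vector field on dom p with constant components y in the chart at p *)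
Definition coord_field (M : manifold R) (p : M) (y : 'rV[R]_(dim M)) (q : M)
    : 'rV[R]_(dim M) :=
  'D_y (chart q \o chartV p) (chart p q).

Definition smooth_fun (M : manifold R) (U : set M) (phi : M -> R) : Prop :=
  forall p, Cinfty (chart p @` (U `&` dom p)) (phi \o chartV p : _ -> R^o).

(* s is smooth over U as a section of the pullback bundle F^*TN. *)
Definition smooth_sec (M N : manifold R) (F : M -> N) (U : set M)
    (s : M -> 'rV[R]_(dim N)) : Prop :=
  forall p q, Cinfty (chart p @` (U `&` dom p `&` F @^-1` dom q))
    (fun x => tcoord q (F (chartV p x)) (s (chartV p x))).

Definition smooth_curve (M : manifold R) (J : set R) (c : R -> M) : Prop :=
  (forall t, J t -> {for t, continuous c}) /\
  forall q, Cinfty (J `&` c @^-1` dom q : set R^o) (chart q \o c).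

Definition velocity (M : manifold R) (c : R -> M) (t : R) : 'rV[R]_(dim M) :=
  derive1 (chart (c t) \o c) t.

Definition inner_of n (G : 'M[R]_n) (x y : 'rV[R]_n) : R :=
  (x *m G *m y^T) 0 0.

(* components in the chart at p of a family of bilinear forms on the tangent
   spaces *)
Definition metric_coord (M : manifold R) (G : M -> 'M[R]_(dim M)) (p : M)
    (a b : 'rV[R]_(dim M)) (x : 'rV[R]_(dim M)) : R^o :=
  let q := chartV p x in
  inner_of (G q) (coord_field p a q) (coord_field p b q).

End SmoothMaps.

Record riemannian (R : realType) := Riemannian {
  rmanifold :> manifold R;
  metric : rmanifold -> 'M[R]_(dim rmanifold);
  metric_sym : forall p, (metric p)^T = metric p;
  metric_pos : forall p x, x != 0 -> 0 < inner_of (metric p) x x;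
  metric_smooth : forall p a b,
    Cinfty (chart p @` dom p) (metric_coord metric p a b)
}.

Section Riemannian.
Variable R : realType.

Definition inner (M : riemannian R) (p : M) (x y : 'rV[R]_(dim M)) : R :=
  inner_of (metric p) x y.

Definition isometry (M N : riemannian R) (g : M -> N) : Prop :=
  [/\ smooth g,
      exists g' : N -> M, [/\ smooth g', cancel g g' & cancel g' g] &
      forall p x y, inner (g p) (tmap g p x) (tmap g p y) = inner p x y].

(* The Christoffel symbols of the Levi-Civita connection at p, in the chart at
   p, as a bilinear map: the lowered components
   (d_a G(b,e_l) + d_b G(a,e_l) - d_l G(a,b)) / 2  are raised by (metric p)^-1. *)
Definition christoffel (M : riemannian R) (p : M) (a b : 'rV[R]_(dim M))
    : 'rV[R]_(dim M) :=
  (\row_l (2^-1 *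
     (('D_a (metric_coord (@metric R M) p b (delta_mx 0 l)) (chart p p) : R)
      + ('D_b (metric_coord (@metric R M) p a (delta_mx 0 l)) (chart p p) : R)
      - ('D_(delta_mx 0 l) (metric_coord (@metric R M) p a b) (chart p p) : R))))
  *m invmx (metric p).

(* The Levi-Civita connection of N, pulled back along F and acting on sections
   of F^*TN.  For F = idfun this is the Levi-Civita connection itself. *)
Definition nabla (M : manifold R) (N : riemannian R) (F : M -> N) (p : M)
    (v : 'rV[R]_(dim M)) (s : M -> 'rV[R]_(dim N)) : 'rV[R]_(dim N) :=
  ('D_v (fun x => tcoord (F p) (F (chartV p x)) (s (chartV p x))) (chart p p)
    : 'rV[R]_(dim N))
  + christoffel (F p) (tmap F p v) (s p).

End Riemannian.

(* Subbundles E of F^*TN for a map F : M -> N, given as families of subspaces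
   E p of T_{F p}N. For F = idfun and E p = setT one gets TM. *)
Section Bundles.
Variables (R : realType) (M N : manifold R) (F : M -> N).
Let m := dim N.
Variable E : M -> set 'rV[R]_m.

Definition tot := {e : M * 'rV[R]_m | E e.1 e.2}.
Definition bpt (e : tot) : M := (sval e).1.
Definition vec (e : tot) : 'rV[R]_m := (sval e).2.

Definition section_over (U : set M) (s : M -> 'rV[R]_m) : Prop :=
  [/\ open U, forall q, U q -> E q (s q) & smooth_sec F U s].

Definition local_frame (U : set M) r (e : 'I_r -> M -> 'rV[R]_m) : Prop :=
  [/\ forall i, section_over U (e i),
      open U,
      forall q (a : 'rV[R]_r), U q -> E q (\sum_i a 0 i *: e i q) &
      forall q v, U q -> E q v ->
        exists! a : 'rV[R]_r, v = \sum_i a 0 i *: e i q].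

Definition is_subbundle : Prop :=
  forall p, exists U r (e : 'I_r -> M -> 'rV[R]_m), U p /\ local_frame U e.

(* Vector bundle homomorphisms E -> E along g : M -> M; smoothness says that
   smooth sections of E are mapped to smooth sections of g^*E. *)
Definition bundle_hom (g : M -> M) (Phi : tot -> tot) : Prop :=
  [/\ forall e, bpt (Phi e) = g (bpt e),
      forall (a : R) (e1 e2 e3 : tot), bpt e1 = bpt e2 -> bpt e2 = bpt e3 ->
        vec e3 = a *: vec e1 + vec e2 ->
        vec (Phi e3) = a *: vec (Phi e1) + vec (Phi e2) &
      forall U s s', section_over U s ->
        (forall e, U (bpt e) -> vec e = s (bpt e) ->
           vec (Phi e) = s' (bpt e)) ->
        smooth_sec (F \o g) U s'].

Definition bundle_iso (g : M -> M) (Phi : tot -> tot) : Prop :=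
  bundle_hom g Phi /\
  exists g' Psi, [/\ bundle_hom g' Psi, cancel Phi Psi & cancel Psi Phi].

(* G is thought of as a group of transformations of M *)
Definition bundle_action (G : set (M -> M))
    (alpha : {g | G g} -> tot -> tot) : Prop :=
  [/\ forall g, bundle_iso (sval g) (alpha g),
      forall g e, sval g = idfun -> alpha g e = e &
      forall g h gh e, sval gh = sval g \o sval h ->
        alpha gh e = alpha g (alpha h e)].

(* D p v s  is the derivative at p, in direction v, of the section s, which
   needs to be defined near p only. *)
Definition connection_op := forall p : M, 'rV[R]_(dim M) -> (M -> 'rV[R]_m) -> 'rV[R]_m.

Definition is_connection (D : connection_op) : Prop :=
  [/\ forall U p v s, section_over U s -> U p -> E p (D p v s),
      forall U p (a : R) v w s, section_over U s -> U p ->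
        D p (a *: v + w) s = a *: D p v s + D p w s,
      forall U p v s s', section_over U s -> section_over U s' -> U p ->
        D p v (fun q => s q + s' q) = D p v s + D p v s',
      forall U p v s (phi : M -> R), section_over U s -> smooth_fun U phi ->
        U p ->
        D p v (fun q => phi q *: s q) =
          ('D_v (phi \o chartV p : _ -> R^o) (chart p p) : R) *: s p
          + phi p *: D p v s &
      (forall U p v s s', section_over U s -> section_over U s' -> U p ->
        (forall q, U q -> s q = s' q) -> D p v s = D p v s') /\
      (forall U (X : M -> 'rV[R]_(dim M)) s, section_over U s ->
        smooth_sec (idfun : M -> M) U X -> smooth_sec F U (fun q => D q (X q) s))].

(* s is a D-parallel section of E along its base curve c = bpt o s, which is
   smooth on the open interval J. In a local frame (e_i) with s = sum a_i e_i
   this means  sum (a_i' e_i + a_i D_{c'} e_i) = 0. *)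
Definition parallel_along (D : connection_op) (J : set R) (s : R -> tot)
    : Prop :=
  [/\ open J, is_interval J, smooth_curve J (bpt \o s) &
   forall t, J t ->
     exists U r (e : 'I_r -> M -> 'rV[R]_m) (a : 'I_r -> R -> R),
     [/\ U (bpt (s t)), local_frame U e,
         \forall u \near t, vec (s u) = \sum_i a i u *: e i (bpt (s u)),
         forall i, derivable (a i) t 1 &
         \sum_i (derive1 (a i) t *: e i (bpt (s t))
                 + a i t *: D (bpt (s t)) (velocity (bpt \o s) t) (e i)) = 0]].

Definition parallel_map (D : connection_op) (Phi : tot -> tot) : Prop :=
  forall J s, parallel_along D J s -> parallel_along D J (Phi \o s).

(* beta makes E a homogeneous vector bundle (w.r.t. the group G) *)
Definition homogeneous_via (G : set (M -> M)) (beta : {g | G g} -> tot -> tot)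
    : Prop :=
  is_subbundle /\ bundle_action beta.

End Bundles.

Arguments bpt {R M N E}.
Arguments vec {R M N E}.
Arguments bundle_hom {R M N} F E.
Arguments bundle_iso {R M N} F E.
Arguments bundle_action {R M N} F E G.
Arguments is_connection {R M N} F E.
Arguments parallel_along {R M N} F E.
Arguments parallel_map {R M N} F E.
Arguments homogeneous_via {R M N} F E G.
Arguments tot {R M} N E.

Definition fibre_isometric (R : realType) (M : manifold R) (N : riemannian R)
    (F : M -> N) (E : M -> set 'rV[R]_(dim N)) (Phi : tot N E -> tot N E)
    : Prop :=
  forall e1 e2, bpt e1 = bpt e2 ->
    inner (F (bpt (Phi e1))) (vec (Phi e1)) (vec (Phi e2)) =
    inner (F (bpt e1)) (vec e1) (vec e2).

Definition tangent (R : realType) (M : manifold R) : M -> set 'rV[R]_(dim M) :=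
  fun=> setT.
Arguments tangent {R} M.

(* Riemannian symmetric spaces: sym p is the geodesic symmetry at p, i.e. the
   (unique) isometry fixing p with differential -id at p. *)
Record symmetric_space (R : realType) := SymmetricSpace {
  sriemannian :> riemannian R;
  sspace_connected : connected [set: sriemannian];
  sym : sriemannian -> sriemannian -> sriemannian;
  sym_isometry : forall p, isometry (sym p);
  sym_fix : forall p, sym p p = p;
  sym_reflection : forall p v, tmap (sym p) p v = - v
}.

Section SymmetricSpaces.
Variable R : realType.

Definition simply_connected (T : topologicalType) : Prop :=
  (forall x y : T, exists c : R -> T,
     [/\ {within `[0, 1], continuous c}, c 0 = x & c 1 = y]) /\
  forall c : R -> T, {within `[0, 1], continuous c} -> c 0 = c 1 ->
    exists H : R * R -> T,
      {within `[0, 1] `*` `[0, 1], continuous H} /\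
      forall t, `[0, 1]%classic t ->
        [/\ H (0, t) = c t, H (1, t) = c 0, H (t, 0) = c 0 & H (t, 1) = c 0].

(* Smooth loops give the same holonomy group as piecewise smooth ones, since
   parallel transport does not depend on the parametrization. *)
Definition holonomy_invariant (M : riemannian R) (p : M)
    (W : {vspace 'rV[R]_(dim M)}) : Prop :=
  forall (J : set R) (s : R -> tot M (tangent M)),
    parallel_along (idfun : M -> M) (tangent M)
      (nabla (idfun : M -> M)) J s ->
    `[0, 1]%classic `<=` J -> bpt (s 0) = p -> bpt (s 1) = p ->
    vec (s 0) \in W -> vec (s 1) \in W.

(* The bound on the dimension excludes points and the Euclidean line, which do
   not count as irreducible symmetric spaces. *)
Definition irreducible_space (M : riemannian R) : Prop :=
  (1 < dim M)%N /\
  forall (p : M) (W : {vspace 'rV[R]_(dim M)}),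
    holonomy_invariant p W -> W = 0%VS \/ W = fullv.

(* A Riemannian product is described by its projections pi i; a smooth bijection
   preserving the metric between manifolds of the same dimension is an
   isometry. *)
Definition isometric_to_product (M : riemannian R) k
    (Mi : 'I_k -> riemannian R) : Prop :=
  exists pi : forall i, M -> Mi i,
    [/\ forall i, smooth (pi i),
        forall y : (forall i, Mi i), exists! p, forall i, pi i p = y i,
        dim M = (\sum_i dim (Mi i))%N &
        forall (p : M) x y, inner p x y =
          \sum_i inner (pi i p) (tmap (pi i) p x) (tmap (pi i) p y)].

(* the identity component of the isometry group *)
Definition isom0 (M : riemannian R) : set (M -> M) :=
  connected_component
    ([set g | isometry (g : M -> M)] : set {compact-open, M -> M}) idfun.
Arguments isom0 M : clear implicits.

Inductive Sym (M : symmetric_space R) : (M -> M) -> Prop :=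
| Sym_gen p : Sym (sym p)
| Sym_id : Sym idfun
| Sym_comp g h : Sym g -> Sym h -> Sym (g \o h)
| Sym_inv g g' : Sym g -> cancel g g' -> cancel g' g -> Sym g'.
Arguments Sym M : clear implicits.

(* Elements of the Lie algebra of I(M) are represented by the vector fields X
   they induce on M; exp (tX) is then the flow theta_t of X. *)
Definition isometric_flow (M : riemannian R) (X : M -> 'rV[R]_(dim M))
    (theta : R -> M -> M) : Prop :=
  [/\ smooth_sec (idfun : M -> M) setT X,
      forall t, isometry (theta t),
      theta 0 = idfun,
      forall t u, theta (t + u) = theta t \o theta u &
      forall q, smooth_curve setT (theta ^~ q) /\
        forall t, velocity (theta ^~ q) t = X (theta t q)].

(* the (-1)-eigenspace of Ad (sym o); Ad g X is the vector field g_* X *)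
Definition cartan_p (M : symmetric_space R) (o : M) (X : M -> 'rV[R]_(dim M)) : Prop :=
  (exists theta, isometric_flow X theta) /\
  forall q, tmap (sym o) q (X q) = - X (sym o q).

Definition canonical_connection (M : symmetric_space R) (o : M)
    (N : manifold R) (F : M -> N) (E : M -> set 'rV[R]_(dim N))
    (beta : {g | isom0 M g} -> tot N E -> tot N E)
    (D : connection_op M N) : Prop :=
  is_connection F E D /\
  forall (g : {g | isom0 M g}) X theta (gamma : R -> {g | isom0 M g}) v,
    cartan_p o X -> isometric_flow X theta ->
    (forall t, sval (gamma t) = sval g \o theta t) -> bpt v = o ->
    parallel_along F E D setT (fun t => beta (gamma t) v).

Definition restrict_action (M : symmetric_space R) (T : Type)
    (sub : isom0 M `<=` Sym M) (alpha : {g | Sym M g} -> T -> T)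
    (g : {g | isom0 M g}) : T -> T :=
  alpha (exist _ (sval g) (sub _ (proj2_sig g))).

End SymmetricSpaces.
Arguments isom0 {R} M.
Arguments Sym {R} M.
Arguments simply_connected R T : clear implicits.

Section Immersions.
Variables (R : realType) (M N : riemannian R) (f : M -> N).

Definition isometric_immersion : Prop :=
  smooth f /\
  forall p x y, inner (f p) (tmap f p x) (tmap f p y) = inner p x y.

(* Second fundamental form, by the Gauss formula
   nabla^N_x df(Y) = df(nabla^M_x Y) + h(x, Y), where Y extends y. *)
Definition h (p : M) (x y : 'rV[R]_(dim M)) : 'rV[R]_(dim N) :=
  nabla f p x (fun q => tmap f q (coord_field p y q))
  - tmap f p (nabla (idfun : M -> M) p x (coord_field p y)).

Definition normal (p : M) : set 'rV[R]_(dim N) :=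
  [set u | forall x : 'rV[R]_(dim M), inner (f p) (tmap f p x) u = 0].

(* orthogonal projection of T_{f p}N onto the normal space *)
Definition normal_part (p : M) (w : 'rV[R]_(dim N)) : 'rV[R]_(dim N) :=
  xget 0 [set u | normal p u /\ exists x : 'rV[R]_(dim M), w = tmap f p x + u].

Definition nabla_normal (p : M) (v : 'rV[R]_(dim M)) (s : M -> 'rV[R]_(dim N))
    : 'rV[R]_(dim N) :=
  normal_part p (nabla f p v s).

Definition parallel_immersion : Prop :=
  forall X Y Z : M -> 'rV[R]_(dim M),
    smooth_sec (idfun : M -> M) setT X ->
    smooth_sec (idfun : M -> M) setT Y ->
    smooth_sec (idfun : M -> M) setT Z ->
    forall p, nabla_normal p (X p) (fun q => h q (Y q) (Z q)) =
      h p (nabla (idfun : M -> M) p (X p) Y) (Z p)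
      + h p (Y p) (nabla (idfun : M -> M) p (X p) Z).

Definition normal1 (p : M) : set 'rV[R]_(dim N) :=
  [set u | exists r (a : 'I_r -> R) (x y : 'I_r -> 'rV[R]_(dim M)),
     u = \sum_i a i *: h p (x i) (y i)].

Definition osc (p : M) : set 'rV[R]_(dim N) :=
  [set u | exists (x : 'rV[R]_(dim M)) xi, normal1 p xi /\ u = tmap f p x + xi].

End Immersions.

Section Sigma.
Variables (R : realType) (M : symmetric_space R) (N : riemannian R).
Variable f : M -> N.

(* S is the map Sigma_p *)
Definition is_Sigma (p : M) (S : tot N (osc f) -> tot N (osc f)) : Prop :=
  [/\ involutive S,
      bundle_hom f (osc f) (sym p) S,
      fibre_isometric f S,
      parallel_map f (osc f) (nabla f) S &
      forall e, bpt e = p ->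
        (normal1 f p (vec e) -> vec (S e) = vec e) /\
        (forall x : 'rV[R]_(dim M), vec e = tmap f p x -> vec (S e) = - vec e)].

(* alpha is an action by isometric, parallel vector bundle isomorphisms of
   the osculating bundle, with alpha (sym p, v) = Sigma_p v for v over p *)
Definition natural_action (Sigma : M -> tot N (osc f) -> tot N (osc f))
    (alpha : {g | Sym M g} -> tot N (osc f) -> tot N (osc f)) : Prop :=
  [/\ bundle_action f (osc f) (Sym M) alpha,
      forall g, fibre_isometric f (alpha g),
      forall g, parallel_map f (osc f) (nabla f) (alpha g) &
      forall p g e, sval g = sym p -> bpt e = p -> alpha g e = Sigma p e].

End Sigma.

(* Main.v *)
(* Along any curve in M, the sections h(E_i, E_j) built from a parallel frame E of
   TM have constant inner products, because h is parallel.  So the first normal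
   spaces have locally constant rank, the shape operators have constant components
   in E, and a parallel section of the osculating bundle, written in the generators
   df(E_k) and h(E_i, E_j), solves a linear differential equation which depends only
   on the velocity of the curve in E and on the numbers <h(E_i, E_j), h(E_k, E_l)>.
   Consequently a parallel isometric bundle map of the osculating bundle over an
   isometry s of M which maps df(x) to df(ds x) and h(x, y) to h(ds x, ds y) at one
   point does so at every point.

   Sigma_p has this form at p, since h(-x, -y) = h(x, y), hence everywhere, and the
   form is inherited by composites and inverses.  So each g in Sym(M) has exactly
   one lift of this form, which gives the action together with its uniqueness, its
   splitting and the invariance of h.

   For (d), let theta be the flow of X in p^M.  As Ad(sym o) X = -X, the isometry
   theta_s o (sym o) o theta_-s reverses the orbit theta_t(o) about its point at
   time s and acts as -1 there; comparing it with sym o shows that d(theta_2s) is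
   the parallel transport along the orbit.  Hence d(theta_t) x is parallel, and so
   is h(d(theta_t) x, d(theta_t) y) in the normal bundle. *)

From mathcomp Require Import all_boot all_order all_algebra.
From mathcomp Require Import all_classical all_reals all_analysis.
From mathcomp Require Import ring lra.
Require Import Defs.
Set Implicit Arguments.
Unset Strict Implicit.
Unset Printing Implicit Defensive.
Import Order.TTheory GRing.Theory Num.Theory.
Import numFieldNormedType.Exports.
Local Open Scope classical_set_scope.
Local Open Scope ring_scope.

(* Two obstacles shape the proof. Tangent vectors are stored in the preferred chart of their own
   base point, and that chart depends on the point without any regularity. Hence nothing is
   differentiated before it is moved to one fixed chart, and the covariant derivative is taken for
   fields along an arbitrary map from a normed space, which treats curves and sections read in a
   chart at once. Secondly, the generators df(E_k), h(E_i, E_j) are linearly dependent, already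
   because h is symmetric. So a parallel section is not determined by an equation for its
   components: the differential equation is solved for a choice of coefficients, and uniqueness
   comes from the constant length of parallel sections. The curves needed for rigidity are straight
   segments in chart balls. They can be run in both directions, so naturality of a bundle map is an
   open condition and so is its failure; connectedness of M does the rest. As parallelism of f is
   assumed for global vector fields only, coordinate fields have to be cut off before it applies to
   them. *)
#[local] Hint Resolve dom_self : core.

(** * Calculus *)

Section DirectionalDerivatives.
Variable R : realType.
Implicit Types V W : normedModType R.

Lemma differentiable_near V W (f g : V -> W) x :
  (\near x, f x = g x) -> differentiable f x -> differentiable g x.
Proof.
move=> fg df.
pose h y := g y - f y.
have h0 : \near x, h x = 0.
  by apply: filterS fg => y; rewrite /h => ->; rewrite subrr.
have hx : h x = 0 by exact: (nbhs_singleton h0).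
have ho : h \o shift x = cst (h x) + (0 : V -> W) +o_0 id.
  have h0' : \forall y \near (0 : V), h (y + x) = 0.
    by move: h0; rewrite (near_shift 0) /= subr0.
  apply: (proj2 (eqaddoP _ _ _ _)) => e e0; apply: filterS h0' => y hy.
  by rewrite !fctE /= hy hx /cst addr0 subr0 normr0 mulr_ge0 // ltW.
have dh0 : 'd h x = 0 :> (V -> W).
  by apply/diff_unique => // y; exact: cst_continuous.
have dh : differentiable h x.
  apply/diff_locallyP; rewrite dh0; split=> // y; exact: cst_continuous.
have -> : g = f + h by apply/funext => y; rewrite fctE /h addrC subrK.
exact: differentiableD.
Qed.

Lemma derive_comp V W (U : normedModType R) (f : V -> W) (g : W -> U) x v :
  differentiable f x -> differentiable g (f x) ->
  'D_v (g \o f) x = 'D_('D_v f x) g (f x).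
Proof.
move=> df dg; rewrite !deriveE //; last exact: differentiable_comp.
by rewrite diff_comp.
Qed.

Lemma derive_linear V W (f : V -> W) x (a : R) v w : differentiable f x ->
  'D_(a *: v + w) f x = a *: 'D_v f x + 'D_w f x.
Proof. by move=> df; rewrite !deriveE // linearP. Qed.

Lemma derive_suml V W (f : V -> W) x I r (P : pred I) (a : I -> R) (v : I -> V) :
  differentiable f x ->
  'D_(\sum_(i <- r | P i) a i *: v i) f x =
  \sum_(i <- r | P i) a i *: 'D_(v i) f x.
Proof.
move=> df; rewrite deriveE // linear_sum; apply: eq_bigr => i _.
by rewrite linearZ deriveE.
Qed.

Lemma derive_row n W (f : 'rV[R]_n -> W) x v : differentiable f x ->
  'D_v f x = \sum_i v 0 i *: 'D_(delta_mx 0 i) f x.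
Proof. by move=> df; rewrite [in LHS](row_sum_delta v) derive_suml. Qed.

Lemma derive_sum_fun V W I r (P : pred I) (f : I -> V -> W) x v :
  (forall i, P i -> differentiable (f i) x) ->
  differentiable (fun y => \sum_(i <- r | P i) f i y) x /\
  'D_v (fun y => \sum_(i <- r | P i) f i y) x = \sum_(i <- r | P i) 'D_v (f i) x.
Proof.
move=> df; elim: r => [|i r [IHd IHD]].
  under eq_fun do rewrite big_nil; rewrite big_nil; split.
    exact: differentiable_cst.
  exact: derive_cst.
under eq_fun do rewrite big_cons; rewrite big_cons; case: ifP => // Pi; split.
  exact: (differentiableD (df i Pi) IHd).
by rewrite -IHD; apply: deriveD; apply: diff_derivable => //; exact: df.
Qed.

Lemma differentiable_sumf V W I r (P : pred I) (f : I -> V -> W) x :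
  (forall i, P i -> differentiable (f i) x) ->
  differentiable (fun y => \sum_(i <- r | P i) f i y) x.
Proof. by move=> df; case: (derive_sum_fun r 0 df). Qed.

Lemma derive_sumf V W I r (P : pred I) (f : I -> V -> W) x v :
  (forall i, P i -> differentiable (f i) x) ->
  'D_v (fun y => \sum_(i <- r | P i) f i y) x = \sum_(i <- r | P i) 'D_v (f i) x.
Proof. by move=> df; case: (derive_sum_fun r v df). Qed.

Lemma differentiable_addf V W (f g : V -> W) x :
  differentiable f x -> differentiable g x ->
  differentiable (fun y => f y + g y) x.
Proof. exact: differentiableD. Qed.

Lemma derive_addf V W (f g : V -> W) x v :
  differentiable f x -> differentiable g x ->
  'D_v (fun y => f y + g y) x = 'D_v f x + 'D_v g x.
Proof. by move=> df dg; apply: deriveD; exact: diff_derivable. Qed.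

Lemma differentiable_oppf V W (f : V -> W) x :
  differentiable f x -> differentiable (fun y => - f y) x.
Proof. exact: differentiableN. Qed.

Lemma derive_oppf V W (f : V -> W) x v : differentiable f x ->
  'D_v (fun y => - f y) x = - 'D_v f x.
Proof. by move=> df; apply: deriveN; exact: diff_derivable. Qed.

Lemma differentiable_subf V W (f g : V -> W) x :
  differentiable f x -> differentiable g x ->
  differentiable (fun y => f y - g y) x.
Proof. exact: differentiableB. Qed.

Lemma derive_subf V W (f g : V -> W) x v :
  differentiable f x -> differentiable g x ->
  'D_v (fun y => f y - g y) x = 'D_v f x - 'D_v g x.
Proof. by move=> df dg; apply: deriveB; exact: diff_derivable. Qed.

Lemma differentiable_mulf V (f g : V -> R^o) x :
  differentiable f x -> differentiable g x ->
  differentiable (fun y => f y * g y : R^o) x.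
Proof. exact: differentiableM. Qed.

Lemma derive_mulf V (f g : V -> R^o) x v :
  differentiable f x -> differentiable g x ->
  'D_v (fun y => f y * g y : R^o) x = 'D_v f x * g x + f x * 'D_v g x.
Proof.
move=> df dg; rewrite addrC [X in _ + X]mulrC.
by apply: deriveM; exact: diff_derivable.
Qed.

Lemma differentiable_entry V n (f : V -> 'rV[R]_n) i x :
  differentiable f x -> differentiable (fun y => f y 0 i : R^o) x.
Proof.
move=> df; apply: (differentiable_comp df (differentiable_coord _ _ _)).
Qed.

Lemma derive_entry V n (f : V -> 'rV[R]_n) i x v : differentiable f x ->
  ('D_v f x) 0 i = 'D_v (fun y => f y 0 i : R^o) x.
Proof. by move=> df; rewrite derive_mx ?mxE //; exact: diff_derivable. Qed.

Lemma differentiable_row V n (f : V -> 'rV[R]_n) x :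
  (forall i, differentiable (fun y => f y 0 i : R^o) x) -> differentiable f x.
Proof.
move=> df.
have -> : f = fun y => \sum_i f y 0 i *: (delta_mx 0 i : 'rV[R]_n).
  by apply/funext => y; exact: row_sum_delta.
apply: differentiable_sumf => i _.
exact: (@differentiableZl R V _ (fun y => f y 0 i) (delta_mx 0 i) x (df i)).
Qed.

Lemma differentiable_scale_row V n (k : V -> R^o) (f : V -> 'rV[R]_n) x :
  differentiable k x -> differentiable f x ->
  differentiable (fun y => k y *: f y) x.
Proof.
move=> dk df; apply: differentiable_row => i.
under eq_fun do rewrite mxE; apply: differentiable_mulf => //.
exact: differentiable_entry.
Qed.

Lemma derive_scale_row V n (k : V -> R^o) (f : V -> 'rV[R]_n) x v :
  differentiable k x -> differentiable f x ->
  'D_v (fun y => k y *: f y) x = 'D_v k x *: f x + k x *: 'D_v f x.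
Proof.
move=> dk df; apply/rowP => i; rewrite derive_entry; last first.
  exact: differentiable_scale_row.
under eq_fun do rewrite mxE; rewrite derive_mulf ?mxE //.
  by rewrite derive_entry.
exact: differentiable_entry.
Qed.

Lemma differentiable_idf V (x : V) : differentiable (fun y : V => y) x.
Proof. exact: (@ex_diff _ _ _ _ _ _ _ (is_diff_id x)). Qed.

Lemma differentiable_line V (x v : V) (t : R) :
  differentiable (fun t : R^o => x + t *: v) t.
Proof.
apply: differentiable_addf; first exact: differentiable_cst.
exact: (@differentiableZl R R^o V (fun y => y) v t (differentiable_idf _)).
Qed.

Lemma derive_line V (x v : V) (t : R) : 'D_1 (fun t : R^o => x + t *: v) t = v.
Proof.
have dl : differentiable (fun t : R^o => t *: v) t.
  exact: (@differentiableZl R R^o V (fun y => y) v t (differentiable_idf _)).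
rewrite derive_addf //.
rewrite derive_cst add0r deriveE //.
rewrite (@diffZl R R^o V (fun y => y) v t (differentiable_idf _)) -deriveE.
  by rewrite derive_id scale1r.
exact: differentiable_idf.
Qed.

Lemma MVT_line V (f : V -> R^o) x v (s : R) : 0 <= s ->
  (forall t, 0 <= t <= s -> differentiable f (x + t *: v)) ->
  exists2 t, 0 <= t <= s & f (x + s *: v) - f x = s * 'D_v f (x + t *: v).
Proof.
move=> s0 df; pose g (t : R^o) : R^o := f (x + t *: v).
have dg t : 0 <= t <= s -> differentiable g t.
  move=> ht; apply: (differentiable_comp (differentiable_line x v t)).
  exact: df.
have gE t : 0 <= t <= s -> 'D_1 g t = 'D_v f (x + t *: v).
  move=> ht; rewrite (derive_comp _ (differentiable_line x v t)) ?derive_line //.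
  exact: df.
have [t|t|c] := @MVT_segment R g (fun t => 'D_1 g t) 0 s s0.
- rewrite in_itv /= => /andP[t0 ts]; apply: derivableP.
  by apply/derivable1_diffP/dg; rewrite !ltW.
- apply: derivable_within_continuous => u; rewrite in_itv /= => hu.
  exact/derivable1_diffP/dg.
- rewrite in_itv /= => hc; rewrite /g scale0r addr0 subr0 => ->.
  by exists c => //; rewrite mulrC -gE.
Qed.

End DirectionalDerivatives.

(** * Calculus of C^k maps and symmetry of second derivatives *)

Section Smoothness.
Variable R : realType.
Implicit Types V W : normedModType R.

Lemma open_eq_near V W (U : set V) (f g : V -> W) x : open U -> U x ->
  (forall y, U y -> f y = g y) -> \near x, f x = g x.
Proof.
by move=> oU Ux fg; apply: filterS (open_nbhs_nbhs (conj oU Ux)) => y /fg.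
Qed.

Lemma Ck_eq V W k (U : set V) (f g : V -> W) : open U ->
  (forall y, U y -> f y = g y) -> Ck k U f -> Ck k U g.
Proof.
move=> oU; elim: k f g => [|k IH] f g fg /=.
  move=> cf x Ux; have fgx := open_eq_near oU Ux fg.
  rewrite /prop_for /continuous_at -(fg _ Ux).
  apply: cvg_trans (cf x Ux); apply: near_eq_cvg.
  by apply: filterS fgx => y ->.
move=> [df cf]; split=> [x Ux|v].
  exact: (differentiable_near (open_eq_near oU Ux fg) (df x Ux)).
apply: IH (cf v) => x Ux; exact: near_eq_derive (open_eq_near oU Ux fg).
Qed.

Lemma Ck_sub V W k (U U' : set V) (f : V -> W) : U' `<=` U ->
  Ck k U f -> Ck k U' f.
Proof.
move=> UU; elim: k f => [|k IH] f /= cf; first by move=> x /UU /cf.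
by case: cf => df cf; split=> [x /UU /df|v] //; apply: IH.
Qed.

Lemma Ck_pred V W k (U : set V) (f : V -> W) : Ck k.+1 U f -> Ck k U f.
Proof.
elim: k f => [|k IH] f /= [df cf].
  by move=> x Ux; exact/differentiable_continuous/df.
by split=> // v; apply: IH.
Qed.

Lemma Ck_local V W k (U : set V) (f : V -> W) :
  (forall x, U x -> exists2 U', U' x & Ck k U' f) -> Ck k U f.
Proof.
elim: k f => [|k IH] f /= H.
  by move=> x /H[U' U'x]; apply.
split=> [x /H[U' U'x [df _]]|v]; first exact: df.
by apply: IH => x /H[U' U'x [_ cf]]; exists U'.
Qed.

Lemma Ck_cst V W k (U : set V) (c : W) : Ck k U (fun=> c).
Proof.
elim: k c => [|k IH] c /=; first by move=> x _; exact: cst_continuous.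
split=> [x _|v]; first exact: differentiable_cst.
rewrite (_ : (fun x => _) = fun=> (0 : W)) //.
by apply/funext => x; exact: derive_cst.
Qed.

Lemma Ck_add V W k (U : set V) (f g : V -> W) : open U ->
  Ck k U f -> Ck k U g -> Ck k U (fun y => f y + g y).
Proof.
move=> oU; elim: k f g => [|k IH] f g /=.
  by move=> cf cg x Ux; apply: continuousD; [exact: cf|exact: cg].
move=> [df cf] [dg cg]; split=> [x Ux|v].
  by apply: differentiable_addf; [exact: df|exact: dg].
apply: (Ck_eq oU _ (IH _ _ (cf v) (cg v))) => x Ux.
by rewrite derive_addf //; [exact: df|exact: dg].
Qed.

Lemma Ck_sum V W k (U : set V) I r (P : pred I) (f : I -> V -> W) : open U ->
  (forall i, P i -> Ck k U (f i)) -> Ck k U (fun y => \sum_(i <- r | P i) f i y).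
Proof.
move=> oU cf; elim: r => [|i r IH].
  by under eq_fun do rewrite big_nil; exact: Ck_cst.
under eq_fun do rewrite big_cons; case Pi : (P i) => //.
exact: (Ck_add oU (cf i Pi) IH).
Qed.

Lemma Ck_mul V k (U : set V) (f g : V -> R^o) : open U ->
  Ck k U f -> Ck k U g -> Ck k U (fun y => f y * g y : R^o).
Proof.
move=> oU; elim: k f g => [|k IH] f g.
  by move=> cf cg x Ux; apply: continuousM; [exact: cf|exact: cg].
move=> cf cg; have [df Cf] := cf; have [dg Cg] := cg.
split=> [x Ux|v].
  by apply: differentiable_mulf; [exact: df|exact: dg].
have := Ck_add oU (IH _ _ (Cf v) (Ck_pred cg)) (IH _ _ (Ck_pred cf) (Cg v)).
by apply: Ck_eq => // x Ux; rewrite derive_mulf //; [exact: df|exact: dg].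
Qed.

Lemma Ck_opp V W k (U : set V) (f : V -> W) : open U ->
  Ck k U f -> Ck k U (fun y => - f y).
Proof.
move=> oU; elim: k f => [|k IH] f /=.
  by move=> cf x Ux; apply: continuousN; exact: cf.
move=> [df cf]; split=> [x Ux|v]; first by apply: differentiable_oppf; exact: df.
by apply: (Ck_eq oU _ (IH _ (cf v))) => x Ux; rewrite derive_oppf //; exact: df.
Qed.

Lemma Ck_inv V k (U : set V) (f : V -> R^o) : open U ->
  (forall x, U x -> f x != 0) -> Ck k U f -> Ck k U (fun y => (f y)^-1 : R^o).
Proof.
move=> oU f0; elim: k => [|k IH] cf.
  by move=> x Ux; apply: continuousV; [exact: f0|exact: cf].
have [df Cf] := cf; split=> [x Ux|v].
  by apply: differentiableV; [exact: df|exact: f0].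
have iC := IH (Ck_pred cf).
apply: (Ck_eq oU _ (Ck_opp oU (Ck_mul oU (Ck_mul oU iC iC) (Cf v)))) => x Ux.
rewrite deriveV ?f0 //; last exact/diff_derivable/df.
by rewrite -invfM -expr2 scaleNr.
Qed.

Lemma Ck_entry V k (U : set V) n (f : V -> 'rV[R]_n) i : open U ->
  Ck k U f -> Ck k U (fun y => f y 0 i : R^o).
Proof.
move=> oU; elim: k f => [|k IH] f /=.
  move=> cf x Ux; apply: (@continuous_comp _ _ _ f (fun M : 'rV[R]_n => M 0 i)).
    exact: cf.
  exact: coord_continuous.
move=> [df cf]; split=> [x Ux|v]; first by apply: differentiable_entry; exact: df.
by apply: (Ck_eq oU _ (IH _ (cf v))) => x Ux; rewrite -derive_entry //; exact: df.
Qed.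

Lemma continuous_row (V : topologicalType) n (f : V -> 'rV[R]_n) (x : V) :
  (forall i, {for x, continuous (fun y => f y 0 i : R^o)}) ->
  {for x, continuous f}.
Proof.
move=> H; apply/cvgrPdist_le => e e0; near=> y.
rewrite /Num.Def.normr /= mx_normrE (bigmax_le _ (ltW e0)) //= => i _.
rewrite !mxE ord1; move: i; near: y; apply: filter_forall => /= i.
exact: ((cvgrPdist_le _ _).1 (H i.2)).
Unshelve. all: by end_near. Qed.

Lemma Ck_row V k (U : set V) n (f : V -> 'rV[R]_n) : open U ->
  (forall i, Ck k U (fun y => f y 0 i : R^o)) -> Ck k U f.
Proof.
move=> oU; elim: k f => [|k IH] f /= H.
  by move=> x Ux; apply: continuous_row => i; exact: H.
have df x : U x -> differentiable f x.
  by move=> Ux; apply: differentiable_row => i; case: (H i) => + _; apply.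
split=> // v; apply: IH => i; case: (H i) => _ /(_ v).
by apply: (Ck_eq oU) => x Ux; rewrite derive_entry //; exact: df.
Qed.

(** Induction on [k] by the chain rule in coordinates: a directional derivative of [g \o f] is a
    finite sum of products of entries of ['D_v f] with partial derivatives of [g] composed with [f],
    to which the induction hypothesis applies. This is why the intermediate space is a space of row
    vectors. *)
Lemma Ck_comp V k (U : set V) n (U' : set 'rV[R]_n) (f : V -> 'rV[R]_n)
    (g : 'rV[R]_n -> R^o) : open U -> open U' -> U `<=` f @^-1` U' ->
  Ck k U f -> Ck k U' g -> Ck k U (g \o f).
Proof.
move=> oU oU' UU'; elim: k g => [|k IH] g.
  by move=> cf cg x Ux; apply: continuous_comp; [exact: cf|exact/cg/UU'].
move=> cf cg; have [df Cf] := cf; have [dg Cg] := cg.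
split=> [x Ux|v]; first by apply: differentiable_comp; [exact: df|exact/dg/UU'].
have H i := Ck_mul oU (Ck_entry i oU (Cf v)) (IH _ (Ck_pred cf) (Cg (delta_mx 0 i))).
have S := @Ck_sum V R^o k U _ (index_enum _) xpredT _ oU (fun i _ => H i).
apply: (Ck_eq oU _ S) => x Ux.
rewrite (derive_comp _ (df _ Ux) (dg _ (UU' _ Ux))).
by rewrite (derive_row _ (dg _ (UU' _ Ux))).
Qed.

Lemma Ck_comp1 V k (U : set V) (U' : set R^o) (f : V -> R^o)
    (g : R^o -> R^o) : open U -> open U' -> U `<=` f @^-1` U' ->
  Ck k U f -> Ck k U' g -> Ck k U (g \o f).
Proof.
move=> oU oU' UU'; elim: k g => [|k IH] g.
  by move=> cf cg x Ux; apply: continuous_comp; [exact: cf|exact/cg/UU'].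
move=> cf cg; have [df Cf] := cf; have [dg Cg] := cg.
split=> [x Ux|v]; first by apply: differentiable_comp; [exact: df|exact/dg/UU'].
have H := Ck_mul oU (Cf v) (IH _ (Ck_pred cf) (Cg 1)).
apply: (Ck_eq oU _ H) => x Ux.
have dgx := dg _ (UU' _ Ux); rewrite (derive_comp _ (df _ Ux) dgx).
have := derive_linear ('D_v f x) (1 : R^o) 0 dgx.
by rewrite derive0 !addr0 [_ *: (1 : R^o)]mulr1 => ->.
Qed.

Lemma Ck_id k (U : set R^o) : Ck k U (fun x : R^o => x).
Proof.
case: k => [|k]; first by move=> x _; exact: cvg_id.
split=> [x _|v]; first exact: differentiable_idf.
have -> : 'D_v (fun x : R^o => x) = fun=> v; last exact: Ck_cst.
by apply/funext => x; exact: derive_id.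
Qed.

Lemma Ck_coord k n (U : set 'rV[R]_n) i : Ck k U (fun x : 'rV[R]_n => x 0 i : R^o).
Proof.
case: k => [|k]; first by move=> x _; exact: coord_continuous.
split=> [x _|v]; first exact: differentiable_coord.
have -> : 'D_v (fun x : 'rV[R]_n => x 0 i : R^o) = fun=> v 0 i; last exact: Ck_cst.
apply/funext => x; rewrite -derive_entry; last exact: differentiable_idf.
by rewrite derive_id.
Qed.

(** The mixed second difference of [f] over the parallelogram spanned by
    [s v] and [s w] approximates both mixed second derivatives. *)
Lemma derive_derive_diff V (U : set V) (f : V -> R^o) x v w : open U -> U x ->
  Ck 2 U f -> forall e, 0 < e -> \forall s \near (0:R)^'+,
  `|(f (x + s *: v + s *: w) - f (x + s *: v) - (f (x + s *: w) - f x)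
    - s ^+ 2 * 'D_w ('D_v f) x : R)| <= s ^+ 2 * e.
Proof.
move=> oU Ux [df Cf] e e0.
have [dDf CDf] := Cf v.
have cD : {for x, continuous ('D_w ('D_v f))} by exact: CDf.
have nU : \near x, U x by apply: open_nbhs_nbhs.
have nG : nbhs x (U `&` [set y | `|'D_w ('D_v f) x - 'D_w ('D_v f) y| <= e]).
  by apply: filterI nU _; exact: ((cvgrPdist_le _ _).1 cD e e0).
have /nbhs_ballP[r /= r0 hr] := nG.
(* For [0 <= t, u <= s < r / c] the point [x + t *: v + u *: w] stays in the ball of radius [r]; the
   summand [1] keeps [c] positive when [v] and [w] vanish. *)
pose c := `|v| + `|w| + 1.
have c0 : 0 < c by rewrite ltr_wpDl // addr_ge0.
have hin s t u : 0 < s < r / c -> 0 <= t <= s -> 0 <= u <= s ->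
    ball x r (x + t *: v + u *: w).
  move=> /andP[s0 sr] /andP[t0 ts] /andP[u0 us]; rewrite -ball_normE /=.
  rewrite -addrA opprD addrA subrr add0r normrN.
  apply: le_lt_trans (ler_normD _ _) _; rewrite !normrZ !ger0_norm //.
  move: sr; rewrite ltr_pdivlMr // => /(le_lt_trans _); apply.
  rewrite /c !mulrDr mulr1; apply: ler_wpDr; first exact: ltW.
  by rewrite lerD // ler_wpM2r.
near=> s; have s0 : 0 < s by [].
have sr : 0 < s < r / c.
  rewrite s0 /=; near: s; apply: nbhs_right_lt; exact: divr_gt0.
have ss : 0 <= s <= s by rewrite ltW //=.
have s00 : 0 <= (0 : R) <= s by rewrite lexx ltW.
have Uin t u : 0 <= t <= s -> 0 <= u <= s -> U (x + t *: v + u *: w).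
  by move=> ht hu; have [] := hr _ (hin _ _ _ sr ht hu).
have shiftE (y : V) : y + s *: w = (fun t : R^o => y + t *: w) s by [].
pose F y := f (y + s *: w) - f y.
(* The second difference is the increment of [F] in direction [v]. The mean value theorem is applied
   to [F] along [v], and then to ['D_v f] along [w]. *)
have dsh y : differentiable (fun y : V => y + s *: w) y.
  by apply: differentiable_addf; [exact: differentiable_idf|exact: differentiable_cst].
have Dsh y : 'D_v (fun y : V => y + s *: w) y = v.
  by rewrite derive_addf // derive_id derive_cst addr0.
have dF1 t : 0 <= t <= s -> differentiable (fun y => f (y + s *: w)) (x + t *: v).
  move=> ht; apply: (differentiable_comp (dsh _)); apply: df; exact: Uin.
have dF2 t : 0 <= t <= s -> differentiable f (x + t *: v).
  by move=> ht; apply: df; have := Uin t 0 ht s00; rewrite scale0r addr0.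
have [t ht] := @MVT_line R V F x v s (ltW s0)
  (fun t ht => differentiable_subf (dF1 t ht) (dF2 t ht)).
rewrite {1 2}/F => ->.
rewrite derive_subf; [|exact: dF1|exact: dF2].
rewrite (derive_comp _ (dsh _)); last by apply: df; exact: Uin.
rewrite Dsh.
have [u hu ->] := @MVT_line R V ('D_v f) (x + t *: v) w s (ltW s0)
  (fun u hu => dDf _ (Uin t u ht hu)).
rewrite mulrA -expr2 -mulrBr normrM ger0_norm ?sqr_ge0 // ler_wpM2l ?sqr_ge0 //.
by rewrite distrC; have [] := hr _ (hin _ _ _ sr ht hu).
Unshelve. all: by end_near. Qed.

(** Schwarz's theorem. The second difference is symmetric in [v] and [w], so after division by
    [s ^+ 2] both mixed derivatives lie within [e / 2] of the same number. *)
Lemma derive_comm V (U : set V) (f : V -> R^o) x v w : open U -> U x ->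
  Ck 2 U f -> 'D_w ('D_v f) x = 'D_v ('D_w f) x.
Proof.
move=> oU Ux Cf; pose A : R := 'D_w ('D_v f) x; pose B : R := 'D_v ('D_w f) x.
suff : `|A - B| <= 0 by rewrite normr_le0 subr_eq0 => /eqP.
apply/ler_addgt0Pl => e e0; rewrite addr0.
have aux (P Q T Z X Y S : R) : `|P - Q - (T - Z) - X| <= S * (e / 2) ->
    `|P - T - (Q - Z) - Y| <= S * (e / 2) -> `|X - Y| <= S * e.
  rewrite !ler_norml => /andP[h1 h1'] /andP[h2 h2'].
  by apply/andP; split; lra.
have e20 : 0 < e / 2 by rewrite divr_gt0.
have H1 := derive_derive_diff v w oU Ux Cf e20.
have H2 := derive_derive_diff w v oU Ux Cf e20.
have [s [[h1 h2] s0]] := filter_ex (filterI (filterI H1 H2) (nbhs_right_gt 0)).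
rewrite -(ler_pM2l (exprn_gt0 2 s0)) -[X in X * `|_|]ger0_norm ?sqr_ge0 //.
rewrite -normrM mulrBr /A /B.
have E : x + s *: w + s *: v = x + s *: v + s *: w by rewrite addrAC.
rewrite E in h2.
refine (aux _ _ _ _ _ _ _ h1 h2).
Qed.

End Smoothness.

Section CinftyClosure.
Variable R : realType.
Implicit Types V W : normedModType R.

Lemma Cinfty_eq V W (U : set V) (f g : V -> W) : open U ->
  (forall y, U y -> f y = g y) -> Cinfty U f -> Cinfty U g.
Proof. by move=> oU fg cf k; apply: Ck_eq fg (cf k). Qed.

Lemma Cinfty_sub V W (U U' : set V) (f : V -> W) : U' `<=` U ->
  Cinfty U f -> Cinfty U' f.
Proof. by move=> UU cf k; apply: Ck_sub UU (cf k). Qed.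

Lemma Cinfty_local V W (U : set V) (f : V -> W) :
  (forall x, U x -> exists2 U', U' x & Cinfty U' f) -> Cinfty U f.
Proof. by move=> H k; apply: Ck_local => x /H[U' ? ?]; exists U'. Qed.

Lemma Cinfty_cst V W (U : set V) (c : W) : Cinfty U (fun=> c).
Proof. by move=> k; exact: Ck_cst. Qed.

Lemma Cinfty_add V W (U : set V) (f g : V -> W) : open U ->
  Cinfty U f -> Cinfty U g -> Cinfty U (fun y => f y + g y).
Proof. by move=> oU cf cg k; apply: Ck_add. Qed.

Lemma Cinfty_opp V W (U : set V) (f : V -> W) : open U ->
  Cinfty U f -> Cinfty U (fun y => - f y).
Proof. by move=> oU cf k; apply: Ck_opp. Qed.

Lemma Cinfty_subr V W (U : set V) (f g : V -> W) : open U ->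
  Cinfty U f -> Cinfty U g -> Cinfty U (fun y => f y - g y).
Proof. by move=> oU cf cg; apply: Cinfty_add => //; exact: Cinfty_opp. Qed.

Lemma Cinfty_sum V W (U : set V) I r (P : pred I) (f : I -> V -> W) : open U ->
  (forall i, P i -> Cinfty U (f i)) ->
  Cinfty U (fun y => \sum_(i <- r | P i) f i y).
Proof. by move=> oU cf k; apply: Ck_sum => // i Pi; exact: cf. Qed.

Lemma Cinfty_mul V (U : set V) (f g : V -> R^o) : open U ->
  Cinfty U f -> Cinfty U g -> Cinfty U (fun y => f y * g y : R^o).
Proof. by move=> oU cf cg k; apply: Ck_mul. Qed.

Lemma Cinfty_inv V (U : set V) (f : V -> R^o) : open U ->
  (forall x, U x -> f x != 0) -> Cinfty U f ->
  Cinfty U (fun y => (f y)^-1 : R^o).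
Proof. by move=> oU f0 cf k; apply: Ck_inv. Qed.

Lemma Cinfty_prod V (U : set V) I r (P : pred I) (f : I -> V -> R^o) : open U ->
  (forall i, P i -> Cinfty U (f i)) ->
  Cinfty U (fun y => \prod_(i <- r | P i) f i y : R^o).
Proof.
move=> oU cf; elim: r => [|i r IH].
  by under eq_fun do rewrite big_nil; exact: Cinfty_cst.
under eq_fun do rewrite big_cons; case Pi : (P i) => //.
exact: (Cinfty_mul oU (cf i Pi) IH).
Qed.

Lemma Cinfty_entry V (U : set V) n (f : V -> 'rV[R]_n) i : open U ->
  Cinfty U f -> Cinfty U (fun y => f y 0 i : R^o).
Proof. by move=> oU cf k; apply: Ck_entry. Qed.

Lemma Cinfty_row V (U : set V) n (f : V -> 'rV[R]_n) : open U ->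
  (forall i, Cinfty U (fun y => f y 0 i : R^o)) -> Cinfty U f.
Proof. by move=> oU cf k; apply: Ck_row => // i; exact: cf. Qed.

Lemma Cinfty_comp V (U : set V) n (U' : set 'rV[R]_n) (f : V -> 'rV[R]_n)
    (g : 'rV[R]_n -> R^o) : open U -> open U' -> U `<=` f @^-1` U' ->
  Cinfty U f -> Cinfty U' g -> Cinfty U (fun x => g (f x)).
Proof. by move=> oU oU' UU cf cg k; apply: (Ck_comp oU oU' UU (cf k) (cg k)). Qed.

Lemma Cinfty_comp_row V (U : set V) n m (U' : set 'rV[R]_n) (f : V -> 'rV[R]_n)
    (g : 'rV[R]_n -> 'rV[R]_m) : open U -> open U' -> U `<=` f @^-1` U' ->
  Cinfty U f -> Cinfty U' g -> Cinfty U (fun x => g (f x)).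
Proof.
move=> oU oU' UU cf cg; apply: Cinfty_row => // i.
exact: (Cinfty_comp oU oU' UU cf (Cinfty_entry i oU' cg)).
Qed.

Lemma Cinfty_comp1 V (U : set V) (U' : set R^o) (f : V -> R^o)
    (g : R^o -> R^o) : open U -> open U' -> U `<=` f @^-1` U' ->
  Cinfty U f -> Cinfty U' g -> Cinfty U (fun x => g (f x)).
Proof. by move=> oU oU' UU cf cg k; apply: (Ck_comp1 oU oU' UU (cf k) (cg k)). Qed.

Lemma Cinfty_derive V W (U : set V) (f : V -> W) v :
  Cinfty U f -> Cinfty U ('D_v f).
Proof. by move=> cf k; have [_] := cf k.+1; apply. Qed.

Lemma Cinfty_differentiable V W (U : set V) (f : V -> W) x :
  Cinfty U f -> U x -> differentiable f x.
Proof. by move=> /(_ 1%N)[df _]; exact: df. Qed.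

Lemma Cinfty_continuous V W (U : set V) (f : V -> W) x :
  Cinfty U f -> U x -> {for x, continuous f}.
Proof. by move=> /(_ 0%N); apply. Qed.

Lemma Cinfty_id n (U : set 'rV[R]_n) : open U -> Cinfty U (fun x : 'rV[R]_n => x).
Proof. by move=> oU; apply: Cinfty_row => // i k; exact: Ck_coord. Qed.

Lemma Cinfty_scale_row V (U : set V) n (k : V -> R^o) (f : V -> 'rV[R]_n) :
  open U -> Cinfty U k -> Cinfty U f -> Cinfty U (fun y => k y *: f y).
Proof.
move=> oU ck cf; apply: Cinfty_row => // i.
under eq_fun do rewrite mxE; apply: Cinfty_mul => //; exact: Cinfty_entry.
Qed.

Lemma Cinfty_dir_comp V n m (U : set V) (U' : set 'rV[R]_n)
    (f : V -> 'rV[R]_n) (g : 'rV[R]_n -> 'rV[R]_m) (w : V -> 'rV[R]_n) :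
  open U -> open U' -> U `<=` f @^-1` U' -> Cinfty U f -> Cinfty U' g ->
  Cinfty U w -> Cinfty U (fun x => 'D_(w x) g (f x)).
Proof.
move=> oU oU' UU cf cg cw.
have H i := Cinfty_scale_row oU (Cinfty_entry i oU cw)
  (Cinfty_comp_row oU oU' UU cf (Cinfty_derive (delta_mx 0 i) cg)).
have S := @Cinfty_sum _ 'rV[R]_m U _ (index_enum _) xpredT _ oU (fun i _ => H i).
apply: (Cinfty_eq oU _ S) => x Ux.
by rewrite (derive_row _ (Cinfty_differentiable cg (UU _ Ux))).
Qed.

Definition Cinfty_mx V (U : set V) p q (A : V -> 'M[R]_(p, q)) :=
  forall i j, Cinfty U (fun y => A y i j : R^o).

Lemma Cinfty_mulmx V (U : set V) p q r (A : V -> 'M[R]_(p, q))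
    (B : V -> 'M[R]_(q, r)) : open U -> Cinfty_mx U A -> Cinfty_mx U B ->
  Cinfty_mx U (fun y => A y *m B y).
Proof.
move=> oU cA cB i j; under eq_fun do rewrite mxE.
by apply: Cinfty_sum => // k _; apply: Cinfty_mul; [|exact: cA|exact: cB].
Qed.

Lemma Cinfty_mx_row V (U : set V) n (A : V -> 'rV[R]_n) : open U ->
  Cinfty U A <-> Cinfty_mx U A.
Proof.
move=> oU; split=> [cA i j|cA]; first by rewrite ord1; exact: Cinfty_entry.
by apply: Cinfty_row => // i; exact: cA.
Qed.

Lemma Cinfty_det V (U : set V) n (A : V -> 'M[R]_n) : open U ->
  Cinfty_mx U A -> Cinfty U (fun y => \det (A y) : R^o).
Proof.
move=> oU cA; rewrite /determinant; apply: Cinfty_sum => // s _.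
apply: Cinfty_mul => //; first exact: Cinfty_cst.
by apply: Cinfty_prod => // i _; exact: cA.
Qed.

Lemma Cinfty_invmx V (U : set V) n (A : V -> 'M[R]_n) : open U ->
  (forall y, U y -> A y \in unitmx) -> Cinfty_mx U A ->
  Cinfty_mx U (fun y => invmx (A y)).
Proof.
move=> oU uA cA i j.
have cdet := Cinfty_det oU cA.
have d0 y : U y -> \det (A y) != 0 by move=> /uA; rewrite unitmxE unitfE.
have cadj : Cinfty U (fun y => \adj (A y) i j : R^o).
  under eq_fun do rewrite mxE /cofactor; apply: Cinfty_mul => //.
    exact: Cinfty_cst.
  apply: Cinfty_det => // k l; under eq_fun do rewrite !mxE; exact: cA.
apply: (Cinfty_eq oU _ (Cinfty_mul oU (Cinfty_inv oU d0 cdet) cadj)) => y Uy.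
by rewrite /invmx uA // [in RHS]mxE.
Qed.

End CinftyClosure.

(** * Smooth cut-off functions *)

Section Bump.
Variable R : realType.

(** The powers of [x^-1] close the family under differentiation: the derivative of [flat n] is
    [flat n.+2 - n * flat n.+1]. Smoothness of all members then follows by one induction on the
    order. *)
Definition flat (n : nat) (x : R^o) : R^o :=
  if 0 < x then x^-1 ^+ n * expR (- x^-1) else 0.

Lemma flat_small n (x : R) : 0 < x -> `|flat n x : R| <= n.+1`!%:R * x.
Proof.
move=> x0; rewrite /flat x0 ger0_norm; last first.
  by rewrite mulr_ge0 ?expR_ge0 // exprn_ge0 // invr_ge0 ltW.
have y0 : 0 < x^-1 by rewrite invr_gt0.
rewrite expRN ler_pdivrMr ?expR_gt0 //.
have := expR_ge1Dxn n (ltW y0); set E := expR _ => hE.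
have hE' : x^-1 ^+ n.+1 <= n.+1`!%:R * E.
  rewrite -ler_pdivrMl ?ltr0n ?fact_gt0 // mulrC; apply: le_trans hE.
  by rewrite lerDr.
by rewrite -mulrA [x * _]mulrC mulrA -ler_pdivrMr // -exprSr.
Qed.

Lemma flat_is_derive n (x : R) :
  is_derive (x : R^o) 1 (flat n) (flat n.+2 x - n%:R * flat n.+1 x).
Proof.
have [x0|x0|->] := ltgtP x 0.
- have -> : flat n.+2 x - n%:R * flat n.+1 x = 0.
    by rewrite /flat ltNge (ltW x0) /= mulr0 subr0.
  apply: (@near_eq_is_derive R R^o R^o (cst 0)).
    have : \forall y \near x, y < 0 by apply: lt_nbhsl.
    by apply: filterS => y y0; rewrite /flat ltNge (ltW y0).
- apply: (@near_eq_is_derive R R^o R^o (fun x : R^o => x^-1 ^+ n * expR (- x^-1))).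
    have : \forall y \near x, 0 < y by apply: lt_nbhsr.
    by apply: filterS => y y0; rewrite /flat y0.
  have xn0 : x != 0 by rewrite gt_eqF.
  have dV := @is_deriveV R id x 1 1 xn0 (is_derive_id _ _).
  have dX := @is_deriveX R R^o (fun y : R => y^-1) n x 1 _ dV.
  have dE := @is_derive1_comp R expR (fun y => - y^-1) x _ _ (is_derive_expR _) (@is_deriveN R R^o R^o _ _ _ _ dV).
  have dM := @is_deriveM R R^o _ _ _ _ _ _ dX dE.
  have powE y : ((fun y : R => y^-1) ^+ n) y = y^-1 ^+ n.
    by elim: (n) => [|k IH]; rewrite ?expr0 // !exprS -IH.
  have fE : (fun x : R^o => x^-1 ^+ n * expR (- x^-1)) =
      (fun y : R => y^-1) ^+ n * (expR \o (fun y : R => - y^-1)) :> (R -> R).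
    by apply/funext => y; rewrite -powE.
  rewrite fE; refine (is_derive_eq dM _).
  rewrite powE /flat x0 /GRing.scale /= !mulr1 -exprVn.
  move: (expR _) => E; case: (n) => [|k] /=; first by rewrite !expr0 !mul0r !exprS; ring.
  by rewrite !exprS; ring.
- have -> : flat n.+2 0 - n%:R * flat n.+1 0 = 0.
    by rewrite /flat ltxx mulr0 subr0.
  suff H : h^-1 *: (flat n (h *: (1 : R^o) + 0) - flat n 0) @[h --> (0:R)^'] --> (0 : R^o).
    by apply: DeriveDef; [apply/cvg_ex; exists 0|exact: cvg_lim H].
  apply/cvgr0Pnorm_le => e e0; near=> h.
  have hn0 : h != 0 by near: h; exact: nbhs_dnbhs_neq.
  rewrite addr0 [h *: _]mulr1 {2}/flat ltxx subr0.
  have [h0|h0] := ltP 0 h; last by rewrite /flat ltNge h0 /= scaler0 normr0 ltW.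
  (* The difference quotient of [flat n] at [0] is the next member of the family, hence small with
     [h]. *)
  have -> : h^-1 *: flat n h = flat n.+1 h.
    by rewrite /flat h0 /GRing.scale /= mulrA -exprS.
  apply: le_trans (flat_small n.+1 h0) _.
  rewrite -ler_pdivlMl ?ltr0n ?fact_gt0 // -[X in X <= _]ger0_norm ?ltW //.
  near: h; apply: dnbhs0_lt.
  by rewrite mulr_gt0 // invr_gt0 ltr0n fact_gt0.
Unshelve. all: by end_near. Qed.

Lemma flat_Ck k n : Ck k setT (flat n).
Proof.
elim: k n => [|k IH] n.
  move=> x _; apply: differentiable_continuous; apply/derivable1_diffP.
  by have [] := flat_is_derive n x.
split=> [x _|v].
  by apply/derivable1_diffP; have [] := flat_is_derive n x.
have H : 'D_v (flat n) = fun x => v * (flat n.+2 x - n%:R * flat n.+1 x).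
  apply/funext => x; have [dx dE] := flat_is_derive n x.
  have df : differentiable (flat n) x by apply/derivable1_diffP.
  have := derive_linear v (1 : R^o) 0 df.
  by rewrite derive0 !addr0 [_ *: (1 : R^o)]mulr1 => ->; rewrite dE.
rewrite H; apply: Ck_mul; [exact: openT|exact: Ck_cst|].
apply: Ck_add; [exact: openT|exact: IH|].
apply: Ck_opp; first exact: openT.
by apply: Ck_mul; [exact: openT|exact: Ck_cst|exact: IH].
Qed.

(** The witness is [flat 0] of [r ^+ 2] minus the squared Euclidean distance to [x0]. The support is
    bounded coordinate by coordinate because it will be enclosed in a compact box. *)
Lemma exists_bump m (x0 : 'rV[R]_m) (r : R) : 0 < r ->
  exists chi : 'rV[R]_m -> R^o, [/\ Cinfty setT chi, chi x0 != 0 &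
    forall x, chi x != 0 -> forall i, `|x 0 i - x0 0 i| <= r].
Proof.
move=> r0.
pose q (x : 'rV[R]_m) : R^o := r ^+ 2 - \sum_i (x 0 i - x0 0 i) * (x 0 i - x0 0 i).
exists (fun x => flat 0 (q x)); split.
- apply: (@Cinfty_comp1 R _ setT setT); [exact: openT|exact: openT|by []| |].
    apply: Cinfty_subr; [exact: openT|exact: Cinfty_cst|].
    apply: Cinfty_sum; [exact: openT|move=> i _].
    have H : Cinfty setT (fun x : 'rV[R]_m => x 0 i - x0 0 i : R^o).
      apply: Cinfty_subr; [exact: openT| |exact: Cinfty_cst].
      by move=> k; exact: Ck_coord.
    by apply: Cinfty_mul => //; exact: openT.
  by move=> k; exact: flat_Ck.
- rewrite /q big1 ?subr0; last by move=> i _; rewrite subrr mul0r.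
  by rewrite /flat exprn_gt0 // expr0 mul1r gt_eqF // expR_gt0.
- move=> x; rewrite /flat; case: ifP => [|_]; last by rewrite eqxx.
  rewrite subr_gt0 => hq _ j; set d := x 0 j - x0 0 j.
  have hd : d * d <= r * r.
    move: hq; rewrite expr2 => /ltW; apply: le_trans.
    rewrite (bigD1 j) //= lerDl; apply: sumr_ge0 => l _.
    by rewrite -expr2 sqr_ge0.
  by rewrite ler_norml; apply/andP; split; nra.
Qed.

End Bump.

(** * Linear differential equations *)

Section LinearODE.
Variable R : realType.

(** Integration starts at [-1] so that [0] is an interior point, where the derivative is two-sided;
    subtracting the value at [0] then normalizes [F]. *)
Lemma antiderivative_right (f : R -> R) : continuous f ->
  exists F : R -> R, F 0 = 0 /\ forall x : R, -1 < x -> is_derive x 1 F (f x).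
Proof.
move=> cf; pose mu := @lebesgue_measure R.
pose G x := (\int[mu]_(t in [set` `[(-1)%R, x]]) f t)%R.
have dG (x : R) : -1 < x -> is_derive x 1 G (f x).
  move=> x1; have xu : x < x + 1 by rewrite ltrDl.
  have fi : mu.-integrable `[(-1)%R, x + 1]%classic (EFin \o f).
    apply: continuous_compact_integrable; first exact: segment_compact.
    by apply: continuous_subspaceT => y; exact: cf.
  have [dF DF] := continuous_FTC1_closed xu fi x1 (cf x).
  by refine (@DeriveDef _ _ _ _ _ _ _ dF _); rewrite -DF derive1E.
exists (fun x => G x - G 0); split=> [|x x1]; first by rewrite subrr.
rewrite -[f x]subr0; apply: is_deriveB; first exact: dG.
Qed.

Lemma is_derive_flip (F : R -> R) (x d : R) : is_derive (- x) 1 F d ->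
  is_derive x 1 (fun y => - F (- y)) d.
Proof.
move=> dF; have dN : is_derive x 1 (fun y : R => - y) (-1) by exact: is_deriveNid.
have := @is_deriveN R R R _ _ _ _ (@is_derive1_comp R F -%R x _ _ dF dN).
by move=> H; refine (is_derive_eq H _); rewrite mulrN1 opprK.
Qed.

Lemma is_derive_cst_on (f : R -> R) (a b : R) :
  (forall x, a < x < b -> is_derive x 1 f 0) ->
  forall x y, a < x < b -> a < y < b -> f x = f y.
Proof.
move=> df x y; wlog xy : x y / x <= y.
  by move=> H hx hy; case: (leP x y) => [/H|/ltW /H h]; [apply|rewrite h].
move=> /andP[ax xb] /andP[ay yb].
have [| |c hc] := @MVT_segment R f (fun=> 0) x y xy.
- move=> z; rewrite in_itv /= => /andP[xz zy]; apply: df.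
  by rewrite (lt_trans ax) //= (lt_trans zy).
- apply: derivable_within_continuous => z; rewrite in_itv /= => /andP[xz zy].
  suff : is_derive z 1 f 0 by case.
  by apply: df; rewrite (lt_le_trans ax) //= (le_lt_trans zy).
- by rewrite mul0r => /eqP; rewrite subr_eq0 => /eqP ->.
Qed.

(** The primitive on the right is glued with the reflected one. On []-1, 1[] both are primitives of
    [f] vanishing at [0], so they agree there and the glued function is differentiable at [0]
    too. *)
Lemma antiderivative (f : R -> R) : continuous f ->
  exists F : R -> R, F 0 = 0 /\ forall x : R, is_derive x 1 F (f x).
Proof.
move=> cf; have [F1 [F10 dF1]] := antiderivative_right cf.
have cf' : continuous (fun x : R => f (- x)).
  by move=> x; apply: continuous_comp; [exact: continuousN|exact: cf].
have [F2 [F20 dF2]] := antiderivative_right cf'.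
pose F3 x := - F2 (- x).
have dF3 (x : R) : x < 1 -> is_derive x 1 F3 (f x).
  by move=> x1; apply: is_derive_flip; rewrite -{2}[x]opprK; apply: dF2; rewrite ltrN2.
have E (x : R) : -1 < x < 1 -> F1 x = F3 x.
  move=> hx; apply/eqP; rewrite -subr_eq0; apply/eqP.
  have -> : 0 = F1 0 - F3 0 by rewrite F10 /F3 oppr0 F20 oppr0 subrr.
  apply: (@is_derive_cst_on (F1 \- F3) (-1) 1) => //; last by rewrite ltr01 ltrN10.
  move=> z /andP[z1 z2]; rewrite -(subrr (f z)); apply: is_deriveB.
    exact: dF1.
  exact: dF3.
exists (fun x => if 0 <= x then F1 x else F3 x); split; first by rewrite lexx.
move=> x; have [x0|x0] := ltP x 0.
  apply: near_eq_is_derive (dF3 _ _); last exact: (lt_trans x0).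
  have : \forall y \near x, y < 0 by apply: lt_nbhsl.
  by apply: filterS => y y0; rewrite leNgt y0.
apply: near_eq_is_derive (dF1 _ _); last exact: (lt_le_trans _ x0).
have : \forall y \near x, -1 < y by apply: lt_nbhsr; apply: lt_le_trans x0.
apply: filterS => y y0; case: ifP => // /negbT; rewrite -ltNge => y1.
by apply: E; rewrite y0 (lt_trans y1).
Qed.

(** Integration divides the weight [expR (k * |t|)] by [k]. In the sup norm with this weight, Picard
    iteration contracts on the whole line at once, with no subdivision of time. *)
Lemma growth_bound (g dg : R -> R) (k B : R) : 0 < k ->
  (forall t : R, is_derive t 1 g (dg t)) -> g 0 = 0 ->
  (forall t : R, `|dg t| <= B * expR (k * `|t|)) ->
  forall t : R, `|g t| <= B / k * expR (k * `|t|).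
Proof.
move=> k0.
have B0 (dg' : R -> R) : (forall t : R, `|dg' t| <= B * expR (k * `|t|)) -> 0 <= B.
  move=> /(_ 0); rewrite normr0 mulr0 expR0 mulr1; exact: le_trans.
have main (g' dg' : R -> R) : (forall t : R, is_derive t 1 g' (dg' t)) -> g' 0 = 0 ->
    (forall t : R, `|dg' t| <= B * expR (k * `|t|)) ->
    forall t : R, 0 <= t -> g' t <= B / k * expR (k * `|t|).
  move=> dg0 g0 hb t t0.
  pose phi x := B / k * expR (k * x) - g' x.
  have dk (x : R) : is_derive x 1 (fun x : R => k * x) k.
    by have := @is_deriveZ R R R id k x 1 1 (is_derive_id _ _); rewrite /GRing.scale /= mulr1.
  have dphi (x : R) : is_derive x 1 phi (B * expR (k * x) - dg' x).
    apply: is_deriveB.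
    have := @is_deriveZ R R R _ (B / k) x 1 _
      (@is_derive1_comp R expR (fun x => k * x) x _ _ (is_derive_expR _) (dk x)).
    by move=> H; refine (is_derive_eq H _); rewrite /GRing.scale /=;
      field; rewrite gt_eqF.
  have : phi 0 <= phi t.
    apply: (@ger0_derive1_le_cc R phi 0 t _); rewrite ?in_itv /= ?lexx ?t0 //.
    - move=> x; rewrite in_itv /= => /andP[x0 _]; have [_] := dphi x.
      rewrite -derive1E => ->; rewrite subr_ge0.
      by apply: le_trans (ler_norm _) _; have := hb x; rewrite (ger0_norm (ltW x0)).
    - by apply: derivable_within_continuous => x _; have [] := dphi x.
  rewrite /phi mulr0 expR0 mulr1 g0 subr0 ger0_norm // lerBrDr => h.
  apply: le_trans h; rewrite lerDr divr_ge0 ?(ltW k0) //; exact: B0 hb.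
move=> dgd g0 hb t; rewrite ler_norml; apply/andP; split; last first.
  have [t0|t0] := leP 0 t; first exact: (main _ _ dgd g0 hb).
  have := main (fun y => - (- g (- y))) (fun y => - dg (- y)).
  move=> /(_ _ _ _ (- t)); rewrite !opprK normrN; apply.
  - move=> s; apply: is_deriveN; apply: is_derive_flip; exact: dgd.
  - by rewrite oppr0 g0.
  - by move=> s; rewrite normrN; have := hb (- s); rewrite normrN.
  - by rewrite oppr_ge0 ltW.
rewrite lerNl; have [t0|t0] := leP 0 t.
  apply: (main (fun y => - g y) (fun y => - dg y)) => //.
  - by rewrite g0 oppr0.
  - by move=> s; rewrite normrN.
have := main (fun y => - g (- y)) (fun y => dg (- y)).
move=> /(_ _ _ _ (- t)); rewrite opprK normrN; apply.
- by move=> s; apply: is_derive_flip; exact: dgd.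
- by rewrite oppr0 g0 oppr0.
- by move=> s; have := hb (- s); rewrite normrN.
- by rewrite oppr_ge0 ltW.
Qed.

Lemma half_exp_small (e C : R) : 0 < e -> 0 <= C ->
  exists n, 2^-1 ^+ n * C <= e.
Proof.
move=> e0 C0; exists (Num.bound (C / e)).
have h := archi_boundP (divr_ge0 C0 (ltW e0)).
rewrite exprVn mulrC ler_pdivrMr ?exprn_gt0 // -ler_pdivrMl // mulrC.
apply: le_trans (ltW h) _; rewrite -natrX ler_nat.
exact/ltnW/ltn_expl.
Qed.

(** The bounds [u n t -/+ 2 * 2^-1 ^+ n * b t] are nested intervals, the margin being the tail of
    the geometric series. The limit is the supremum of the lower ends, and its error is controlled
    by [b] uniformly in [n]. *)
Lemma geometric_limit (T : Type) (u : nat -> T -> R) (b : T -> R) :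
  (forall n t, `|u n.+1 t - u n t| <= 2^-1 ^+ n * b t) ->
  exists y, forall n t, `|y t - u n t| <= 2 * 2^-1 ^+ n * b t.
Proof.
move=> H.
pose lo t n := u n t - 2 * 2^-1 ^+ n * b t.
pose hi t n := u n t + 2 * 2^-1 ^+ n * b t.
have step t n : lo t n <= lo t n.+1 /\ hi t n.+1 <= hi t n.
  have := H n t; rewrite ler_norml /lo /hi exprS => /andP[h1 h2].
  have E : 2 * (2^-1 * 2^-1 ^+ n) * b t = 2^-1 ^+ n * b t :> R by field.
  have E' : 2 * 2^-1 ^+ n * b t = 2^-1 ^+ n * b t + 2^-1 ^+ n * b t :> R by ring.
  rewrite E E'; split; lra.
have b0 t : 0 <= b t.
  by have := H 0%N t; rewrite expr0 mul1r; apply: le_trans.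
have lohi t n : lo t n <= hi t n.
  rewrite /lo /hi lerBlDr -addrA lerDl.
  by rewrite addr_ge0 // !mulr_ge0 // exprn_ge0.
have lo_mono t n m : lo t n <= lo t (n + m)%N.
  elim: m => [|m IH]; first by rewrite addn0.
  by rewrite addnS; apply: le_trans IH _; case: (step t (n + m)%N).
have hi_mono t n m : hi t (n + m)%N <= hi t n.
  elim: m => [|m IH]; first by rewrite addn0.
  by rewrite addnS; apply: le_trans IH; case: (step t (n + m)%N).
have lo_hi t n m : lo t n <= hi t m.
  apply: le_trans (lo_mono t n m) _; apply: le_trans (lohi _ _) _.
  by rewrite addnC hi_mono.
exists (fun t => sup (range (lo t))) => n t.
have h1 : lo t n <= sup (range (lo t)).
  apply: sup_upper_bound; last by exists n.
  by split; [exists (lo t 0%N), 0%N|exists (hi t 0%N) => _ [m _ <-]].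
have h2 : sup (range (lo t)) <= hi t n.
  apply: ge_sup; first by exists (lo t 0%N), 0%N.
  by move=> _ [m _ <-].
rewrite ler_norml; move: h1 h2; rewrite /lo /hi => h1 h2.
by apply/andP; split; lra.
Qed.

(** Picard iteration [u n], with successive differences estimated by [growth_bound] and summed by
    [geometric_limit]. *)
Lemma linear_ode (I : finType) (A : I -> I -> R -> R) (K : R) (y0 : I -> R) :
  (forall i j, continuous (A i j)) -> (forall i j t, `|A i j t| <= K) ->
  exists y : I -> R -> R, (forall i, y i 0 = y0 i) /\
    forall i (t : R), is_derive t 1 (y i) (\sum_j A i j t * y j t).
Proof.
move=> cA bA.
pose prim (f : R -> R) : R -> R :=
  xget (fun=> 0) [set F | F 0 = 0 /\ forall x : R, is_derive x 1 F (f x)].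
have primP f : continuous f ->
    prim f 0 = 0 /\ forall x : R, is_derive x 1 (prim f) (f x).
  move=> cf; have [F HF] := antiderivative cf.
  exact: (@xgetPex _ (fun=> 0) [set F | F 0 = 0 /\ forall x : R, is_derive x 1 F (f x)]
            (ex_intro _ F HF)).
pose u := fix u n : I -> R -> R := if n is n'.+1
  then fun i t => y0 i + prim (fun t => \sum_j A i j t * u n' j t) t
  else fun i _ => y0 i.
have cAy (y : I -> R -> R) i : (forall j, continuous (y j)) ->
    continuous (fun t => \sum_j A i j t * y j t).
  move=> cy t.
  refine (@Ck_sum R R^o R^o 0 setT I (index_enum I) xpredT
    (fun j t => A i j t * y j t) openT _ t Logic.I) => j _ /= x _.
  by apply: continuousM; [exact: cA|exact: cy].
have dprim (y : I -> R -> R) i (t : R) : (forall j, continuous (y j)) ->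
    is_derive t 1 (fun t => y0 i + prim (fun t => \sum_j A i j t * y j t) t)
      (\sum_j A i j t * y j t).
  move=> cy; rewrite -[X in is_derive _ _ _ X]add0r; apply: is_deriveD.
  by have [_] := primP _ (cAy y i cy).
have is_derive_cont (f : R -> R) (df : R -> R) :
    (forall t : R, is_derive t 1 f (df t)) -> continuous f.
  move=> df' t; apply: differentiable_continuous; apply/derivable1_diffP.
  by have [] := df' t.
have cu n : forall i, continuous (u n i).
  elim: n => [|n IH] i; first by move=> t; exact: cst_continuous.
  apply: (is_derive_cont _ (fun t => \sum_j A i j t * u n j t)) => t.
  exact: dprim.
pose C := \sum_i `|y0 i|.
have C0 : 0 <= C by exact: sumr_ge0.
have Ci i : `|y0 i| <= C by rewrite /C (bigD1 i) //= lerDl; exact: sumr_ge0.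
(* Chosen so that [k / 2] bounds the row sums of the coefficients; integrating against the weight
   divides by [k], so each iteration gains a factor [1 / 2]. *)
pose k := 2 * (#|I|%:R * (`|K| + 1)) + 2.
have N0 : 0 <= #|I|%:R * (`|K| + 1) :> R by rewrite mulr_ge0 // addr_ge0.
have k0 : 0 < k by rewrite ltr_wpDl // mulr_ge0.
have sumb (z : I -> R) i t B : 0 <= B -> (forall j, `|z j| <= B) ->
    `|\sum_j A i j t * z j| <= k / 2 * B.
  move=> B0 hz; apply: le_trans (ler_norm_sum _ _ _) _.
  apply: (@le_trans _ _ (\sum_(j in I) (`|K| + 1) * B)).
    apply: ler_sum => j _; rewrite normrM ler_pM //.
    by apply: le_trans (bA i j t) _; apply: le_trans (ler_norm _) _; rewrite lerDl.
  rewrite sumr_const -[X in X <= _]mulr_natl mulrA ler_wpM2r // /k.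
  set N := #|I|%:R * _.
  have -> : (2 * N + 2) / 2 = N + 1 by field.
  by rewrite lerDl.
have expge t : 1 <= expR (k * `|t|).
  by rewrite -expR0 ler_expR mulr_ge0 // ltW.
pose b (p : I * R) := C * expR (k * `|p.2|).
have ub n (p : I * R) : `|u n.+1 p.1 p.2 - u n p.1 p.2| <= 2^-1 ^+ n * b p.
  case: p => i t /=.
  elim: n i t => [|n IH] i t.
    rewrite expr0 mul1r /b /=.
    pose g t := y0 i + prim (fun t => \sum_j A i j t * y0 j) t - y0 i.
    have := @growth_bound g (fun t => \sum_j A i j t * y0 j) k (k / 2 * C) k0.
    have -> : k / 2 * C / k = C / 2 by field; rewrite gt_eqF.
    move=> /(_ _ _ _ t) H; apply: le_trans (H _ _ _) _.
    - move=> s; rewrite -[X in is_derive _ _ _ X]subr0; apply: is_deriveB.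
      by apply: (dprim (u 0%N)); exact: (cu 0%N).
    - rewrite /g; have [-> _] := primP _ (cAy (u 0%N) i (cu 0%N)).
      by rewrite addr0 subrr.
    - move=> s; apply: le_trans (sumb _ _ _ _ C0 Ci) _.
      by rewrite ler_peMr // mulr_ge0 // divr_ge0 // ltW.
    - by rewrite ler_wpM2r ?expR_ge0 // ler_pdivrMr // ler_peMr // ler1n.
  pose g t := u n.+2 i t - u n.+1 i t.
  have := @growth_bound g (fun t => \sum_j A i j t * (u n.+1 j t - u n j t)) k
    (k / 2 * (2^-1 ^+ n * C)) k0.
  have -> : k / 2 * (2^-1 ^+ n * C) / k = 2^-1 ^+ n.+1 * C.
    by rewrite exprS; field; rewrite gt_eqF.
  move=> /(_ _ _ _ t) H.
  have -> : 2^-1 ^+ n.+1 * b (i, t) = 2^-1 ^+ n.+1 * C * expR (k * `|t|).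
    by rewrite /b mulrA.
  apply: H.
  - move=> s; refine (is_derive_eq (is_deriveB (dprim (u n.+1) i s (cu n.+1)) (dprim (u n) i s (cu n))) _).
    by rewrite -sumrB; apply: eq_bigr => j _; rewrite mulrBr.
  - rewrite /g /=; have [-> _] := primP _ (cAy (u n.+1) i (cu n.+1)).
    by have [-> _] := primP _ (cAy (u n) i (cu n)); rewrite subrr.
  - move=> s; rewrite -!mulrA mulrA; apply: sumb; last by move=> j; exact: (IH j s).
    by rewrite mulr_ge0 ?exprn_ge0 // mulr_ge0 // expR_ge0.
have [y0' hy] := @geometric_limit (I * R) (fun n p => u n p.1 p.2) b ub.
pose y i t := y0' (i, t).
have hyu n i t : `|y i t - u n i t| <= 2 * 2^-1 ^+ n * (C * expR (k * `|t|)).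
  exact: (hy n (i, t)).
(* The error bound grows with time, so the convergence is uniform on bounded sets only; the times
   with [|s| <= |t| + 1] suffice for continuity at [t]. *)
have cy i : continuous (y i).
  move=> t; apply/cvgrPdist_le => e e0.
  have D0 : 0 <= 2 * (C * expR (k * (`|t| + 1))) by rewrite !mulr_ge0 // expR_ge0.
  have e30 : 0 < e / 3 by rewrite divr_gt0.
  have [n hn] := half_exp_small e30 D0.
  have bnd (s : R) : `|s| <= `|t| + 1 -> `|y i s - u n i s| <= e / 3.
    move=> hs; apply: le_trans (hyu n i s) _; apply: le_trans hn.
    rewrite [2 * _]mulrC -mulrA; rewrite !ler_wpM2l ?exprn_ge0 //.
    by rewrite ler_expR ler_wpM2l // ltW.
  have n1 : \forall s \near (t : R), `|(t : R) - s| <= 1.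
    exact: (@cvgr_dist_le R R _ _ _ (fun s : R => s) t cvg_id 1 ltr01).
  have n2 : \forall s \near (t : R), `|u n i t - u n i s| <= e / 3.
    exact: (@cvgr_dist_le R R _ _ _ (u n i) (u n i t) (cu n i t) (e / 3) e30).
  apply: filterS2 n1 n2 => s hs1 h3.
  have hs : `|s| <= `|t| + 1.
    by rewrite -[s](subKr t); apply: le_trans (ler_normB _ _) _; rewrite lerD2l.
  have h1 := bnd s hs; have h2 : `|y i t - u n i t| <= e / 3 by apply: bnd; rewrite lerDl.
  move: h1 h2 h3; clear; rewrite !ler_norml => /andP[? ?] /andP[? ?] /andP[? ?].
  by apply/andP; split; lra.
(* [z] is the image of [y] under the iteration. It is close to [u n.+1], as [y] is, so [z = y]: the
   limit solves the integral equation. *)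
pose z i t := y0 i + prim (fun t => \sum_j A i j t * y j t) t.
have zy i t : z i t = y i t.
  apply/eqP; rewrite -subr_eq0 -normr_le0; apply/ler_addgt0Pl => e e0; rewrite addr0.
  have D0 : 0 <= 2 * (C * expR (k * `|t|)) by rewrite !mulr_ge0 // expR_ge0.
  have [n hn] := half_exp_small e0 D0.
  have h2 := hyu n.+1 i t.
  pose g t := z i t - u n.+1 i t.
  have := @growth_bound g (fun t => \sum_j A i j t * (y j t - u n j t)) k
    (k / 2 * (2 * 2^-1 ^+ n * C)) k0.
  have -> : k / 2 * (2 * 2^-1 ^+ n * C) / k = 2^-1 ^+ n * C.
    by field; rewrite gt_eqF.
  move=> /(_ _ _ _ t) h1.
  have {}h1 : `|g t| <= 2^-1 ^+ n * C * expR (k * `|t|).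
    apply: h1.
    - move=> s; refine (is_derive_eq (is_deriveB (dprim y i s cy) (dprim (u n) i s (cu n))) _).
      by rewrite -sumrB; apply: eq_bigr => j _; rewrite mulrBr.
    - rewrite /g /z /=; have [-> _] := primP _ (cAy y i cy).
      by have [-> _] := primP _ (cAy (u n) i (cu n)); rewrite subrr.
    - move=> s; rewrite -!mulrA mulrA; apply: sumb.
        by rewrite !mulr_ge0 ?exprn_ge0 // expR_ge0.
      by move=> j; have := hyu n j s; rewrite -!mulrA.
  have E : z i t - y i t = g t - (y i t - u n.+1 i t) by rewrite /g; ring.
  rewrite E; apply: le_trans (ler_normB _ _) _; apply: le_trans (lerD h1 h2) _.
  apply: le_trans hn; rewrite exprS le_eqVlt; apply/orP; left; apply/eqP; by field.
exists y; split=> [i|i t].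
  by rewrite -zy /z; have [-> _] := primP _ (cAy y i cy); rewrite addr0.
have <- : z i = y i by apply/funext => s; exact: zy.
exact: dprim.
Qed.

(** Composing the coefficients with the retraction [clamp] of the line onto [[a, b]] makes them
    continuous and bounded everywhere without changing them on the segment. *)
Lemma linear_ode_segment (I : finType) (A : I -> I -> R -> R) (a b : R) (y0 : I -> R) :
  a < 0 < b -> (forall i j t, a <= t <= b -> {for t, continuous (A i j)}) ->
  exists y : I -> R -> R, (forall i, y i 0 = y0 i) /\
    forall i (t : R), a < t < b -> is_derive t 1 (y i) (\sum_j A i j t * y j t).
Proof.
move=> /andP[a0 b0] cA.
have ab : a <= b by rewrite ltW // (lt_trans a0).
pose clamp (t : R) : R^o := Num.max a (Num.min t b).
have ccl : continuous clamp.
  move=> t.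
  have cmin : {for t, continuous ((fun s : R => s : R^o) \min (fun=> b : R^o))}.
    by apply: continuous_min; [exact: cvg_id|exact: cst_continuous].
  by refine (continuous_max _ cmin); exact: cst_continuous.
have hcl t : a <= clamp t <= b.
  by rewrite /clamp le_max lexx /= ge_max ab ge_min lexx orbT.
have clE t : a < t < b -> clamp t = t.
  by move=> /andP[at' tb]; rewrite /clamp min_l ?max_r ?ltW.
have bnd i j : exists K, forall t, a <= t <= b -> `|A i j t| <= K.
  have cn : {within `[a, b], continuous (fun t => `|A i j t| : R)}.
    apply: continuous_in_subspaceT => t; rewrite inE /= in_itv /= => ht.
    by apply: cvg_norm; exact: cA.
  have [c _ hc] := EVT_max ab cn.
  by exists `|A i j c| => t ht; apply: hc; rewrite in_itv.
pose K i j := xget 0 [set K | forall t, a <= t <= b -> `|A i j t| <= K].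
have KP i j t : a <= t <= b -> `|A i j t| <= K i j.
  exact: (@xgetPex _ 0 [set K | forall t, a <= t <= b -> `|A i j t| <= K] (bnd i j)).
have K0 i j : 0 <= K i j.
  by apply: le_trans (KP i j a _); rewrite ?lexx.
have [|i j t|y [y0E dy]] := @linear_ode I (fun i j t => A i j (clamp t))
  (\sum_i \sum_j K i j) y0.
- move=> i j t; apply: (@continuous_comp _ _ _ clamp (A i j)); first exact: ccl.
  exact: cA.
- apply: le_trans (KP i j _ (hcl t)) _.
  rewrite (bigD1 i) //= (bigD1 j) //= -addrA lerDl addr_ge0 //.
    exact: sumr_ge0.
  by apply: sumr_ge0 => ? _; exact: sumr_ge0.
exists y; split=> // i t /clE tE.
have <- : \sum_j A i j (clamp t) * y j t = \sum_j A i j t * y j t.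
  by apply: eq_bigr => j _; rewrite tE.
exact: dy.
Qed.

End LinearODE.

(* Comparing two distinct values of [derive] by conversion unfolds limits and
   filters and does not terminate in practice, hence these opaque aliases. *)
Fact seal_key : unit. Proof. exact: tt. Qed.
Definition seal T (x : T) : T := locked_with seal_key x.
Lemma sealE T (x : T) : seal x = x.
Proof. by rewrite /seal unlock. Qed.

Section SealedDerivative.
Variable R : realType.
Implicit Types V W : normedModType R.

Definition dv V W (v : V) (f : V -> W) (x : V) : W := seal (@derive R V W) f x v.

Lemma dvE V W v (f : V -> W) x : dv v f x = 'D_v f x.
Proof. by rewrite /dv sealE. Qed.

Lemma dv_fun V W v (f : V -> W) : dv v f = 'D_v f.
Proof. by apply/funext => x; exact: dvE. Qed.

Lemma dv_comp V W (U : normedModType R) (f : V -> W) (g : W -> U) x v :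
  differentiable f x -> differentiable g (f x) ->
  dv v (fun y => g (f y)) x = dv (dv v f x) g (f x).
Proof. by move=> df dg; rewrite !dvE; exact: derive_comp. Qed.

Lemma dvP V W (f : V -> W) x (a : R) v w : differentiable f x ->
  dv (a *: v + w) f x = a *: dv v f x + dv w f x.
Proof. by move=> df; rewrite !dvE; exact: derive_linear. Qed.

Lemma dv_suml V W (f : V -> W) x I r (P : pred I) (a : I -> R) (v : I -> V) :
  differentiable f x ->
  dv (\sum_(i <- r | P i) a i *: v i) f x = \sum_(i <- r | P i) a i *: dv (v i) f x.
Proof.
by move=> df; rewrite dvE derive_suml //; apply: eq_bigr => i _; rewrite dvE.
Qed.

Lemma dv_row n W (f : 'rV[R]_n -> W) x v : differentiable f x ->
  dv v f x = \sum_i v 0 i *: dv (delta_mx 0 i) f x.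
Proof. by move=> df; rewrite [in LHS](row_sum_delta v) dv_suml. Qed.

Lemma dv0 V W (f : V -> W) x : dv 0 f x = 0.
Proof. by rewrite dvE derive0. Qed.

Lemma dvZ V W (f : V -> W) x (a : R) v : differentiable f x ->
  dv (a *: v) f x = a *: dv v f x.
Proof. by move=> df; rewrite -[a *: v]addr0 dvP // dv0 addr0. Qed.

Lemma dvD V W (f : V -> W) x v w : differentiable f x ->
  dv (v + w) f x = dv v f x + dv w f x.
Proof. by move=> df; rewrite -[v in LHS]scale1r dvP // scale1r. Qed.

Lemma dv_sumf V W I r (P : pred I) (f : I -> V -> W) x v :
  (forall i, P i -> differentiable (f i) x) ->
  dv v (fun y => \sum_(i <- r | P i) f i y) x = \sum_(i <- r | P i) dv v (f i) x.
Proof.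
by move=> df; rewrite dvE derive_sumf //; apply: eq_bigr => i _; rewrite dvE.
Qed.

Lemma dv_addf V W (f g : V -> W) x v :
  differentiable f x -> differentiable g x ->
  dv v (fun y => f y + g y) x = dv v f x + dv v g x.
Proof. by move=> df dg; rewrite !dvE; exact: derive_addf. Qed.

Lemma dv_oppf V W (f : V -> W) x v : differentiable f x ->
  dv v (fun y => - f y) x = - dv v f x.
Proof. by move=> df; rewrite !dvE; exact: derive_oppf. Qed.

Lemma dv_mulf V (f g : V -> R^o) x v :
  differentiable f x -> differentiable g x ->
  dv v (fun y => f y * g y : R^o) x = dv v f x * g x + f x * dv v g x.
Proof. by move=> df dg; rewrite !dvE; exact: derive_mulf. Qed.

Lemma dv_scale_row V n (k : V -> R^o) (f : V -> 'rV[R]_n) x v :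
  differentiable k x -> differentiable f x ->
  dv v (fun y => k y *: f y) x = dv v k x *: f x + k x *: dv v f x.
Proof. by move=> df dg; rewrite !dvE; exact: derive_scale_row. Qed.

Lemma dv_entry V n (f : V -> 'rV[R]_n) i x v : differentiable f x ->
  (dv v f x) 0 i = dv v (fun y => f y 0 i : R^o) x.
Proof. by move=> df; rewrite !dvE derive_entry. Qed.

Lemma dv_cst V W v (c : W) (x : V) : dv v (fun=> c) x = 0.
Proof. by rewrite dvE; exact: derive_cst. Qed.

Lemma dv_id V v (x : V) : dv v (fun y => y) x = v.
Proof. by rewrite dvE; exact: derive_id. Qed.

Lemma dv_near V W v (f g : V -> W) x : (\near x, f x = g x) -> dv v f x = dv v g x.
Proof. by move=> fg; rewrite !dvE; exact: near_eq_derive. Qed.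

Lemma dv_comm V (U : set V) n (f : V -> 'rV[R]_n) x v w : open U -> U x ->
  Cinfty U f -> dv w (dv v f) x = dv v (dv w f) x.
Proof.
move=> oU Ux cf; rewrite !dvE !dv_fun.
have dD u : differentiable ('D_u f) x.
  by apply: Cinfty_differentiable (Cinfty_derive u cf) Ux.
have E u u' i : 'D_u' (fun y => ('D_u f y) 0 i : R^o) x =
    'D_u' ('D_u (fun y => f y 0 i : R^o)) x.
  apply: near_eq_derive; apply: (open_eq_near oU Ux) => y Uy.
  by rewrite derive_entry //; exact: (Cinfty_differentiable cf Uy).
apply/rowP => i.
refine (eq_trans (derive_entry i w (dD v)) (eq_trans (E v w i) (eq_trans _
  (esym (eq_trans (derive_entry i v (dD w)) (E w v i)))))).
apply: (derive_comm _ _ oU Ux); exact: (Cinfty_entry i oU cf).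
Qed.

Lemma Cinfty_dv V W (U : set V) (f : V -> W) v : Cinfty U f -> Cinfty U (dv v f).
Proof. by rewrite dv_fun; exact: Cinfty_derive. Qed.

Lemma Cinfty_dv_comp V n m (U : set V) (U' : set 'rV[R]_n)
    (f : V -> 'rV[R]_n) (g : 'rV[R]_n -> 'rV[R]_m) (w : V -> 'rV[R]_n) :
  open U -> open U' -> U `<=` f @^-1` U' -> Cinfty U f -> Cinfty U' g ->
  Cinfty U w -> Cinfty U (fun x => dv (w x) g (f x)).
Proof.
move=> oU oU' UU cf cg cw; under eq_fun do rewrite dvE.
exact: (Cinfty_dir_comp oU oU' UU).
Qed.

End SealedDerivative.

Section InnerOf.
Variable R : realType.

Lemma inner_ofE n (G : 'M[R]_n) x y :
  inner_of G x y = \sum_i \sum_j x 0 i * G i j * y 0 j.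
Proof.
rewrite /inner_of mxE exchange_big; apply: eq_bigr => j _.
rewrite !mxE big_distrl; apply: eq_bigr => i _ //.
Qed.

Lemma inner_of_delta n (G : 'M[R]_n) i j :
  inner_of G (delta_mx 0 i) (delta_mx 0 j) = G i j.
Proof. by rewrite /inner_of -rowE trmx_delta -colE !mxE. Qed.

Lemma inner_ofDl n (G : 'M[R]_n) x x' y :
  inner_of G (x + x') y = inner_of G x y + inner_of G x' y.
Proof. by rewrite /inner_of !mulmxDl mxE. Qed.

Lemma inner_ofDr n (G : 'M[R]_n) x y y' :
  inner_of G x (y + y') = inner_of G x y + inner_of G x y'.
Proof. by rewrite /inner_of linearD mulmxDr mxE. Qed.

Lemma inner_ofZl n (G : 'M[R]_n) a x y :
  inner_of G (a *: x) y = a * inner_of G x y.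
Proof. by rewrite /inner_of -!scalemxAl mxE. Qed.

Lemma inner_ofZr n (G : 'M[R]_n) a x y :
  inner_of G x (a *: y) = a * inner_of G x y.
Proof. by rewrite /inner_of linearZ -scalemxAr mxE. Qed.

Lemma inner_of0l n (G : 'M[R]_n) y : inner_of G 0 y = 0.
Proof. by rewrite /inner_of !mul0mx mxE. Qed.

Lemma inner_of0r n (G : 'M[R]_n) x : inner_of G x 0 = 0.
Proof. by rewrite /inner_of trmx0 mulmx0 mxE. Qed.

Lemma inner_ofNl n (G : 'M[R]_n) x y : inner_of G (- x) y = - inner_of G x y.
Proof. by rewrite -scaleN1r inner_ofZl mulN1r. Qed.

Lemma inner_ofNr n (G : 'M[R]_n) x y : inner_of G x (- y) = - inner_of G x y.
Proof. by rewrite -scaleN1r inner_ofZr mulN1r. Qed.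

Lemma inner_of_suml n (G : 'M[R]_n) I r (P : pred I) (F : I -> 'rV_n) y :
  inner_of G (\sum_(i <- r | P i) F i) y = \sum_(i <- r | P i) inner_of G (F i) y.
Proof.
apply: (big_morph (fun x => inner_of G x y)); last exact: inner_of0l.
by move=> ? ?; exact: inner_ofDl.
Qed.

Lemma inner_of_sumr n (G : 'M[R]_n) I r (P : pred I) (F : I -> 'rV_n) x :
  inner_of G x (\sum_(i <- r | P i) F i) = \sum_(i <- r | P i) inner_of G x (F i).
Proof.
apply: (big_morph (inner_of G x)); last exact: inner_of0r.
by move=> ? ?; exact: inner_ofDr.
Qed.

Lemma inner_of_sym n (G : 'M[R]_n) x y : G^T = G ->
  inner_of G x y = inner_of G y x.
Proof.
move=> sG; rewrite /inner_of -[in LHS](trmxK (x *m G *m y^T)) mxE.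
by rewrite trmx_mul trmxK trmx_mul sG mulmxA.
Qed.

Lemma inner_of_raise n (G : 'M[R]_n) (L : 'rV[R]_n) y : G \in unitmx ->
  inner_of G (L *m invmx G) y = (L *m y^T) 0 0.
Proof. by move=> uG; rewrite /inner_of mulmxKV. Qed.

Lemma posdef_unitmx n (G : 'M[R]_n) :
  (forall x, x != 0 -> 0 < inner_of G x x) -> G \in unitmx.
Proof.
move=> posG; rewrite -row_free_unit -kermx_eq0; apply/eqP/row_matrixP => i.
rewrite row0; apply/eqP/negP => /negP xn0.
have := posG _ xn0; rewrite /inner_of.
have -> : row i (kermx G) *m G = 0 by rewrite -row_mul mulmx_ker row0.
by rewrite mul0mx mxE ltxx.
Qed.

Lemma inner_of_inj n (G : 'M[R]_n) x y : G \in unitmx ->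
  (forall z, inner_of G x z = inner_of G y z) -> x = y.
Proof.
move=> uG H; suff : x *m G = y *m G by move/(can_inj (mulmxK uG)).
apply/rowP => j; have := H (delta_mx 0 j).
by rewrite /inner_of !trmx_delta -!colE !mxE.
Qed.

Variable V : normedModType R.

Lemma diff_inner_of n (G : V -> 'M[R]_n) (s s' : V -> 'rV[R]_n) x :
  (forall i j, differentiable (fun y => G y i j : R^o) x) ->
  differentiable s x -> differentiable s' x ->
  differentiable (fun y => inner_of (G y) (s y) (s' y) : R^o) x /\
  forall v, dv v (fun y => inner_of (G y) (s y) (s' y) : R^o) x =
    inner_of (\matrix_(i, j) (dv v (fun y => G y i j : R^o) x : R)) (s x) (s' x)
    + inner_of (G x) (dv v s x) (s' x) + inner_of (G x) (s x) (dv v s' x).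
Proof.
move=> dG ds ds'.
have E : (fun y => inner_of (G y) (s y) (s' y)) =
    fun y => \sum_i \sum_j (s y 0 i * G y i j * s' y 0 j).
  by apply/funext => y; rewrite inner_ofE.
have d1 i j : differentiable (fun y => s y 0 i * G y i j : R^o) x.
  by apply: differentiable_mulf => //; exact: differentiable_entry.
have d2 i j : differentiable (fun y => s y 0 i * G y i j * s' y 0 j : R^o) x.
  by apply: differentiable_mulf => //; exact: differentiable_entry.
have d3 i : differentiable (fun y => \sum_j s y 0 i * G y i j * s' y 0 j : R^o) x.
  exact: differentiable_sumf.
rewrite E; split=> [|v]; first exact: differentiable_sumf.
rewrite (@dv_sumf R V R^o) // !inner_ofE -!big_split; apply: eq_bigr => i _ /=.
rewrite (@dv_sumf R V R^o) // -!big_split; apply: eq_bigr => j _ /=.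
rewrite (dv_mulf _ (d1 i j) (differentiable_entry _ ds')).
rewrite (dv_mulf _ (differentiable_entry _ ds) (dG i j)).
rewrite !mxE -!dv_entry //; ring.
Qed.

End InnerOf.

(** * The Koszul formula and its behaviour under pullback of the metric *)

Section Koszul.
Variables (R : realType) (n m : nat).
Variables (G : 'rV[R]_n -> 'M[R]_n) (H : 'rV[R]_m -> 'M[R]_m).
Variables (U : set 'rV[R]_n) (phi : 'rV[R]_n -> 'rV[R]_m) (z : 'rV[R]_n).

Definition dmx k (A : 'rV[R]_k -> 'M[R]_k) (x u : 'rV[R]_k) : 'M[R]_k :=
  \matrix_(i, j) (dv u (fun y => A y i j : R^o) x : R).

(** The Christoffel symbols of the first kind of the metric [A], that is, Koszul's formula for
    constant fields, whose brackets vanish. *)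
Definition koszul k (A : 'rV[R]_k -> 'M[R]_k) x a b c : R := 2^-1 *
  (inner_of (dmx A x a) b c + inner_of (dmx A x b) a c - inner_of (dmx A x c) a b).

Hypothesis oU : open U.
Hypothesis Uz : U z.
Hypothesis sphi : Cinfty U phi.
Hypothesis sH : forall y, (H y)^T = H y.
Hypothesis dG : forall i j, differentiable (fun y => G y i j : R^o) z.
Hypothesis dH : forall i j, differentiable (fun y => H y i j : R^o) (phi z).
Hypothesis GH : forall y a b, U y ->
  inner_of (G y) a b = inner_of (H (phi y)) (dv a phi y) (dv b phi y).

Lemma dmx_sym y u : (dmx H y u)^T = dmx H y u.
Proof.
apply/matrixP => i j; rewrite !mxE; congr (dv u _ _).
by apply/funext => x; rewrite -{1}(sH x) mxE.
Qed.

Lemma dv_dv_comm a b : dv a (dv b phi) z = dv b (dv a phi) z.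
Proof. exact: dv_comm oU Uz sphi. Qed.

Lemma dmx_pullback a b c : inner_of (dmx G z a) b c =
  inner_of (dmx H (phi z) (dv a phi z)) (dv b phi z) (dv c phi z)
  + inner_of (H (phi z)) (dv a (dv b phi) z) (dv c phi z)
  + inner_of (H (phi z)) (dv b phi z) (dv a (dv c phi) z).
Proof.
have dphi : differentiable phi z by exact: (Cinfty_differentiable sphi Uz).
have dD u : differentiable (dv u phi) z.
  by apply: Cinfty_differentiable (Cinfty_dv u sphi) Uz.
have dHp i j : differentiable (fun y => H (phi y) i j : R^o) z.
  exact: (differentiable_comp dphi (dH i j)).
have [_ /(_ a) EG] := diff_inner_of dG (differentiable_cst (b : 'rV[R]_n) z) (differentiable_cst (c : 'rV[R]_n) z).
have [_ /(_ a) EH] := diff_inner_of dHp (dD b) (dD c).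
have E : dv a (fun y => inner_of (G y) (b) (c) : R^o) z =
  dv a (fun y => inner_of (H (phi y)) (dv b phi y) (dv c phi y) : R^o) z.
  by apply: dv_near; apply: (open_eq_near oU Uz) => y Uy; exact: GH.
move: EG; rewrite E EH !dv_cst inner_of0l inner_of0r !addr0 => <-.
congr (inner_of _ _ _ + _ + _); apply/matrixP => i j; rewrite !mxE.
by rewrite -(dv_comp _ dphi (dH i j)).
Qed.

(** Differentiating [GH] turns the three terms of the Koszul formula of [G] into those of [H] plus
    second derivatives of [phi], of which all but one cancel by symmetry. For a chart change this is
    the transformation law of the Christoffel symbols; for an immersion it says that the second
    fundamental form is normal. *)
Lemma koszul_pullback GG HH a b c :
  (forall c, inner_of (G z) GG c = koszul G z a b c) ->
  (forall c, inner_of (H (phi z)) HH c = koszul H (phi z) (dv a phi z) (dv b phi z) c) ->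
  inner_of (H (phi z)) (dv a (dv b phi) z + HH - dv GG phi z) (dv c phi z) = 0.
Proof.
move=> hG hH; rewrite !inner_ofDl inner_ofNl -(GH _ _ Uz) hG hH /koszul.
rewrite !dmx_pullback (dv_dv_comm b a) (dv_dv_comm c a).
rewrite (dv_dv_comm c b).
rewrite (inner_of_sym (dv a phi z) _ (sH _)).
rewrite [inner_of _ (dv b phi z) (dv a (dv c phi) z)](inner_of_sym _ _ (sH _)).
by field.
Qed.

End Koszul.

(** * Charts and the Levi-Civita connection *)

Section Charts.
Variables (R : realType) (M : manifold R).
Implicit Types (p q r : M).

Notation cim p := (chart p @` dom p).

Lemma chartKd p q : dom p q -> chartV p (chart p q) = q.
Proof. by move=> pq; apply: chartK; rewrite inE. Qed.

Lemma chart_in p q : dom p q -> cim p (chart p q).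
Proof. by exists q. Qed.

Lemma chart_imP p z : cim p z -> dom p (chartV p z) /\ chart p (chartV p z) = z.
Proof. by move=> [q pq <-]; rewrite chartKd. Qed.

Lemma chart_imE p (B : set M) : B `<=` dom p ->
  chart p @` B = [set z | cim p z /\ B (chartV p z)].
Proof.
move=> Bp; apply/seteqP; split=> z.
  by move=> [q Bq <-]; rewrite /= chartKd; [split=> //; apply: chart_in|]; exact: Bp.
by move=> [/chart_imP[pz pzE] Bz]; exists (chartV p z).
Qed.

Lemma near_chartV p q (B : set M) : dom p q -> open B -> B q ->
  \forall z \near chart p q, [/\ cim p z, dom p (chartV p z),
    chart p (chartV p z) = z & B (chartV p z)].
Proof.
move=> pq oB Bq.
have cV : {for chart p q, continuous (chartV p)}.
  by apply: chartV_continuous; exact: chart_in.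
have n1 : \forall z \near chart p q, cim p z.
  by apply: open_nbhs_nbhs; split; [exact: chart_image_open|exact: chart_in].
have n2 : \forall z \near chart p q, B (chartV p z).
  by apply: cV; rewrite chartKd //; apply: open_nbhs_nbhs.
by apply: filterS2 n1 n2 => z /[dup] hz /chart_imP[? ?] ?; split.
Qed.

Lemma chart_im_open p (B : set M) : open B -> B `<=` dom p -> open (chart p @` B).
Proof.
move=> oB Bp; rewrite openE => _ [q Bq <-]; rewrite /interior chart_imE //.
by apply: filterS (near_chartV (Bp _ Bq) oB Bq) => z [].
Qed.

Lemma overlap_open p r : open (chart p @` (dom p `&` dom r)).
Proof. by apply: chart_im_open; [apply: openI; exact: dom_open|move=> ? []]. Qed.

Lemma trans_differentiable p r q : dom p q -> dom r q ->
  differentiable (fun z => chart r (chartV p z)) (chart p q).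
Proof.
move=> pq rq; apply: Cinfty_differentiable (transition_smooth p r) _.
by exists q.
Qed.

(* the change from the components in the chart at [p] to those in the chart at [r],
   for vectors tangent at [q] *)
Definition jac p r q (v : 'rV[R]_(dim M)) : 'rV[R]_(dim M) :=
  dv v (fun z => chart r (chartV p z)) (chart p q).

Lemma tcoordE p q v : tcoord p q v = jac q p q v.
Proof. by rewrite /jac dvE. Qed.

Lemma coord_fieldE p y q : coord_field p y q = jac p q q y.
Proof. by rewrite /jac dvE. Qed.

Lemma near_dom (T : topologicalType) (F : T -> M) x r :
  {for x, continuous F} -> dom r (F x) -> \forall y \near x, dom r (F y).
Proof. by move=> cF rx; apply: cF; apply: open_nbhs_nbhs; split=> //; exact: dom_open. Qed.

Section MapsFromVector.
Variable V : normedModType R.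

Lemma chart_change (F : V -> M) x r s : {for x, continuous F} ->
  dom r (F x) -> dom s (F x) -> differentiable (fun y => chart r (F y)) x ->
  differentiable (fun y => chart s (F y)) x /\
  forall v, dv v (fun y => chart s (F y)) x =
            jac r s (F x) (dv v (fun y => chart r (F y)) x).
Proof.
move=> cF rx sx dr.
have dt := trans_differentiable rx sx.
have E : \near x, chart s (chartV r (chart r (F x))) = chart s (F x).
  by apply: filterS (near_dom cF rx) => y ry; rewrite chartKd.
split=> [|v].
  apply: (differentiable_near E).
  exact: (@differentiable_comp _ _ _ _ _ (fun z => chart s (chartV r z)) _ dr dt).
by rewrite -(dv_near v E) (@dv_comp _ _ _ _ _ (fun z => chart s (chartV r z)) x v dr dt).
Qed.

End MapsFromVector.

Lemma jac_comp p r s q v : dom p q -> dom r q -> dom s q ->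
  jac r s q (jac p r q v) = jac p s q v.
Proof.
move=> pq rq sq.
have cV : {for chart p q, continuous (chartV p)}.
  by apply: chartV_continuous; exact: chart_in.
have rV : dom r (chartV p (chart p q)) by rewrite chartKd.
have sV : dom s (chartV p (chart p q)) by rewrite chartKd.
have [_ /(_ v)] := chart_change cV rV sV (trans_differentiable pq rq).
by rewrite chartKd // => E; exact: esym E.
Qed.

Lemma jac_id p q v : dom p q -> jac p p q v = v.
Proof.
move=> pq; rewrite /jac (@dv_near _ _ _ v _ (fun z => z)) ?dv_id //.
by apply: filterS (near_chartV pq openT Logic.I) => z [].
Qed.

Lemma jacK p r q : dom p q -> dom r q -> cancel (jac p r q) (jac r p q).
Proof. by move=> pq rq v; rewrite jac_comp // jac_id. Qed.

Lemma jacD p r q v w : dom p q -> dom r q ->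
  jac p r q (v + w) = jac p r q v + jac p r q w.
Proof. by move=> pq rq; rewrite /jac dvD //; exact: trans_differentiable. Qed.

Lemma jacZ p r q a v : dom p q -> dom r q -> jac p r q (a *: v) = a *: jac p r q v.
Proof. by move=> pq rq; rewrite /jac dvZ //; exact: trans_differentiable. Qed.

Lemma jac0 p r q : jac p r q 0 = 0.
Proof. by rewrite /jac dv0. Qed.

Lemma jac_sum p r q I l (P : pred I) (F : I -> 'rV_(dim M)) :
  dom p q -> dom r q ->
  jac p r q (\sum_(i <- l | P i) F i) = \sum_(i <- l | P i) jac p r q (F i).
Proof.
move=> pq rq; apply: (big_morph (jac p r q)); last exact: jac0.
by move=> v w; exact: jacD.
Qed.

End Charts.
Notation cim p := (chart p @` dom p).

Section Metric.
Variables (R : realType) (M : riemannian R).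
Implicit Types (p q r : M).
Notation n := (dim M).

Definition mcoord p a b z : R := seal (@metric_coord R M) (@metric R M) p a b z.

Lemma mcoordE p a b q : dom p q ->
  mcoord p a b (chart p q) = inner q (jac p q q a) (jac p q q b).
Proof. by move=> pq; rewrite /mcoord sealE /metric_coord /= chartKd // !coord_fieldE. Qed.

(* [gmx p z] and [Gam p z] are the metric and the Christoffel symbols in the chart
   at [p], at the point with coordinates [z]. *)
Definition gmx p (z : 'rV[R]_n) : 'M[R]_n :=
  \matrix_(i, j) mcoord p (delta_mx 0 i) (delta_mx 0 j) z.

Lemma metricC q x y : inner q x y = inner q y x :> R.
Proof. by apply: inner_of_sym; exact: metric_sym. Qed.

Lemma gmx_sym p z : (gmx p z)^T = gmx p z.
Proof.
apply/matrixP => i j; rewrite !mxE /mcoord sealE /metric_coord.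
exact: metricC.
Qed.

Lemma gmxE p q a b : dom p q ->
  inner_of (gmx p (chart p q)) a b = inner q (jac p q q a) (jac p q q b).
Proof.
move=> pq; rewrite inner_ofE [in RHS](row_sum_delta a) [in RHS](row_sum_delta b).
rewrite !jac_sum // /inner inner_of_suml; apply: eq_bigr => i _.
rewrite inner_of_sumr; apply: eq_bigr => j _.
rewrite !jacZ // inner_ofZl inner_ofZr mxE mcoordE // /inner; ring.
Qed.

Lemma gmx_self q : gmx q (chart q q) = metric q.
Proof.
apply/matrixP => i j; rewrite -[LHS]inner_of_delta gmxE //.
by rewrite !jac_id // /inner inner_of_delta.
Qed.

Lemma gmx_change p r q a b : dom p q -> dom r q ->
  inner_of (gmx p (chart p q)) a b =
  inner_of (gmx r (chart r q)) (jac p r q a) (jac p r q b).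
Proof. by move=> pq rq; rewrite !gmxE // !jac_comp //. Qed.

Lemma inner_chart r q x y : dom r q ->
  inner q x y = inner_of (gmx r (chart r q)) (jac q r q x) (jac q r q y).
Proof. by move=> rq; rewrite -gmx_change // gmx_self. Qed.

Lemma gmx_unit p q : dom p q -> gmx p (chart p q) \in unitmx.
Proof.
move=> pq; apply: posdef_unitmx => x x0; rewrite gmxE //; apply: metric_pos.
apply: contra_neq x0 => jx; rewrite -(jacK pq (dom_self q) x) jx; exact: jac0.
Qed.

Lemma metric_unit q : metric q \in unitmx.
Proof. by rewrite -gmx_self; apply: gmx_unit; exact: dom_self. Qed.

Lemma gmx_smooth p : Cinfty_mx (cim p) (gmx p).
Proof.
move=> i j; under eq_fun do rewrite mxE /mcoord sealE.
exact: metric_smooth.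
Qed.

Lemma gmx_differentiable p q i j : dom p q ->
  differentiable (fun z => gmx p z i j : R^o) (chart p q).
Proof. by move=> pq; refine (Cinfty_differentiable (@gmx_smooth p i j) (chart_in pq)). Qed.

Lemma dmxP p q a u w b c : dom p q ->
  inner_of (dmx (gmx p) (chart p q) (a *: u + w)) b c =
  a * inner_of (dmx (gmx p) (chart p q) u) b c
  + inner_of (dmx (gmx p) (chart p q) w) b c.
Proof.
move=> pq; rewrite !inner_ofE big_distrr -big_split; apply: eq_bigr => i _ /=.
rewrite big_distrr -big_split; apply: eq_bigr => j _ /=; rewrite !mxE.
rewrite dvP; last exact: gmx_differentiable.
rewrite /GRing.scale /=; ring.
Qed.

Definition Gam p z a b : 'rV[R]_n :=
  (\row_l koszul (gmx p) z a b (delta_mx 0 l)) *m invmx (gmx p z).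

Lemma koszulP3 p q a b x c d : dom p q ->
  koszul (gmx p) (chart p q) a b (x *: c + d) =
  x * koszul (gmx p) (chart p q) a b c + koszul (gmx p) (chart p q) a b d.
Proof.
move=> pq; rewrite /koszul dmxP // !inner_ofDr !inner_ofZr; ring.
Qed.

Lemma koszulP1 p q b c x a d : dom p q ->
  koszul (gmx p) (chart p q) (x *: a + d) b c =
  x * koszul (gmx p) (chart p q) a b c + koszul (gmx p) (chart p q) d b c.
Proof.
move=> pq; rewrite /koszul dmxP // !inner_ofDl !inner_ofZl; ring.
Qed.

Lemma koszulC p z a b c : koszul (gmx p) z a b c = koszul (gmx p) z b a c.
Proof.
rewrite /koszul [inner_of _ a b]inner_of_sym; first by ring.
by apply: dmx_sym => y; exact: gmx_sym.
Qed.

Lemma GamP p q a b c : dom p q ->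
  inner_of (gmx p (chart p q)) (Gam p (chart p q) a b) c =
  koszul (gmx p) (chart p q) a b c.
Proof.
move=> pq; rewrite inner_of_raise ?gmx_unit // mxE.
have K0 : koszul (gmx p) (chart p q) a b 0 = 0.
  by have := koszulP3 a b (-1) 0 0 pq; rewrite scaler0 addr0 mulN1r addNr.
rewrite [in RHS](row_sum_delta c).
rewrite (big_morph (koszul (gmx p) (chart p q) a b) (id1 := 0) (op1 := +%R)) //.
  apply: eq_bigr => i _; rewrite !mxE mulrC.
  by rewrite -[_ *: _ in RHS]addr0 koszulP3 // K0 addr0.
by move=> x y; rewrite -[x in LHS]scale1r koszulP3 // mul1r.
Qed.

Lemma GamC p z a b : Gam p z a b = Gam p z b a.
Proof. by congr (_ *m _); apply/rowP => l; rewrite !mxE koszulC. Qed.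

Lemma GamPl p q x a d b : dom p q ->
  Gam p (chart p q) (x *: a + d) b = x *: Gam p (chart p q) a b + Gam p (chart p q) d b.
Proof.
move=> pq; rewrite /Gam scalemxAl -mulmxDl; congr (_ *m _).
by apply/rowP => l; rewrite !mxE koszulP1.
Qed.

Lemma dv_mcoord p q a b c : dom p q ->
  dv a (mcoord p b c : _ -> R^o) (chart p q) = inner_of (dmx (gmx p) (chart p q) a) b c.
Proof.
move=> pq.
have E : \forall z \near chart p q, inner_of (gmx p z) b c = mcoord p b c z :> R^o.
  apply: filterS (near_chartV pq openT Logic.I) => z [_ hz zE _].
  by rewrite -zE gmxE // mcoordE.
rewrite -(dv_near a E).
have [_ ->] := @diff_inner_of R _ n (gmx p) (fun=> b) (fun=> c) (chart p q)
  (fun i j => gmx_differentiable i j pq) (differentiable_cst (b : 'rV[R]_n) _)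
  (differentiable_cst (c : 'rV[R]_n) _).
by rewrite !dv_cst inner_of0l inner_of0r !addr0.
Qed.

Lemma christoffelE p a b : christoffel p a b = Gam p (chart p p) a b.
Proof.
rewrite /christoffel /Gam gmx_self; congr (_ *m _); apply/rowP => l; rewrite !mxE.
have E a' b' c' : 'D_a' (metric_coord (@metric R M) p b' c') (chart p p) =
    inner_of (dmx (gmx p) (chart p p) a') b' c'.
  by rewrite -dv_mcoord // dvE /mcoord sealE.
refine (f_equal (fun x : R => 2^-1 * x) (f_equal2 (fun x y : R => x - y)
  (f_equal2 (fun x y : R => x + y) (E a b _) (E b a _)) (E _ a b))).
Qed.

Lemma trans_pullback p r z a b : (chart p @` (dom p `&` dom r)) z ->
  inner_of (gmx p z) a b = inner_of (gmx r (chart r (chartV p z)))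
    (dv a (fun z => chart r (chartV p z)) z) (dv b (fun z => chart r (chartV p z)) z).
Proof. by move=> [q [pq rq] <-]; rewrite chartKd // (gmx_change a b pq rq). Qed.

(** A transition map is isometric for the metrics read in the two charts, so by the Koszul identity
    the difference of both sides is orthogonal to the image of [jac p r q], which is the whole
    space. *)
Lemma Gam_change p r q a b : dom p q -> dom r q ->
  dv a (dv b (fun z => chart r (chartV p z))) (chart p q)
    + Gam r (chart r q) (jac p r q a) (jac p r q b) =
  jac p r q (Gam p (chart p q) a b).
Proof.
move=> pq rq; apply/eqP; rewrite -subr_eq0; apply/eqP.
apply: (inner_of_inj (gmx_unit rq)) => w; rewrite inner_of0l -(jacK rq pq w).
have Uz : (chart p @` (dom p `&` dom r)) (chart p q) by exists q.
have := @koszul_pullback R n n (gmx p) (gmx r) _ (fun z => chart r (chartV p z))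
  (chart p q) (@overlap_open _ M p r) Uz (transition_smooth p r) (gmx_sym r)
  (fun i j => gmx_differentiable i j pq).
rewrite chartKd // => /(_ (fun i j => gmx_differentiable i j rq)
  (fun z a b hz => trans_pullback a b hz)); apply.
- by move=> c; exact: GamP.
- by move=> c; exact: GamP.
Qed.

End Metric.

Section DirectionVariation.
Variables (R : realType) (V : normedModType R) (n m : nat).
Variables (U : set 'rV[R]_n) (tau : 'rV[R]_n -> 'rV[R]_m).
Hypothesis oU : open U.
Hypothesis stau : Cinfty U tau.

(** Both the point and the direction of the derivative vary. Expanding [w] in the standard basis
    leaves fixed partial derivatives of [tau] with variable coefficients, so the product rule
    applies. *)
Lemma dv_dir (phi w : V -> 'rV[R]_n) x : differentiable phi x ->
  differentiable w x -> U (phi x) ->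
  differentiable (fun y => dv (w y) tau (phi y)) x /\
  forall v, dv v (fun y => dv (w y) tau (phi y)) x =
    dv (dv v phi x) (dv (w x) tau) (phi x) + dv (dv v w x) tau (phi x).
Proof.
move=> dphi dw Ux.
have dtau z : U z -> differentiable tau z by exact: Cinfty_differentiable.
have dDtau u : differentiable (dv u tau) (phi x).
  exact: Cinfty_differentiable (Cinfty_dv u stau) Ux.
have E : \near x, \sum_i w x 0 i *: dv (delta_mx 0 i) tau (phi x) = dv (w x) tau (phi x).
  have : \forall y \near x, U (phi y).
    by apply: (differentiable_continuous dphi); apply: open_nbhs_nbhs.
  by apply: filterS => y Uy; rewrite -dv_row //; exact: dtau.
have dDp i : differentiable (fun y => dv (delta_mx 0 i) tau (phi y)) x.
  exact: (differentiable_comp dphi (dDtau _)).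
have dt i : differentiable (fun y => w y 0 i *: dv (delta_mx 0 i) tau (phi y)) x.
  by apply: differentiable_scale_row => //; exact: differentiable_entry.
split=> [|v].
  by apply: (differentiable_near E); apply: differentiable_sumf.
rewrite -(dv_near v E) dv_sumf //.
have Ew : \forall z \near phi x,
    \sum_i w x 0 i *: dv (delta_mx 0 i) tau z = dv (w x) tau z.
  apply: (open_eq_near oU Ux) => z Uz; rewrite -dv_row //; exact: dtau.
rewrite -(dv_near _ Ew) dv_sumf; last first.
  move=> i _; apply: differentiable_scale_row => //; exact: differentiable_cst.
rewrite [dv (dv v w x) tau _]dv_row; last exact: dtau.
rewrite -big_split; apply: eq_bigr => i _ /=.
rewrite dv_scale_row //; last exact: differentiable_entry.
rewrite dv_scale_row //.
by rewrite dv_cst scale0r add0r addrC -dv_comp // dv_entry.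
Qed.

End DirectionVariation.

(** * Velocities and differentials in charts *)

Section CurvesAndMaps.
Variables (R : realType) (M : manifold R).
Implicit Types (p q r : M).

Section FromVector.
Variable V : normedModType R.
Implicit Types (F : V -> M) (x v : V).

(** Continuity is a separate clause because a chart takes unspecified values off its domain:
    differentiability of [chart (F x) \o F] alone would say nothing about [F]. *)
Definition mdiff F x :=
  {for x, continuous F} /\ differentiable (fun y => chart (F x) (F y)) x.

Lemma mdiff_chart F x r : mdiff F x -> dom r (F x) ->
  differentiable (fun y => chart r (F y)) x.
Proof. by move=> [cF dF] rx; have [] := chart_change cF (dom_self _) rx dF. Qed.

Lemma mdiffI F x r : {for x, continuous F} -> dom r (F x) ->
  differentiable (fun y => chart r (F y)) x -> mdiff F x.
Proof. by move=> cF rx dF; split=> //; have [] := chart_change cF rx (dom_self _) dF. Qed.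

Definition vel F x v := dv v (fun y => chart (F x) (F y)) x.

Lemma vel_chart F x v r : mdiff F x -> dom r (F x) ->
  jac (F x) r (F x) (vel F x v) = dv v (fun y => chart r (F y)) x.
Proof. by move=> [cF dF] rx; have [_ ->] := chart_change cF (dom_self _) rx dF. Qed.

Lemma velP F x a v w : mdiff F x -> vel F x (a *: v + w) = a *: vel F x v + vel F x w.
Proof. by move=> [_ dF]; rewrite /vel dvP. Qed.

Lemma mdiff_near F F' x : (\near x, F x = F' x) -> mdiff F x -> mdiff F' x.
Proof.
move=> E [cF dF]; have Ex : F x = F' x by exact: nbhs_singleton E.
split.
  rewrite /prop_for /continuous_at -Ex; apply: cvg_trans cF.
  by apply: near_eq_cvg; apply: filterS E => y ->.
rewrite -Ex; apply: differentiable_near dF.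
by apply: filterS E => y ->.
Qed.

Lemma vel_near F F' x v : (\near x, F x = F' x) -> vel F x v = vel F' x v.
Proof.
move=> E; have Ex : F x = F' x by exact: nbhs_singleton E.
by rewrite /vel -Ex; apply: dv_near; apply: filterS E => y ->.
Qed.

End FromVector.

Lemma mdiff_chartV p q : dom p q -> mdiff (chartV p) (chart p q).
Proof.
move=> pq; apply: (@mdiffI _ _ _ q); rewrite ?chartKd //.
  by apply: chartV_continuous; exact: chart_in.
exact: trans_differentiable.
Qed.

Lemma vel_chartV p q v : dom p q -> vel (chartV p) (chart p q) v = jac p q q v.
Proof. by move=> pq; rewrite /vel chartKd. Qed.

Lemma mdiff_comp (V W : normedModType R) (F : W -> M) (psi : V -> W) x :
  differentiable psi x -> mdiff F (psi x) ->
  mdiff (fun y => F (psi y)) x /\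
  forall v, vel (fun y => F (psi y)) x v = vel F (psi x) (dv v psi x).
Proof.
move=> dpsi [cF dF]; split=> [|v].
  split; last exact: (differentiable_comp dpsi dF).
  by apply: continuous_comp => //; exact: differentiable_continuous.
by rewrite /vel (dv_comp _ dpsi dF).
Qed.

End CurvesAndMaps.

Section Maps.
Variables (R : realType) (M N : manifold R).
Implicit Types (p q : M) (r : N) (g : M -> N).

Definition gdiff g q := {for q, continuous g} /\ mdiff (fun z => g (chartV q z)) (chart q q).

Definition tm g q (v : 'rV[R]_(dim M)) := vel (fun z => g (chartV q z)) (chart q q) v.

Lemma tmapE g q v : tmap g q v = tm g q v.
Proof. by rewrite /tm /vel dvE chartKd. Qed.

Lemma vel_map (V : normedModType R) g (F : V -> M) x : mdiff F x -> gdiff g (F x) ->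
  mdiff (fun y => g (F y)) x /\
  forall v, vel (fun y => g (F y)) x v = tm g (F x) (vel F x v).
Proof.
move=> [cF dF] [cg dg].
have E : \near x, g (chartV (F x) (chart (F x) (F x))) = g (F x).
  have /= := near_dom cF (dom_self (F x)).
  by move: (F x) => q; apply: filterS => y ry; rewrite chartKd.
have [m1 v1] := mdiff_comp dF dg.
split=> [|v].
  apply: (mdiff_near _ m1).
  have := near_dom cF (dom_self (F x)).
  by apply: filterS => y ry; rewrite chartKd.
rewrite /tm -v1; apply: vel_near.
have := near_dom cF (dom_self (F x)).
by apply: filterS => y ry; rewrite chartKd.
Qed.

Lemma smooth_gdiff g q : smooth g -> gdiff g q.
Proof.
move=> [cg sg]; split; first exact: cg.
apply: (@mdiffI _ _ _ _ _ (g q)); rewrite ?chartKd //.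
  apply: continuous_comp; last by rewrite chartKd //; exact: cg.
  by apply: chartV_continuous; exact: chart_in.
by apply: (Cinfty_differentiable (sg q (g q))); exists q => //; split => //=.
Qed.

Lemma tm_chart g p q r v : gdiff g q -> dom p q -> dom r (g q) ->
  jac (g q) r (g q) (tm g q v) = dv (jac q p q v) (fun z => chart r (g (chartV p z))) (chart p q).
Proof.
move=> dg pq rq.
have [] := @vel_map _ g (chartV p) (chart p q) (mdiff_chartV pq).
  by rewrite chartKd.
move=> m1 v1; have := v1 (jac q p q v); rewrite vel_chartV // chartKd // jacK //.
move=> <-; rewrite -(vel_chart _ m1) chartKd //.
Qed.

Lemma tmP g q a v w : gdiff g q -> tm g q (a *: v + w) = a *: tm g q v + tm g q w.
Proof. by move=> [_ dg]; rewrite /tm velP. Qed.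

End Maps.

Section TangentFunctor.
Variables (R : realType) (M N P : manifold R).

Lemma tm_comp (g : M -> N) (k : N -> P) q v : gdiff g q -> gdiff k (g q) ->
  gdiff (fun q => k (g q)) q /\ tm (fun q => k (g q)) q v = tm k (g q) (tm g q v).
Proof.
move=> [cg dg] dk.
have dk' : gdiff k (g (chartV q (chart q q))) by rewrite chartKd.
have [m1 v1] := vel_map dg dk'; split; last by rewrite /tm v1 chartKd.
by split=> //; apply: continuous_comp => //; case: dk.
Qed.

Lemma tm_id (q : M) v : tm (fun q => q) q v = v.
Proof. by rewrite /tm vel_chartV // jac_id. Qed.

Lemma gdiff_id (q : M) : gdiff (fun q : M => q) q.
Proof. by split; [exact: cvg_id|exact: mdiff_chartV]. Qed.

End TangentFunctor.

(** * Covariant derivatives of fields along a map *)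

Section CovariantDerivative.
Variables (R : realType) (N : riemannian R).
Implicit Types (r : N).

Section Along.
Variable V : normedModType R.
Implicit Types (F : V -> N) (x v : V) (s : V -> 'rV[R]_(dim N)).

(** The components of [s] in the single chart at [r]. The values [s y] themselves refer to the chart
    at [F y], so only [shat] can be meaningfully differentiated. *)
Definition shat r F s y := jac (F y) r (F y) (s y).

Definition sdiff F s x := differentiable (shat (F x) F s) x.

(* The fields [s] along [F : V -> N] include the case of a curve, [V = R^o];
   [nabla f p] is the case [F = f \o chartV p]. *)
Definition covd F x v s : 'rV[R]_(dim N) :=
  seal (dv v (shat (F x) F s) x + Gam (F x) (chart (F x) (F x)) (vel F x v) (s x)).

Lemma shat_self F s x : shat (F x) F s x = s x.
Proof. by rewrite /shat jac_id. Qed.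

Lemma shat_change F s x r r' : {for x, continuous F} -> dom r (F x) -> dom r' (F x) ->
  \near x, dv (shat r F s x) (fun z => chart r' (chartV r z)) (chart r (F x))
           = shat r' F s x.
Proof.
move=> cF rx rx'; have n1 := near_dom cF rx; have n2 := near_dom cF rx'.
by apply: filterS2 n1 n2 => y ry ry'; rewrite -/(jac _ _ _ _) jac_comp.
Qed.

Lemma sdiff_change F s x r r' : mdiff F x -> dom r (F x) -> dom r' (F x) ->
  differentiable (shat r F s) x -> differentiable (shat r' F s) x.
Proof.
move=> mF rx rx' ds; apply: (differentiable_near (shat_change s mF.1 rx rx')).
have Ux : (chart r @` (dom r `&` dom r')) (chart r (F x)) by exists (F x).
have [] := dv_dir (@overlap_open _ _ r r') (transition_smooth r r')
  (mdiff_chart mF rx) ds Ux; by [].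
Qed.

Lemma sdiffI F s x r : mdiff F x -> dom r (F x) ->
  differentiable (shat r F s) x -> sdiff F s x.
Proof. by move=> mF rx; apply: sdiff_change. Qed.

(** Independence of the chart: differentiating the change of components produces a second derivative
    of the transition map, which the transformation law of the Christoffel symbols absorbs. *)
Lemma covd_chart F s x v r : mdiff F x -> sdiff F s x -> dom r (F x) ->
  jac (F x) r (F x) (covd F x v s) =
  dv v (shat r F s) x
  + Gam r (chart r (F x)) (dv v (fun y => chart r (F y)) x) (shat r F s x).
Proof.
move=> mF ds rx; set q := F x.
rewrite /covd !sealE jacD // -Gam_change // -(dv_near v (shat_change s mF.1 (dom_self q) rx)).
have Ux : (chart q @` (dom q `&` dom r)) (chart q (F x)) by exists (F x).
have [_ ->] := dv_dir (@overlap_open _ _ q r) (transition_smooth q r)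
  (mdiff_chart mF (dom_self q)) ds Ux.
rewrite -/(vel F x v) shat_self addrAC.
rewrite -[X in dv (vel F x v) X]/(dv (s x) (fun z => chart r (chartV q z))).
by rewrite [LHS]addrC -(vel_chart v mF rx).
Qed.

Lemma near_dom_self F x : {for x, continuous F} -> \forall y \near x, dom (F x) (F y).
Proof. by move=> cF; apply: near_dom. Qed.

Lemma sdiffD F s s' x : mdiff F x -> sdiff F s x -> sdiff F s' x ->
  sdiff F (fun y => s y + s' y) x.
Proof.
move=> mF ds ds'; apply: (differentiable_near _ (differentiable_addf ds ds')).
by apply: filterS (near_dom_self mF.1) => y hy; rewrite /shat jacD.
Qed.

Lemma GamPr r q a b (x : R) d : dom r q ->
  Gam r (chart r q) a (x *: b + d) = x *: Gam r (chart r q) a b + Gam r (chart r q) a d.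
Proof. by move=> rq; rewrite GamC GamPl // (GamC _ _ b) (GamC _ _ d). Qed.

Lemma GamZr r q a b (x : R) : dom r q ->
  Gam r (chart r q) a (x *: b) = x *: Gam r (chart r q) a b.
Proof.
move=> rq; have G0 : Gam r (chart r q) a 0 = 0.
  by have := GamPr a 0 (-1) 0 rq; rewrite scaler0 addr0 scaleN1r addNr.
by rewrite -[x *: b]addr0 GamPr // G0 addr0.
Qed.

Lemma GamDr r q a b d : dom r q ->
  Gam r (chart r q) a (b + d) = Gam r (chart r q) a b + Gam r (chart r q) a d.
Proof. by move=> rq; rewrite -[b in LHS]scale1r GamPr // scale1r. Qed.

Lemma dv_shatD F s s' x v : mdiff F x -> sdiff F s x -> sdiff F s' x ->
  dv v (shat (F x) F (fun y => s y + s' y)) x =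
  dv v (shat (F x) F s) x + dv v (shat (F x) F s') x.
Proof.
move=> mF ds ds'; rewrite -dv_addf //; apply: dv_near.
by apply: filterS (near_dom_self mF.1) => y hy; rewrite /shat jacD.
Qed.

Lemma covdD F s s' x v : mdiff F x -> sdiff F s x -> sdiff F s' x ->
  covd F x v (fun y => s y + s' y) = covd F x v s + covd F x v s'.
Proof. by move=> mF ds ds'; rewrite /covd !sealE dv_shatD // GamDr // addrACA. Qed.

Lemma sdiff_scale F (k : V -> R^o) s x : mdiff F x -> differentiable k x ->
  sdiff F s x -> sdiff F (fun y => k y *: s y) x.
Proof.
move=> mF dk ds; apply: (differentiable_near _ (differentiable_scale_row dk ds)).
by apply: filterS (near_dom_self mF.1) => y hy; rewrite /shat jacZ.
Qed.

Lemma covd_scale F (k : V -> R^o) s x v : mdiff F x -> differentiable k x ->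
  sdiff F s x ->
  covd F x v (fun y => k y *: s y) = dv v k x *: s x + k x *: covd F x v s.
Proof.
move=> mF dk ds; rewrite /covd !sealE GamZr // scalerDr addrA; congr (_ + _).
rewrite -{1}(shat_self F s x) -dv_scale_row //; apply: dv_near.
by apply: filterS (near_dom_self mF.1) => y hy; rewrite /shat jacZ.
Qed.

Lemma covd_near F s s' x v : (\near x, s x = s' x) -> covd F x v s = covd F x v s'.
Proof.
move=> E; rewrite /covd !sealE (nbhs_singleton E); congr (_ + _).
by apply: dv_near; apply: filterS E => y Ey; rewrite /shat Ey.
Qed.

Lemma sdiff_near F s s' x : (\near x, s x = s' x) -> sdiff F s x -> sdiff F s' x.
Proof.
move=> E; apply: differentiable_near; apply: filterS E => y Ey.
by rewrite /shat Ey.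
Qed.

Lemma covd_near_map F F' s x v : (\near x, F x = F' x) ->
  covd F x v s = covd F' x v s.
Proof.
move=> E; have Ex : F x = F' x by exact: nbhs_singleton E.
rewrite /covd !sealE (vel_near _ E) -Ex; congr (_ + _).
by apply: dv_near; apply: filterS E => y Ey; rewrite /shat Ey.
Qed.

Lemma sdiff_near_map F F' s x : (\near x, F x = F' x) -> sdiff F s x -> sdiff F' s x.
Proof.
move=> E; have Ex : F x = F' x by exact: nbhs_singleton E.
rewrite /sdiff -Ex; apply: differentiable_near; apply: filterS E => y Ey.
by rewrite /shat Ey.
Qed.

Lemma sdiff0 F x : sdiff F (fun=> 0) x.
Proof.
rewrite /sdiff (_ : shat _ _ _ = fun=> 0); first exact: differentiable_cst.
by apply/funext => y; rewrite /shat jac0.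
Qed.

Lemma covd0 F x v : mdiff F x -> covd F x v (fun=> 0) = 0.
Proof.
move=> mF; have d0 := @sdiff0 F x.
have := covdD v mF d0 d0; rewrite addr0 => E.
by apply: (@addrI _ (covd F x v (fun=> 0))); rewrite addr0 -E.
Qed.

Lemma sdiff_covd_sum F x v I l (P : pred I) (s : I -> V -> 'rV_(dim N)) :
  mdiff F x -> (forall i, sdiff F (s i) x) ->
  sdiff F (fun y => \sum_(i <- l | P i) s i y) x /\
  covd F x v (fun y => \sum_(i <- l | P i) s i y) = \sum_(i <- l | P i) covd F x v (s i).
Proof.
move=> mF ds; elim: l => [|i l [IHd IHD]].
  under eq_fun do rewrite big_nil; rewrite big_nil; split; first exact: sdiff0.
  exact: covd0.
under eq_fun do rewrite big_cons; rewrite big_cons; case: ifP => // Pi; split.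
  exact: sdiffD.
by rewrite covdD // IHD.
Qed.

Lemma sdiff_sum F x I l (P : pred I) (s : I -> V -> 'rV_(dim N)) :
  mdiff F x -> (forall i, sdiff F (s i) x) ->
  sdiff F (fun y => \sum_(i <- l | P i) s i y) x.
Proof. by move=> mF ds; case: (sdiff_covd_sum 0 l P mF ds). Qed.

Lemma covd_sum F x v I l (P : pred I) (s : I -> V -> 'rV_(dim N)) :
  mdiff F x -> (forall i, sdiff F (s i) x) ->
  covd F x v (fun y => \sum_(i <- l | P i) s i y) = \sum_(i <- l | P i) covd F x v (s i).
Proof. by move=> mF ds; case: (sdiff_covd_sum v l P mF ds). Qed.

Lemma covdN F x v s : mdiff F x -> sdiff F s x ->
  covd F x v (fun y => - s y) = - covd F x v s.
Proof.
move=> mF ds; have := covd_scale v mF (differentiable_cst (-1 : R^o) x) ds.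
rewrite dv_cst scale0r add0r scaleN1r => <-.
by congr covd; apply/funext => y; rewrite scaleN1r.
Qed.

Lemma sdiffN F x s : mdiff F x -> sdiff F s x -> sdiff F (fun y => - s y) x.
Proof.
move=> mF ds; have := sdiff_scale mF (differentiable_cst (-1 : R^o) x) ds.
by under eq_fun do rewrite scaleN1r.
Qed.

Lemma covdP F s x a v w : mdiff F x -> sdiff F s x ->
  covd F x (a *: v + w) s = a *: covd F x v s + covd F x w s.
Proof.
by move=> mF ds; rewrite /covd !sealE velP // GamPl // dvP // scalerDr addrACA.
Qed.

(** Compatibility with the metric: by the Koszul formula the two Christoffel terms add up to the
    derivative of the metric coefficients along [F]. *)
Lemma inner_along F s s' x : mdiff F x -> sdiff F s x -> sdiff F s' x ->
  differentiable (fun y => inner (F y) (s y) (s' y) : R^o) x /\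
  forall v, dv v (fun y => inner (F y) (s y) (s' y) : R^o) x =
    inner (F x) (covd F x v s) (s' x) + inner (F x) (s x) (covd F x v s').
Proof.
move=> mF ds ds'; set r := F x.
have E : \near x, inner_of (gmx r (chart r (F x))) (shat r F s x) (shat r F s' x)
    = inner (F x) (s x) (s' x) :> R^o.
  by apply: filterS (near_dom_self mF.1) => y hy; rewrite (inner_chart _ _ hy).
have dr := mdiff_chart mF (dom_self r).
have dG i j : differentiable (fun y => gmx r (chart r (F y)) i j : R^o) x.
  exact: (differentiable_comp dr (gmx_differentiable i j (dom_self r))).
have [d1 D1] := diff_inner_of dG ds ds'.
split=> [|v]; first exact: (differentiable_near E).
rewrite -(dv_near v E) D1 !shat_self /covd !sealE -/r.
rewrite /inner !inner_ofDl !inner_ofDr -gmx_self.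
rewrite [inner_of _ (s x) (Gam _ _ _ _)]inner_of_sym ?gmx_sym // !GamP //.
rewrite /koszul.
have -> : \matrix_(i, j) dv v (fun y => gmx r (chart r (F y)) i j : R^o) x =
    dmx (gmx r) (chart r r) (vel F x v).
  apply/matrixP => i j; rewrite !mxE.
  by rewrite (dv_comp _ dr (gmx_differentiable i j (dom_self r))).
rewrite [inner_of _ (s' x) (s x)]inner_of_sym; last first.
  by apply: dmx_sym => y; exact: gmx_sym.
by field.
Qed.

End Along.

Lemma covd_comp (V W : normedModType R) (F : W -> N) (psi : V -> W) s x v :
  differentiable psi x -> mdiff F (psi x) -> sdiff F s (psi x) ->
  sdiff (fun y => F (psi y)) (fun y => s (psi y)) x /\
  covd (fun y => F (psi y)) x v (fun y => s (psi y)) = covd F (psi x) (dv v psi x) s.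
Proof.
move=> dpsi mF ds; split; first exact: (differentiable_comp dpsi ds).
rewrite /covd !sealE; have [_ ->] := mdiff_comp dpsi mF; congr (_ + _).
exact: (dv_comp _ dpsi ds).
Qed.

End CovariantDerivative.

Section NablaAlong.
Variables (R : realType) (M : manifold R) (N : riemannian R) (f : M -> N).

Definition nab p v s : 'rV[R]_(dim N) :=
  covd (fun z => f (chartV p z)) (chart p p) v (fun z => s (chartV p z)).

Lemma nablaE p v s : nabla f p v s = nab p v s.
Proof.
rewrite /nab /nabla christoffelE tmapE -dvE /covd !sealE chartKd //.
have -> // : (fun z => tcoord (f p) (f (chartV p z)) (s (chartV p z))) =
  shat (f p) (fun z => f (chartV p z)) (fun z => s (chartV p z)).
by apply/funext => z; rewrite /shat tcoordE.
Qed.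

Definition secdiff s p := sdiff (fun z => f (chartV p z)) (fun z => s (chartV p z)) (chart p p).

Lemma covd_nabla (V : normedModType R) (c : V -> M) s x v :
  mdiff c x -> gdiff f (c x) -> secdiff s (c x) ->
  sdiff (fun y => f (c y)) (fun y => s (c y)) x /\
  covd (fun y => f (c y)) x v (fun y => s (c y)) = nab (c x) (vel c x v) s.
Proof.
move=> mc df ds; set p := c x.
have nE : \forall y \near x, chartV p (chart p (c y)) = c y.
  by apply: filterS (near_dom mc.1 (dom_self p)) => y hy; rewrite chartKd.
have [d1 D1] := covd_comp v mc.2 df.2 ds.
have Ef : \forall y \near x, f (chartV p (chart p (c y))) = f (c y).
  by apply: filterS nE => y ->.
have Es : \forall y \near x, s (chartV p (chart p (c y))) = s (c y).
  by apply: filterS nE => y ->.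
split.
  by apply: (sdiff_near Es); apply: (sdiff_near_map Ef).
by rewrite -(covd_near_map _ _ Ef) -(covd_near _ _ Es) D1.
Qed.

End NablaAlong.

Lemma sdiff_coord (R : realType) (M : riemannian R) (p q : M) y : dom p q ->
  sdiff (chartV p) (fun z => jac p (chartV p z) (chartV p z) y) (chart p q).
Proof.
move=> pq; apply: (@sdiffI _ _ _ _ _ _ p (mdiff_chartV pq)); rewrite ?chartKd //.
apply: (@differentiable_near _ _ _ (fun=> y)); last exact: differentiable_cst.
apply: filterS (near_chartV pq openT Logic.I) => z [_ pz zE _].
by rewrite /shat jac_comp // jac_id.
Qed.

Lemma covd_coord (R : realType) (M : riemannian R) (p q : M) a y : dom p q ->
  jac q p q (covd (chartV p) (chart p q) a (fun z => jac p (chartV p z) (chartV p z) y))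
  = Gam p (chart p q) a y.
Proof.
move=> pq; have pV : dom p (chartV p (chart p q)) by rewrite chartKd.
have := covd_chart a (mdiff_chartV pq) (sdiff_coord y pq) pV.
rewrite chartKd // => ->; rewrite /shat chartKd // jac_comp // jac_id //.
rewrite (@dv_near _ _ _ a (fun y => chart p (chartV p y)) (fun z => z)); last first.
  by apply: filterS (near_chartV pq openT Logic.I) => z [].
rewrite dv_id (@dv_near _ _ _ a _ (fun=> y)) ?dv_cst ?add0r //.
apply: filterS (near_chartV pq openT Logic.I) => z [_ pz zE _].
by rewrite jac_comp // jac_id.
Qed.

(** * The second fundamental form *)

Section Immersion.
Variables (R : realType) (M N : riemannian R) (f : M -> N).
Hypothesis f_imm : isometric_immersion f.
Implicit Types (p q : M) (r : N).

Let sf : smooth f. Proof. by case: f_imm. Qed.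

Lemma imm_gdiff q : gdiff f q. Proof. exact: smooth_gdiff. Qed.
#[local] Hint Resolve imm_gdiff : core.

Lemma tm_isometric q x y : inner (f q) (tm f q x) (tm f q y) = inner q x y.
Proof. by rewrite -!tmapE; case: f_imm. Qed.

Definition fhat p r z := chart r (f (chartV p z)).
Definition fdom p r := chart p @` (dom p `&` f @^-1` dom r).

Lemma fdom_open p r : open (fdom p r).
Proof.
apply: chart_im_open; last by move=> ? [].
apply: openI; first exact: dom_open.
by apply: open_comp; [move=> ? _; exact: sf.1|exact: dom_open].
Qed.

Lemma fhat_smooth p r : Cinfty (fdom p r) (fhat p r).
Proof. exact: sf.2. Qed.

Lemma fdomP p r q : dom p q -> dom r (f q) -> fdom p r (chart p q).
Proof. by move=> pq rq; exists q. Qed.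

Lemma fhat_differentiable p r q : dom p q -> dom r (f q) ->
  differentiable (fhat p r) (chart p q).
Proof. by move=> pq rq; apply: Cinfty_differentiable (@fhat_smooth p r) (fdomP pq rq). Qed.

Lemma tm_hat p r q v : dom p q -> dom r (f q) ->
  jac (f q) r (f q) (tm f q v) = dv (jac q p q v) (fhat p r) (chart p q).
Proof. by move=> pq rq; exact: tm_chart. Qed.

Lemma fhat_pullback p r z a b : fdom p r z ->
  inner_of (gmx p z) a b =
  inner_of (gmx r (fhat p r z)) (dv a (fhat p r) z) (dv b (fhat p r) z).
Proof.
move=> [q [pq rq] <-]; rewrite gmxE // -tm_isometric (inner_chart _ _ rq).
by rewrite !(tm_hat _ pq rq) !jac_comp // !jac_id // /fhat chartKd.
Qed.

(* the second fundamental form read in the charts at [p] and [r] *)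
Definition hhat p r z a b := dv a (dv b (fhat p r)) z
  + Gam r (fhat p r z) (dv a (fhat p r) z) (dv b (fhat p r) z)
  - dv (Gam p z a b) (fhat p r) z.

Lemma hhat_normal p r q a b c : dom p q -> dom r (f q) ->
  inner_of (gmx r (chart r (f q))) (hhat p r (chart p q) a b)
    (dv c (fhat p r) (chart p q)) = 0.
Proof.
move=> pq rq.
have fE : fhat p r (chart p q) = chart r (f q) by rewrite /fhat chartKd.
have := @koszul_pullback R _ _ (gmx p) (gmx r) _ (fhat p r)
  (chart p q) (@fdom_open p r) (fdomP pq rq) (@fhat_smooth p r) (gmx_sym r)
  (fun i j => gmx_differentiable i j pq).
rewrite /hhat fE => /(_ (fun i j => gmx_differentiable i j rq)
  (fun z a b hz => fhat_pullback a b hz)); apply.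
- by move=> d; exact: GamP.
- by move=> d; exact: GamP.
Qed.

Definition hh p x y : 'rV[R]_(dim N) := seal (@h R M N f) p x y.

Section GaussFormula.
Variables (V : normedModType R) (psi : V -> M) (Y : V -> 'rV[R]_(dim M)) (x : V).
Hypotheses (mpsi : mdiff psi x) (dY : sdiff psi Y x).
Let p := psi x.

Lemma mdiff_imm : mdiff (fun y => f (psi y)) x.
Proof. by case: (vel_map mpsi (imm_gdiff (psi x))). Qed.

Lemma vel_imm v : vel (fun y => f (psi y)) x v = tm f p (vel psi x v).
Proof. by case: (vel_map mpsi (imm_gdiff (psi x))). Qed.

Let hatE : \near x, dv (shat p psi Y x) (fhat p (f p)) (chart p (psi x)) =
  shat (f p) (fun y => f (psi y)) (fun y => tm f (psi y) (Y y)) x.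
Proof.
have n1 := near_dom mpsi.1 (dom_self p).
have n2 := near_dom mdiff_imm.1 (dom_self (f p)).
by apply: filterS2 n1 n2 => y py ry; rewrite {2}/shat (tm_hat _ py ry).
Qed.

Let Ux : fdom p (f p) (chart p (psi x)).
Proof. exact: fdomP. Qed.

Lemma sdiff_tm : sdiff (fun y => f (psi y)) (fun y => tm f (psi y) (Y y)) x.
Proof.
apply: (differentiable_near hatE).
by have [] := dv_dir (@fdom_open p (f p)) (@fhat_smooth p (f p)) mpsi.2 dY Ux.
Qed.

(** In charts the pushed-forward field is [fhat] differentiated in the direction of the components
    of [Y]. Its derivative by [dv_dir] has a part with the derivative of these components, which
    with the Christoffel term of M is tangential; the remainder is [hhat]. *)
Lemma gauss_hhat v :
  covd (fun y => f (psi y)) x v (fun y => tm f (psi y) (Y y)) =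
  tm f p (covd psi x v Y) + hhat p (f p) (chart p p) (vel psi x v) (Y x).
Proof.
rewrite /covd !sealE -(dv_near v hatE).
have [_ ->] := dv_dir (@fdom_open p (f p)) (@fhat_smooth p (f p)) mpsi.2 dY Ux.
have tmE u : tm f p u = dv u (fhat p (f p)) (chart p p).
  by have := @tm_hat p (f p) p u (dom_self _) (dom_self _); rewrite !jac_id.
rewrite vel_imm shat_self /hhat /fhat chartKd // -/(fhat p (f p)).
rewrite -/(vel psi x v) -/p !tmE dvD; last exact: fhat_differentiable.
set A := dv _ (dv _ _) _; set B := dv _ (fhat _ _) _; set C := Gam _ _ _ _.
move: A B C => A B C; move: (dv _ (fhat _ _) _) => D.
by apply/rowP => i; rewrite !mxE; ring.
Qed.

End GaussFormula.

Lemma hh_hhat p x y : hh p x y = hhat p (f p) (chart p p) x y.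
Proof.
rewrite /hh sealE /h !nablaE /nab tmapE.
have mV := mdiff_chartV (dom_self p).
have := @gauss_hhat _ (chartV p) _ (chart p p) mV (sdiff_coord y (dom_self p)) x.
rewrite vel_chartV // chartKd // !jac_id //.
have -> : (fun z => tmap f (chartV p z) (coord_field p y (chartV p z))) =
   (fun z => tm f (chartV p z) (jac p (chartV p z) (chartV p z) y)).
  by apply/funext => z; rewrite tmapE coord_fieldE.
have -> : (fun z => coord_field p y (chartV p z)) =
   (fun z => jac p (chartV p z) (chartV p z) y).
  by apply/funext => z; rewrite coord_fieldE.
by move=> ->; rewrite [X in X - _]addrC addrK.
Qed.

Lemma gauss (V : normedModType R) (psi : V -> M) (Y : V -> 'rV[R]_(dim M)) x v :
  mdiff psi x -> sdiff psi Y x ->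
  covd (fun y => f (psi y)) x v (fun y => tm f (psi y) (Y y)) =
  tm f (psi x) (covd psi x v Y) + hh (psi x) (vel psi x v) (Y x).
Proof. by move=> mpsi dY; rewrite gauss_hhat // hh_hhat. Qed.

(** [hhat] in any pair of charts represents the tensor [hh]: the Gauss formula for a coordinate
    field is compared with its covariant derivative read in the chart at [r]. Smoothness of h as a
    section rests on this, since [hh] itself is defined through a chart that varies with the
    point. *)
Lemma hh_chart p r q a b : dom p q -> dom r (f q) ->
  jac (f q) r (f q) (hh q (jac p q q a) (jac p q q b)) = hhat p r (chart p q) a b.
Proof.
move=> pq rq.
have mV := mdiff_chartV pq.
have rV : dom r (f (chartV p (chart p q))) by rewrite chartKd.
have := gauss a mV (sdiff_coord b pq); rewrite vel_chartV // chartKd //.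
have := covd_chart a (mdiff_imm mV) (sdiff_tm mV (sdiff_coord b pq)) rV.
rewrite chartKd // => E1 E2; move: E1; rewrite E2 jacD // => E1.
have {}E1 := canRL (addKr _) E1; rewrite E1 /hhat addrC; congr (_ - _).
  have E z : fdom p r z -> shat r (fun y => f (chartV p y))
      (fun y => tm f (chartV p y) (jac p (chartV p y) (chartV p y) b)) z
      = dv b (fhat p r) z.
    move=> [q' [pq' rq'] <-]; rewrite /shat chartKd // (tm_hat _ pq' rq').
    by rewrite jac_comp // jac_id.
  congr (_ + Gam _ _ _ _).
  - apply: dv_near; exact: (open_eq_near (@fdom_open p r) (fdomP pq rq) E).
  - by rewrite /fhat chartKd.
  - exact: E (fdomP pq rq).
by rewrite (tm_hat _ pq rq) covd_coord.
Qed.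

Lemma hh_normal p x y c : inner (f p) (tm f p c) (hh p x y) = 0.
Proof.
have := @hhat_normal p (f p) p x y c (dom_self _) (dom_self _).
rewrite gmx_self -hh_hhat metricC.
by have := @tm_hat p (f p) p c (dom_self _) (dom_self _); rewrite !jac_id // => ->.
Qed.

Lemma hhC p x y : hh p x y = hh p y x.
Proof.
rewrite !hh_hhat /hhat GamC [Gam p _ _ _]GamC.
by rewrite (dv_comm _ _ (@fdom_open p (f p)) (fdomP (dom_self p) (dom_self (f p))) (@fhat_smooth p (f p))).
Qed.

Lemma hhP p a x x' y : hh p (a *: x + x') y = a *: hh p x y + hh p x' y.
Proof.
have df := fhat_differentiable (dom_self p) (dom_self (f p)).
have dDf : differentiable (dv y (fhat p (f p))) (chart p p).
  exact: Cinfty_differentiable (Cinfty_dv y (@fhat_smooth p (f p))) (fdomP _ _).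
rewrite !hh_hhat /hhat (dvP _ _ _ dDf) (dvP _ _ _ df) GamPl // (dvP _ _ _ df).
have -> : fhat p (f p) (chart p p) = chart (f p) (f p) by rewrite /fhat chartKd.
rewrite GamPl //; move: (dv x _ _) (dv x' _ _) (dv (Gam _ _ x y) _ _) (dv (Gam _ _ x' y) _ _)
  (Gam _ _ (dv x _ _) _) (Gam _ _ (dv x' _ _) _) => A B C D E F.
by apply/rowP => i; rewrite !mxE; ring.
Qed.

End Immersion.

(** * Smooth sections and fields in charts, tangential and normal parts *)

Section SmoothSections.
Variables (R : realType) (M N : manifold R) (F : M -> N).
Hypothesis cF : continuous F.
Implicit Types (p : M) (r : N) (U : set M) (s : M -> 'rV[R]_(dim N)).

Definition sdom U p r := chart p @` (U `&` dom p `&` F @^-1` dom r).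

Lemma sdom_open U p r : open U -> open (sdom U p r).
Proof.
move=> oU; apply: chart_im_open; last by move=> ? [[]].
apply: openI; first by apply: openI => //; exact: dom_open.
by apply: open_comp; [move=> ? _; exact: cF|exact: dom_open].
Qed.

Definition sechat p r s (z : 'rV[R]_(dim M)) : 'rV[R]_(dim N) :=
  jac (F (chartV p z)) r (F (chartV p z)) (s (chartV p z)).

Lemma smooth_secP U s :
  smooth_sec F U s <-> forall p r, Cinfty (sdom U p r) (sechat p r s).
Proof.
have E p r : (fun z => tcoord r (F (chartV p z)) (s (chartV p z))) = sechat p r s.
  by apply/funext => z; rewrite tcoordE.
by split=> H p r; have := H p r; rewrite E.
Qed.

Lemma smooth_sec_near U s : open U ->
  (forall q, U q -> exists U', [/\ open U', U' q & smooth_sec F U' s]) ->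
  smooth_sec F U s.
Proof.
move=> oU H; apply/smooth_secP => p r; apply: Cinfty_local => _ [q [[Uq pq] rq] <-].
have [U' [oU' U'q /smooth_secP sU']] := H q Uq.
by exists (sdom U' p r) => //; exists q.
Qed.

Lemma smooth_sec_sub U U' s : U' `<=` U -> smooth_sec F U s -> smooth_sec F U' s.
Proof.
move=> UU /smooth_secP H; apply/smooth_secP => p r; apply: Cinfty_sub (H p r).
by move=> _ [q [[Uq pq] rq] <-]; exists q => //; split=> //; split=> //; exact: UU.
Qed.

Lemma smooth_sec_eq U s s' : open U -> (forall q, U q -> s q = s' q) ->
  smooth_sec F U s -> smooth_sec F U s'.
Proof.
move=> oU E /smooth_secP H; apply/smooth_secP => p r.
apply: (Cinfty_eq (@sdom_open U p r oU) _ (H p r)) => _ [q [[Uq pq] rq] <-].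
by rewrite /sechat chartKd // E.
Qed.

Lemma smooth_secD U s s' : open U -> smooth_sec F U s -> smooth_sec F U s' ->
  smooth_sec F U (fun q => s q + s' q).
Proof.
move=> oU /smooth_secP H /smooth_secP H'; apply/smooth_secP => p r.
have oD := @sdom_open U p r oU.
apply: (Cinfty_eq oD _ (Cinfty_add oD (H p r) (H' p r))) => _ [q [[Uq pq] rq] <-].
by rewrite /sechat chartKd // jacD.
Qed.

Lemma smooth_sec_scale U (k : M -> R) s : open U -> smooth_fun U k ->
  smooth_sec F U s -> smooth_sec F U (fun q => k q *: s q).
Proof.
move=> oU hk /smooth_secP H; apply/smooth_secP => p r.
have oD := @sdom_open U p r oU.
have kp : Cinfty (sdom U p r) (fun z => k (chartV p z) : R^o).
  apply: Cinfty_sub (hk p) => _ [q [[Uq pq] rq] <-]; by exists q.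
apply: (Cinfty_eq oD _ (Cinfty_scale_row oD kp (H p r))) => _ [q [[Uq pq] rq] <-].
by rewrite /sechat chartKd // jacZ.
Qed.

End SmoothSections.

Section SmoothFields.
Variables (R : realType) (M : manifold R).
Implicit Types (p q : M) (U : set M) (X : M -> 'rV[R]_(dim M)).

Lemma continuous_idfun : continuous (idfun : M -> M).
Proof. by move=> x; exact: cvg_id. Qed.

Definition vhat p X (z : 'rV[R]_(dim M)) : 'rV[R]_(dim M) :=
  jac (chartV p z) p (chartV p z) (X (chartV p z)).

Definition vdom U p := chart p @` (U `&` dom p).

Lemma vdom_open U p : open U -> open (vdom U p).
Proof.
move=> oU; apply: chart_im_open; last by move=> ? [].
by apply: openI => //; exact: dom_open.
Qed.

Lemma field_hat U X p : smooth_sec (idfun : M -> M) U X -> Cinfty (vdom U p) (vhat p X).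
Proof.
move=> /smooth_secP/(_ p p); apply: Cinfty_sub => _ [q [Uq pq] <-].
by exists q.
Qed.

Lemma vhat_chart p X q : dom p q -> vhat p X (chart p q) = jac q p q (X q).
Proof. by move=> pq; rewrite /vhat chartKd. Qed.

Lemma coord_smooth p y : smooth_sec (idfun : M -> M) (dom p) (fun q => jac p q q y).
Proof.
apply/smooth_secP => p' r.
have oD := @sdom_open _ _ _ idfun continuous_idfun _ p' r (@dom_open _ M p).
have oO := @overlap_open R M p r.
have H : Cinfty (chart p @` (dom p `&` dom r)) (dv y (fun z => chart r (chartV p z))).
  exact: Cinfty_dv (transition_smooth p r).
have T : Cinfty (sdom idfun (dom p) p' r) (fun z => chart p (chartV p' z)).
  apply: Cinfty_sub (transition_smooth p' p) => _ [q [[pq p'q] rq] <-].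
  by exists q.
apply: (Cinfty_eq oD _ (Cinfty_comp_row oD oO _ T H)).
  move=> _ [q [[pq p'q] rq] <-]; rewrite /sechat chartKd //.
  by rewrite -/(jac _ _ _ _) jac_comp.
by move=> _ [q [[pq p'q] rq] <-]; rewrite /= chartKd //; exists q.
Qed.

End SmoothFields.

Section GammaSmooth.
Variables (R : realType) (M : riemannian R).

Lemma Gam_smooth (p : M) a b : Cinfty (cim p) (fun z => Gam p z a b).
Proof.
have oc := @chart_image_open _ _ p.
have cg := @gmx_smooth R M p.
have cdmx u v w : Cinfty (cim p) (fun z => inner_of (dmx (gmx p) z u) v w : R^o).
  under eq_fun do rewrite inner_ofE.
  apply: Cinfty_sum => // i _; apply: Cinfty_sum => // j _.
  apply: Cinfty_mul => //; last exact: Cinfty_cst.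
  apply: Cinfty_mul => //; first exact: Cinfty_cst.
  under eq_fun do rewrite mxE; apply: Cinfty_dv; exact: cg.
apply: (proj2 (Cinfty_mx_row _ oc)).
apply: Cinfty_mulmx => //; last first.
  by apply: Cinfty_invmx => // _ [q pq <-]; exact: gmx_unit.
move=> i j; under eq_fun do rewrite mxE /koszul.
apply: Cinfty_mul => //; first exact: Cinfty_cst.
apply: Cinfty_subr => //; exact: Cinfty_add.
Qed.

Lemma GamPsum (p q : M) a b : dom p q ->
  Gam p (chart p q) a b =
  \sum_i \sum_j (a 0 i * b 0 j) *: Gam p (chart p q) (delta_mx 0 i) (delta_mx 0 j).
Proof.
move=> pq; rewrite {1}(row_sum_delta a).
have G0 c : Gam p (chart p q) 0 c = 0.
  by have := GamPl (-1) 0 0 c pq; rewrite scaler0 addr0 scaleN1r addNr.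
rewrite (big_morph (fun a => Gam p (chart p q) a b) (id1 := 0) (op1 := +%R)) //; last first.
  by move=> x y; rewrite -[x in LHS]scale1r GamPl // scale1r.
apply: eq_bigr => i _; rewrite -[_ *: delta_mx _ _ in LHS]addr0 GamPl // G0 addr0.
rewrite {1}(row_sum_delta b) GamC.
rewrite (big_morph (fun b => Gam p (chart p q) b (delta_mx 0 i)) (id1 := 0) (op1 := +%R)) //; last first.
  by move=> x y; rewrite -[x in LHS]scale1r GamPl // scale1r.
rewrite scaler_sumr; apply: eq_bigr => j _.
by rewrite -[_ *: delta_mx _ _ in LHS]addr0 GamPl // G0 addr0 scalerA GamC.
Qed.

Lemma Gam_comp_smooth (V : normedModType R) (U : set V) (p : M)
    (phi a b : V -> 'rV[R]_(dim M)) : open U -> U `<=` phi @^-1` (cim p) ->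
  Cinfty U phi -> Cinfty U a -> Cinfty U b ->
  Cinfty U (fun y => Gam p (phi y) (a y) (b y)).
Proof.
move=> oU Uc cphi ca cb.
have H i j : Cinfty U (fun y => (a y 0 i * b y 0 j) *: Gam p (phi y) (delta_mx 0 i) (delta_mx 0 j)).
  apply: Cinfty_scale_row => //.
    by apply: Cinfty_mul => //; exact: Cinfty_entry.
  exact: (Cinfty_comp_row oU (@chart_image_open _ _ p) Uc cphi (@Gam_smooth p _ _)).
have S : Cinfty U (fun y => \sum_i \sum_j (a y 0 i * b y 0 j) *: Gam p (phi y) (delta_mx 0 i) (delta_mx 0 j)).
  by apply: Cinfty_sum => // i _; apply: Cinfty_sum => // j _; exact: H.
by apply: (Cinfty_eq oU _ S) => y /Uc [q pq E]; rewrite -E -GamPsum.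
Qed.

End GammaSmooth.

Section NormalPart.
Variables (R : realType) (M N : riemannian R) (f : M -> N).
Hypothesis f_imm : isometric_immersion f.
Implicit Types (p q : M) (r : N).

Let sf : smooth f. Proof. by case: f_imm. Qed.
Let cf : continuous f. Proof. by case: sf. Qed.
Let gf q : gdiff f q. Proof. exact: imm_gdiff. Qed.
#[local] Hint Resolve gf : core.

Lemma tmD p v w : tm f p (v + w) = tm f p v + tm f p w.
Proof. by rewrite -[v in LHS]scale1r (tmP _ _ _ (imm_gdiff f_imm p)) scale1r. Qed.

Lemma tm0 p : tm f p 0 = 0.
Proof. by rewrite /tm /vel dv0. Qed.

Lemma tmZ p a v : tm f p (a *: v) = a *: tm f p v.
Proof. by rewrite -[_ *: _ in LHS]addr0 (tmP _ _ _ (imm_gdiff f_imm p)) tm0 addr0. Qed.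

Lemma tmN p v : tm f p (- v) = - tm f p v.
Proof. by rewrite -scaleN1r tmZ scaleN1r. Qed.

Lemma tm_sum p I l (P : pred I) (v : I -> 'rV_(dim M)) :
  tm f p (\sum_(i <- l | P i) v i) = \sum_(i <- l | P i) tm f p (v i).
Proof. by apply: (big_morph (tm f p)); [move=> ? ?; exact: tmD|exact: tm0]. Qed.

(* [tang] and [npart] are the tangential and the normal component. *)
Definition tang p (w : 'rV[R]_(dim N)) : 'rV[R]_(dim M) :=
  (\row_l inner (f p) (tm f p (delta_mx 0 l)) w) *m invmx (metric p).

Lemma tangP p w y : inner p (tang p w) y = inner (f p) (tm f p y) w.
Proof.
rewrite /inner inner_of_raise ?metric_unit // mxE [in RHS](row_sum_delta y).
rewrite tm_sum inner_of_suml; apply: eq_bigr => l _.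
by rewrite !mxE tmZ inner_ofZl mulrC.
Qed.

Lemma inner_inj p x y : (forall z, inner p x z = inner p y z) -> x = y :> 'rV[R]_(dim M).
Proof. by move=> H; apply: (inner_of_inj (metric_unit p)) => z; exact: H. Qed.

Lemma tang_tm p x : tang p (tm f p x) = x.
Proof. by apply: (@inner_inj p) => z; rewrite tangP tm_isometric // metricC. Qed.

Lemma normalP p u : normal f p u <-> forall x, inner (f p) (tm f p x) u = 0.
Proof. by split=> H x; have := H x; rewrite tmapE. Qed.

Lemma tang_normal p u : normal f p u -> tang p u = 0.
Proof.
move=> /normalP nu; apply: (@inner_inj p) => z.
by rewrite tangP nu /inner inner_of0l.
Qed.

Lemma tangPl p a v w : tang p (a *: v + w) = a *: tang p v + tang p w.
Proof.
apply: (@inner_inj p) => z.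
by rewrite /inner inner_ofDl inner_ofZl -!/(inner _ _ _) !tangP /inner inner_ofDr inner_ofZr.
Qed.

Definition npart p w := w - tm f p (tang p w).

Lemma npart_normal p w : normal f p (npart p w).
Proof.
apply/normalP => x; rewrite /npart /inner inner_ofDr inner_ofNr -!/(inner _ _ _).
by rewrite tm_isometric // -tangP [inner p x _]metricC subrr.
Qed.

Lemma npart_id p u : normal f p u -> npart p u = u.
Proof. by move=> nu; rewrite /npart tang_normal // tm0 subr0. Qed.

Lemma npart_tm p x : npart p (tm f p x) = 0.
Proof. by rewrite /npart tang_tm subrr. Qed.

Lemma npartP p a v w : npart p (a *: v + w) = a *: npart p v + npart p w.
Proof.
by rewrite /npart tangPl tmD tmZ scalerBr opprD addrACA.
Qed.

Lemma npartD p v w : npart p (v + w) = npart p v + npart p w.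
Proof. by rewrite -[v in LHS]scale1r npartP scale1r. Qed.

Lemma npart0 p : npart p 0 = 0.
Proof. by rewrite npart_id //; apply/normalP => x; rewrite /inner inner_of0r. Qed.

Lemma npartZ p a v : npart p (a *: v) = a *: npart p v.
Proof. by rewrite -[_ *: _ in LHS]addr0 npartP npart0 addr0. Qed.

Lemma npart_sum p I l (P : pred I) (v : I -> 'rV_(dim N)) :
  npart p (\sum_(i <- l | P i) v i) = \sum_(i <- l | P i) npart p (v i).
Proof. by apply: (big_morph (npart p)); [move=> ? ?; exact: npartD|exact: npart0]. Qed.

Lemma normal_partE p w : normal_part f p w = npart p w.
Proof.
rewrite /normal_part; case: xgetP => [u _ [nu [x wE]]|H].
  by rewrite wE tmapE npartD npart_tm add0r npart_id.
exfalso; apply: (H (npart p w)); split; first exact: npart_normal.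
by exists (tang p w); rewrite tmapE /npart addrC subrK.
Qed.

Lemma normal_hh p x y : normal f p (hh f p x y).
Proof. by apply/normalP => c; exact: hh_normal. Qed.

Lemma normalPlin p a u v : normal f p u -> normal f p v -> normal f p (a *: u + v).
Proof.
move=> /normalP nu /normalP nv; apply/normalP => x.
by rewrite /inner inner_ofDr inner_ofZr -!/(inner _ _ _) nu nv mulr0 addr0.
Qed.

Lemma tm_smooth U X : open U -> smooth_sec (idfun : M -> M) U X ->
  smooth_sec f U (fun q => tm f q (X q)).
Proof.
move=> oU /field_hat sX; apply/smooth_secP => p r.
have oD := @sdom_open _ _ _ f cf U p r oU.
have sXp : Cinfty (sdom f U p r) (vhat p X).
  by apply: Cinfty_sub (sX p) => _ [q [[Uq pq] rq] <-]; exists q.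
have Dsub : sdom f U p r `<=` (fun z => z) @^-1` fdom f p r.
  by move=> _ [q [[Uq pq] rq] <-]; exists q.
apply: (Cinfty_eq oD _ (Cinfty_dv_comp oD (@fdom_open _ _ _ f f_imm p r) Dsub (Cinfty_id oD)
  (@fhat_smooth _ _ _ f f_imm p r) sXp)) => _ [q [[Uq pq] rq] <-].
by rewrite /sechat !chartKd // (tm_hat f_imm _ pq rq) vhat_chart.
Qed.

Lemma dv_dv_smooth n m (U : set 'rV[R]_n) (F : 'rV[R]_n -> 'rV[R]_m)
    (a b : 'rV[R]_n -> 'rV[R]_n) : open U -> Cinfty U F -> Cinfty U a ->
  Cinfty U b -> Cinfty U (fun z => dv (a z) (dv (b z) F) z).
Proof.
move=> oU cF ca cb.
have H j : Cinfty U (fun z => b z 0 j *: dv (a z) (dv (delta_mx 0 j) F) z).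
  apply: Cinfty_scale_row => //; first exact: Cinfty_entry.
  by apply: (Cinfty_dv_comp oU oU _ (Cinfty_id oU) (Cinfty_dv _ cF) ca).
have S := @Cinfty_sum _ _ 'rV[R]_m U _ (index_enum _) xpredT _ oU (fun j _ => H j).
apply: (Cinfty_eq oU _ S) => z Uz.
have E : \forall y \near z, \sum_j b z 0 j *: dv (delta_mx 0 j) F y = dv (b z) F y.
  apply: (open_eq_near oU Uz) => y Uy; rewrite -dv_row //.
  exact: Cinfty_differentiable cF Uy.
have dF j : differentiable (dv (delta_mx 0 j) F) z.
  exact: Cinfty_differentiable (Cinfty_dv _ cF) Uz.
rewrite -(dv_near _ E) dv_sumf => [|j _]; last first.
  by apply: differentiable_scale_row => //; exact: differentiable_cst.
by apply: eq_bigr => j _; rewrite dv_scale_row // dv_cst scale0r add0r.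
Qed.

Lemma hh_smooth U X Y : open U -> smooth_sec (idfun : M -> M) U X ->
  smooth_sec (idfun : M -> M) U Y -> smooth_sec f U (fun q => hh f q (X q) (Y q)).
Proof.
move=> oU /field_hat sX /field_hat sY; apply/smooth_secP => p r.
have oD := @sdom_open _ _ _ f cf U p r oU.
have sub1 Z : Cinfty (vdom U p) (vhat p Z) -> Cinfty (sdom f U p r) (vhat p Z).
  by apply: Cinfty_sub => _ [q [[Uq pq] rq] <-]; exists q.
have {}sX := sub1 _ (sX p); have {}sY := sub1 _ (sY p).
have Dsub : sdom f U p r `<=` (fun z => z) @^-1` fdom f p r.
  by move=> _ [q [[Uq pq] rq] <-]; exists q.
have oF := @fdom_open _ _ _ f f_imm p r.
have sF := @fhat_smooth _ _ _ f f_imm p r.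
have sFD : Cinfty (sdom f U p r) (fhat f p r) by apply: Cinfty_sub sF.
have cdv Z : Cinfty (sdom f U p r) Z -> Cinfty (sdom f U p r) (fun z => dv (Z z) (fhat f p r) z).
  exact: (Cinfty_dv_comp oD oF Dsub (Cinfty_id oD) sF).
have cG : Cinfty (sdom f U p r) (fun z => Gam p z (vhat p X z) (vhat p Y z)).
  apply: (Gam_comp_smooth oD _ (Cinfty_id oD) sX sY).
  by move=> _ [q [[Uq pq] rq] <-]; exists q.
have cGN : Cinfty (sdom f U p r) (fun z => Gam r (fhat f p r z)
    (dv (vhat p X z) (fhat f p r) z) (dv (vhat p Y z) (fhat f p r) z)).
  apply: (Gam_comp_smooth oD _ sFD (cdv _ sX) (cdv _ sY)).
  by move=> _ [q [[Uq pq] rq] <-]; rewrite /= /fhat chartKd //; exists (f q).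
have S := Cinfty_subr oD (Cinfty_add oD (dv_dv_smooth oD sFD sX sY) cGN) (cdv _ cG).
apply: (Cinfty_eq oD _ S) => _ [q [[Uq pq] rq] <-].
rewrite -/(hhat f p r _ _ _) -(hh_chart f_imm) // !vhat_chart // !jac_comp // !jac_id //.
by rewrite /sechat chartKd.
Qed.

Lemma smooth_secdiff U s p : open U -> U p -> smooth_sec f U s -> secdiff f s p.
Proof.
move=> oU Up /smooth_secP/(_ p (f p)) H.
have : differentiable (sechat f p (f p) s) (chart p p).
  apply: (Cinfty_differentiable H); exists p => //.
  by split; [split => //; exact: dom_self|exact: dom_self].
by rewrite /secdiff /sdiff chartKd.
Qed.

Lemma sdiff_chartV U s p q : open U -> U q -> dom p q -> smooth_sec f U s ->
  sdiff (fun z => f (chartV p z)) (fun z => s (chartV p z)) (chart p q).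
Proof.
move=> oU Uq pq /smooth_secP/(_ p (f q)) H.
have : differentiable (sechat f p (f q) s) (chart p q).
  apply: (Cinfty_differentiable H); exists q => //.
  by split; [split|exact: dom_self].
by rewrite /sdiff chartKd.
Qed.

Lemma nab_hat p r q v U s : open U -> U q -> smooth_sec f U s -> dom p q ->
  dom r (f q) ->
  jac (f q) r (f q) (nab f q v s) =
  dv (jac q p q v) (sechat f p r s) (chart p q)
  + Gam r (fhat f p r (chart p q)) (dv (jac q p q v) (fhat f p r) (chart p q))
      (sechat f p r s (chart p q)).
Proof.
move=> oU Uq ss pq rq.
have mV := mdiff_chartV pq.
have gq : gdiff f (chartV p (chart p q)) by [].
have sq : secdiff f s (chartV p (chart p q)).
  by rewrite chartKd //; exact: smooth_secdiff ss.
have [_ E] := covd_nabla (jac q p q v) mV gq sq.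
move: E; rewrite vel_chartV // chartKd // jacK // => <-.
have rV : dom r (f (chartV p (chart p q))) by rewrite chartKd.
have := covd_chart (jac q p q v) (mdiff_imm f_imm mV) (sdiff_chartV oU Uq pq ss) rV.
by rewrite /fhat chartKd.
Qed.

Lemma nab_smooth U X s : open U -> smooth_sec (idfun : M -> M) U X ->
  smooth_sec f U s -> smooth_sec f U (fun q => nab f q (X q) s).
Proof.
move=> oU /field_hat sX ss; apply/smooth_secP => p r.
have oD := @sdom_open _ _ _ f cf U p r oU.
have sXp : Cinfty (sdom f U p r) (vhat p X).
  by apply: Cinfty_sub (sX p) => _ [q [[Uq pq] rq] <-]; exists q.
have sS : Cinfty (sdom f U p r) (sechat f p r s) by move: ss => /smooth_secP; apply.
have sFD : Cinfty (sdom f U p r) (fhat f p r).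
  apply: Cinfty_sub (@fhat_smooth _ _ _ f f_imm p r).
  by move=> _ [q [[Uq pq] rq] <-]; exists q.
have cdv n (Z : _ -> 'rV[R]_n) : Cinfty (sdom f U p r) Z ->
    Cinfty (sdom f U p r) (fun z => dv (vhat p X z) Z z).
  by move=> cZ; apply: (Cinfty_dv_comp oD oD _ (Cinfty_id oD) cZ sXp).
have cG : Cinfty (sdom f U p r) (fun z => Gam r (fhat f p r z)
    (dv (vhat p X z) (fhat f p r) z) (sechat f p r s z)).
  apply: (Gam_comp_smooth oD _ sFD (cdv _ _ sFD) sS).
  by move=> _ [q [[Uq pq] rq] <-]; rewrite /= /fhat chartKd //; exists (f q).
apply: (Cinfty_eq oD _ (Cinfty_add oD (cdv _ _ sS) cG)) => _ [q [[Uq pq] rq] <-].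
by rewrite [in RHS]/sechat chartKd // (nab_hat _ oU Uq ss pq rq) vhat_chart.
Qed.

Lemma tang_hat p r q w : dom p q -> dom r (f q) ->
  jac q p q (tang q w) =
  (\row_l inner_of (gmx r (fhat f p r (chart p q)))
     (dv (delta_mx 0 l) (fhat f p r) (chart p q)) (jac (f q) r (f q) w))
  *m invmx (gmx p (chart p q)).
Proof.
move=> pq rq; apply: (inner_of_inj (gmx_unit pq)) => y.
rewrite inner_of_raise ?gmx_unit // mxE -{1}(jacK pq (dom_self q) y).
rewrite -inner_chart // tangP [in LHS](row_sum_delta y) jac_sum // tm_sum.
rewrite /inner inner_of_suml; apply: eq_bigr => l _.
rewrite jacZ // tmZ inner_ofZl !mxE mulrC -/(inner _ _ _).
rewrite (inner_chart _ _ rq) (tm_hat f_imm _ pq rq) jacK //.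
by rewrite /fhat chartKd.
Qed.

Lemma npart_smooth U s : open U -> smooth_sec f U s ->
  smooth_sec f U (fun q => npart q (s q)).
Proof.
move=> oU ss.
have st : smooth_sec (idfun : M -> M) U (fun q => tang q (s q)).
  apply/smooth_secP => p p'.
  have oD := @sdom_open _ _ _ idfun (@continuous_idfun _ M) U p p' oU.
  apply: Cinfty_local => _ [q0 [[Uq0 pq0] p'q0] <-].
  (* The coordinate formula for [tang] also involves a chart of N, so smoothness is checked near
     each [q0] separately, with the chart at [f q0]. *)
  pose r := f q0; pose D := chart p @` (U `&` dom p `&` dom p' `&` f @^-1` dom r).
  have oD' : open D.
    apply: chart_im_open; last by move=> ? [[[]]].
    apply: openI; first by apply: openI; [apply: openI => //|]; exact: dom_open.
    by apply: open_comp; [move=> ? _; exact: cf|exact: dom_open].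
  exists D; first by exists q0 => //; split; [split|exact: dom_self].
  have sS : Cinfty D (sechat f p r s).
    by move: ss => /smooth_secP/(_ p r); apply: Cinfty_sub => _ [q [[[? ?] ?] ?] <-]; exists q.
  have sFD : Cinfty D (fhat f p r).
    apply: Cinfty_sub (@fhat_smooth _ _ _ f f_imm p r).
    by move=> _ [q [[[? ?] ?] ?] <-]; exists q.
  have cH i j : Cinfty D (fun z => gmx r (fhat f p r z) i j : R^o).
    apply: (Cinfty_comp oD' (@chart_image_open _ _ r) _ sFD (@gmx_smooth _ N r i j)).
    by move=> _ [q [[[? ?] ?] ?] <-]; rewrite /= /fhat chartKd //; exists (f q).
  have cG : Cinfty_mx D (gmx p).
    move=> i j; apply: Cinfty_sub (@gmx_smooth _ M p i j).
    by move=> _ [q [[[? ?] ?] ?] <-]; exists q.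
  have cL : Cinfty_mx D (fun z => \row_l inner_of (gmx r (fhat f p r z))
     (dv (delta_mx 0 l) (fhat f p r) z) (sechat f p r s z)).
    move=> i l; under eq_fun do rewrite mxE inner_ofE.
    apply: Cinfty_sum => // a _; apply: Cinfty_sum => // b _.
    apply: Cinfty_mul => //; last exact: Cinfty_entry.
    by apply: Cinfty_mul => //; apply: Cinfty_entry => //; exact: Cinfty_dv.
  have uG y : D y -> gmx p y \in unitmx.
    by move=> [q [[[? ?] ?] ?] <-]; exact: gmx_unit.
  have cT := proj2 (Cinfty_mx_row _ oD') (Cinfty_mulmx oD' cL (Cinfty_invmx oD' uG cG)).
  have Dsub : D `<=` (fun z => z) @^-1` (chart p @` (dom p `&` dom p')).
    by move=> _ [q [[[? ?] ?] ?] <-]; exists q.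
  apply: (Cinfty_eq oD' _ (Cinfty_dv_comp oD' (@overlap_open _ _ p p') Dsub
    (Cinfty_id oD') (transition_smooth p p') cT)) => _ [q [[[Uq pq] p'q] rq] <-].
  rewrite /sechat !chartKd // -(tang_hat _ pq rq).
  exact: (jac_comp _ (dom_self q) pq p'q).
have cm1 : smooth_fun U (fun=> -1 : R) by move=> p; exact: Cinfty_cst.
have := smooth_secD cf oU ss (smooth_sec_scale cf oU cm1 (tm_smooth oU st)).
by apply: (smooth_sec_eq cf oU) => q Uq; rewrite /npart scaleN1r.
Qed.

End NormalPart.

Section BumpField.
Variables (R : realType) (M : manifold R).

Lemma rV_norm_le n (x : 'rV[R]_n) (r : R) : 0 <= r ->
  (forall i, `|x 0 i| <= r) -> `|x| <= r.
Proof.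
move=> r0 H; rewrite [leLHS]/Num.Def.normr /= mx_normrE (bigmax_le _ r0) //= => -[i j] _.
by rewrite ord1 /=.
Qed.

(* Multiplying coordinate fields by a cut-off function that is supported in a
   compact subset of the chart extends them smoothly by zero. *)
Lemma bump_field (p q : M) : dom p q -> exists chi : 'rV[R]_(dim M) -> R^o,
  [/\ Cinfty setT chi, chi (chart p q) != 0 &
    forall y, smooth_sec (idfun : M -> M) setT (fun q' =>
      if pselect (dom p q') then chi (chart p q') *: jac p q' q' y else 0)].
Proof.
move=> pq; set x0 := chart p q.
have /nbhs_ballP[rho /= rho0 hrho] : nbhs x0 (cim p).
  by apply: open_nbhs_nbhs; split; [exact: chart_image_open|exact: chart_in].
have r0 : 0 < rho / 2 by rewrite divr_gt0.
have [chi [cchi chi0 hchi]] := exists_bump x0 r0.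
exists chi; split=> // y.
pose B := [set v : 'rV[R]_(dim M) |
  forall i, `[x0 0 i - rho / 2, x0 0 i + rho / 2]%classic (v ord0 i)].
have Bc : B `<=` cim p.
  move=> v Bv; apply: hrho; rewrite -ball_normE /ball_ /= distrC.
  apply: (@le_lt_trans _ _ (rho / 2)); last by rewrite ltr_pdivrMr // ltr_pMr // ltr1n.
  apply: rV_norm_le; first exact: ltW.
  by move=> i; have := Bv i; rewrite !mxE /= in_itv /= -ler_distlC distrC.
(* The image of the compact box is closed because M is Hausdorff. Its complement is thus an open set
   which contains every point outside [dom p] and on which the field vanishes. *)
have cK : closed (chartV p @` B).
  apply: compact_closed; first exact: manifold_hausdorff.
  apply: continuous_compact.
    apply: continuous_in_subspaceT => v; rewrite inE => /Bc; exact: chartV_continuous.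
  apply: (@rV_compact R _ (fun i => `[x0 0 i - rho / 2, x0 0 i + rho / 2]%classic)).
  by move=> i; exact: segment_compact.
apply: smooth_sec_near; first exact: openT.
move=> q0 _; have [pq0|npq0] := pselect (dom p q0).
  exists (dom p); split=> //; first exact: dom_open.
  have cf : smooth_fun (dom p) (fun q' => chi (chart p q') : R).
    move=> p'; have oD : open (chart p' @` (dom p `&` dom p')).
      apply: chart_im_open; last by move=> ? [].
      by apply: openI; exact: dom_open.
    apply: (@Cinfty_comp R _ _ _ setT (fun z => chart p (chartV p' z)) chi oD openT) => //.
    apply: Cinfty_sub (transition_smooth p' p).
    by move=> _ [z [? ?] <-]; exists z.
  have := smooth_sec_scale (@continuous_idfun R M) (@dom_open R M p) cf (@coord_smooth R M p y).
  apply: (smooth_sec_eq (@continuous_idfun R M)); first exact: dom_open.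
  by move=> q' pq'; case: pselect.
exists (~` (chartV p @` B)); split.
- exact: closed_openC.
- by move=> [v /Bc /chart_imP[+ _]] E; rewrite E.
- have z0 : smooth_sec (idfun : M -> M) (~` (chartV p @` B)) (fun=> 0).
    apply/smooth_secP => p' r; rewrite /sechat.
    rewrite (_ : (fun z => _) = fun=> 0); first exact: Cinfty_cst.
    by apply/funext => z; rewrite jac0.
  apply: (smooth_sec_eq (@continuous_idfun R M) _ _ z0); first exact: closed_openC.
  move=> q' nK; case: pselect => // pq'; apply/esym/eqP.
  rewrite scaler_eq0; apply/orP; left; apply/negP => /negP c0; apply: nK.
  exists (chart p q'); last by rewrite chartKd.
  by move=> i /=; rewrite in_itv /= -ler_distlC distrC; exact: hchi.
Qed.

End BumpField.

(** * Parallelism of the second fundamental form, locally and along maps *)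

Section ParallelSff.
Variables (R : realType) (M N : riemannian R) (f : M -> N).
Hypothesis f_imm : isometric_immersion f.
Hypothesis f_par : parallel_immersion f.
Implicit Types (p q : M).

Let sf : smooth f. Proof. by case: f_imm. Qed.
Let gf q : gdiff f q. Proof. exact: imm_gdiff. Qed.
#[local] Hint Resolve gf : core.

Notation e_ i := (delta_mx 0 i : 'rV[R]_(dim M)).

Definition cfield p a q := jac p q q a.
Definition Hsec p a b q := hh f q (cfield p a q) (cfield p b q).

Lemma hh0l p y : hh f p 0 y = 0.
Proof. by have := hhP f_imm p (-1) 0 0 y; rewrite scaler0 addr0 scaleN1r addNr. Qed.

Lemma hhDl p x x' y : hh f p (x + x') y = hh f p x y + hh f p x' y.
Proof. by rewrite -[x in LHS]scale1r hhP // scale1r. Qed.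

Lemma hhZl p a x y : hh f p (a *: x) y = a *: hh f p x y.
Proof. by rewrite -[_ *: _ in LHS]addr0 hhP // hh0l addr0. Qed.

Lemma hhDr p x y y' : hh f p x (y + y') = hh f p x y + hh f p x y'.
Proof. by rewrite !(hhC f_imm p x) hhDl. Qed.

Lemma hhZr p a x y : hh f p x (a *: y) = a *: hh f p x y.
Proof. by rewrite !(hhC f_imm p x) hhZl. Qed.

Lemma hh0r p x : hh f p x 0 = 0.
Proof. by rewrite hhC // hh0l. Qed.

Lemma hh_suml p I l (P : pred I) (F : I -> 'rV_(dim M)) y :
  hh f p (\sum_(i <- l | P i) F i) y = \sum_(i <- l | P i) hh f p (F i) y.
Proof. by apply: (big_morph (fun x => hh f p x y)); [move=> ? ?; exact: hhDl|exact: hh0l]. Qed.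

Lemma hh_sumr p I l (P : pred I) (F : I -> 'rV_(dim M)) x :
  hh f p x (\sum_(i <- l | P i) F i) = \sum_(i <- l | P i) hh f p x (F i).
Proof. by apply: (big_morph (hh f p x)); [move=> ? ?; exact: hhDr|exact: hh0r]. Qed.

Lemma nab_local (P : riemannian R) (g : M -> P) p v s s' U : open U -> U p ->
  (forall q, U q -> s q = s' q) -> nab g p v s = nab g p v s'.
Proof.
move=> oU Up E; rewrite /nab; apply: covd_near.
by apply: filterS (near_chartV (dom_self p) oU Up) => z [_ _ _ /E].
Qed.

Lemma nab_scale (P : riemannian R) (g : M -> P) p v (k : M -> R) s : gdiff g p ->
  differentiable (fun z => k (chartV p z) : R^o) (chart p p) -> secdiff g s p ->
  nab g p v (fun q => k q *: s q) =
  dv v (fun z => k (chartV p z) : R^o) (chart p p) *: s p + k p *: nab g p v s.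
Proof.
move=> gg dk ds; rewrite /nab.
by have := covd_scale v gg.2 dk ds; rewrite chartKd.
Qed.

Lemma coord_secdiff p y : secdiff (idfun : M -> M) (cfield p y) p.
Proof. by have := sdiff_coord y (dom_self p). Qed.

Lemma Hsec_smooth p a b : smooth_sec f (dom p) (Hsec p a b).
Proof. by apply: hh_smooth => //; [exact: dom_open|exact: coord_smooth|exact: coord_smooth]. Qed.

Lemma Hsec_secdiff p a b : secdiff f (Hsec p a b) p.
Proof. by apply: (smooth_secdiff _ _ (Hsec_smooth p a b)) => //; exact: dom_open. Qed.

Lemma nabP (P : riemannian R) (g : M -> P) p a v w s : gdiff g p -> secdiff g s p ->
  nab g p (a *: v + w) s = a *: nab g p v s + nab g p w s.
Proof. by move=> gg ds; rewrite /nab; exact: covdP gg.2 ds. Qed.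

Lemma nabZ (P : riemannian R) (g : M -> P) p a v s : gdiff g p -> secdiff g s p ->
  nab g p (a *: v) s = a *: nab g p v s.
Proof.
move=> gg ds; have n0 : nab g p 0 s = 0.
  by have := nabP (-1) 0 0 gg ds; rewrite scaler0 addr0 scaleN1r addNr.
by rewrite -[_ *: _ in LHS]addr0 nabP // n0 addr0.
Qed.

Lemma hE p x y : h f p x y = hh f p x y.
Proof. by rewrite /hh sealE. Qed.

(** The three coordinate fields are cut off to global ones and [f_par] is applied to them. The terms
    containing the derivative [d] of the cut-off function agree on both sides; what remains carries
    the common factor [c ^+ 3], which is nonzero at [p]. *)
Lemma parallel_coord p v a b :
  npart f p (nab f p v (Hsec p a b)) =
  hh f p (nab (idfun : M -> M) p v (cfield p a)) b
  + hh f p a (nab (idfun : M -> M) p v (cfield p b)).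
Proof.
have [chi [cchi c0 sX]] := bump_field (dom_self p).
pose X y q' := if pselect (dom p q') then chi (chart p q') *: jac p q' q' y else 0.
pose k q' : R := chi (chart p q').
have XE y q' : dom p q' -> X y q' = k q' *: cfield p y q' by rewrite /X; case: pselect.
have kp : k p = chi (chart p p) by [].
set c := k p in kp.
have sX' y : smooth_sec (idfun : M -> M) setT (X y) by exact: sX.
have := f_par (sX' v) (sX' a) (sX' b) p.
rewrite /nabla_normal normal_partE // !nablaE XE // {1 2 3}/cfield jac_id // -/c.
have dk : differentiable (fun z => k (chartV p z) : R^o) (chart p p).
  apply: (@differentiable_near _ _ _ chi).
    apply: filterS (near_chartV (dom_self p) openT Logic.I) => z [_ _ zE _].
    by rewrite /k zE.
  exact: Cinfty_differentiable cchi _.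
have gid : gdiff (idfun : M -> M) p by exact: gdiff_id.
have nX y : nab (idfun : M -> M) p (c *: v) (X y) =
  c *: (dv v (fun z => k (chartV p z) : R^o) (chart p p) *: y
        + c *: nab (idfun : M -> M) p v (cfield p y)).
  rewrite (nab_local _ _ (@dom_open _ _ p) (dom_self p) (XE y)).
  rewrite nab_scale //; last exact: coord_secdiff.
  rewrite nabZ //; last exact: coord_secdiff.
  rewrite dvZ // [cfield p y p]jac_id // -/c.
  move: (nab _ _ _ _) (dv v _ _) => A d; apply/rowP => i.
  by rewrite !mxE /GRing.scale /=; ring.
set d := dv v _ _ in nX.
have nH : nab f p (c *: v) (fun q => h f q (X a q) (X b q)) =
  c *: ((d * c + c * d) *: hh f p a b + (c * c) *: nab f p v (Hsec p a b)).
  have E q : dom p q -> h f q (X a q) (X b q) = (k q * k q) *: Hsec p a b q.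
    by move=> pq; rewrite hE !XE // hhZl hhZr scalerA.
  rewrite (nab_local _ _ (@dom_open _ _ p) (dom_self p) E).
  rewrite (@nab_scale _ f p (c *: v) (fun q => k q * k q)) //; last exact: Hsec_secdiff.
    rewrite dv_mulf // dvZ // -/d chartKd // -/c nabZ //; last exact: Hsec_secdiff.
    rewrite [Hsec p a b p]/Hsec /cfield !jac_id //.
    move: (nab _ _ _ _) (hh _ _ _ _) => A B; apply/rowP => i.
    by rewrite !mxE /GRing.scale /=; ring.
  exact: differentiable_mulf.
rewrite nH !nX !XE // /cfield !jac_id // -/c !hE.
move: (nab _ p v _) (nab _ p v _) (nab _ p v _) => nb na A.
rewrite !hhZl !hhZr !hhDl !hhDr !hhZl !hhZr npartZ // npartD // !npartZ //.
rewrite (npart_id f_imm (normal_hh f_imm p a b)).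
move: (npart _ _ _) (hh f p a b) (hh _ _ na _) (hh _ _ _ nb) => {}A B C D E.
have {}E : c ^+ 3 *: A = c ^+ 3 *: (C + D).
  apply/rowP => i; move/rowP/(_ i): E; rewrite !mxE => E.
  by rewrite !exprS expr0; lra.
by apply: (scalerI (a := c ^+ 3)) E; rewrite expf_neq0 // kp.
Qed.

Section AlongMap.
Variables (V : normedModType R) (psi : V -> M) (x v : V).
Hypothesis mpsi : mdiff psi x.
Let p := psi x.

Lemma field_decomp (Y : V -> 'rV[R]_(dim M)) :
  \near x, \sum_i shat p psi Y x 0 i *: cfield p (e_ i) (psi x) = Y x.
Proof.
have := near_dom mpsi.1 (dom_self p); move: (psi) => psi'.
apply: filterS => y py; rewrite /shat /cfield.
rewrite -[RHS](jacK (dom_self _) py); set w := jac (psi' y) _ _ _.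
rewrite [in RHS](row_sum_delta w) jac_sum //.
by apply: eq_bigr => i _; rewrite jacZ.
Qed.

Lemma sdiff_cfield a : sdiff psi (fun y => cfield p a (psi y)) x.
Proof. by have [] := covd_nabla v mpsi (gdiff_id _) (coord_secdiff p a). Qed.

Lemma covd_cfield a : covd psi x v (fun y => cfield p a (psi y)) =
  nab (idfun : M -> M) p (vel psi x v) (cfield p a).
Proof. by have [] := covd_nabla v mpsi (gdiff_id _) (coord_secdiff p a). Qed.

Lemma sdiff_Hsec a b : sdiff (fun y => f (psi y)) (fun y => Hsec p a b (psi y)) x.
Proof. by have [] := covd_nabla v mpsi (gf _) (Hsec_secdiff p a b). Qed.

Lemma covd_Hsec a b : covd (fun y => f (psi y)) x v (fun y => Hsec p a b (psi y)) =
  nab f p (vel psi x v) (Hsec p a b).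
Proof. by have [] := covd_nabla v mpsi (gf _) (Hsec_secdiff p a b). Qed.

Let mfpsi := mdiff_imm f_imm mpsi.

Lemma covd_field (Y : V -> 'rV[R]_(dim M)) : sdiff psi Y x ->
  covd psi x v Y = \sum_i (dv v (fun y => shat p psi Y y 0 i : R^o) x *: e_ i
    + Y x 0 i *: nab (idfun : M -> M) p (vel psi x v) (cfield p (e_ i))).
Proof.
move=> dY; rewrite -(covd_near _ v (field_decomp Y)).
have dYi i : differentiable (fun y => shat p psi Y y 0 i : R^o) x.
  exact: differentiable_entry dY.
rewrite covd_sum // => [|i]; last by apply: sdiff_scale => //; exact: sdiff_cfield.
apply: eq_bigr => i _; rewrite covd_scale //; last exact: sdiff_cfield.
have cE : cfield p (e_ i) (psi x) = e_ i by rewrite /cfield jac_id.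
by rewrite covd_cfield cE shat_self.
Qed.

(** Parallelism of h for fields along any map, in particular along curves, where the fields need not
    extend to M. Both fields are expanded in the coordinate fields at [p], and the Leibniz rule
    reduces the claim to [parallel_coord]. *)
Lemma covd_hh (Y Z : V -> 'rV[R]_(dim M)) : sdiff psi Y x -> sdiff psi Z x ->
  sdiff (fun y => f (psi y)) (fun y => hh f (psi y) (Y y) (Z y)) x /\
  npart f p (covd (fun y => f (psi y)) x v (fun y => hh f (psi y) (Y y) (Z y))) =
    hh f p (covd psi x v Y) (Z x) + hh f p (Y x) (covd psi x v Z).
Proof.
move=> dY dZ.
pose y_ i y : R^o := shat p psi Y y 0 i; pose z_ j y : R^o := shat p psi Z y 0 j.
have dy i : differentiable (y_ i) x by exact: differentiable_entry dY.
have dz i : differentiable (z_ i) x by exact: differentiable_entry dZ.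
have dyz i j : differentiable (fun y => y_ i y * z_ j y : R^o) x by exact: differentiable_mulf.
have E : \near x, \sum_i \sum_j (y_ i x * z_ j x) *: Hsec p (e_ i) (e_ j) (psi x)
     = hh f (psi x) (Y x) (Z x).
  apply: filterS2 (field_decomp Y) (field_decomp Z) => y EY EZ.
  rewrite -[in RHS]EY -[in RHS]EZ hh_suml; apply: eq_bigr => i _.
  by rewrite hh_sumr; apply: eq_bigr => j _; rewrite hhZl hhZr scalerA.
have dH i j : sdiff (fun y => f (psi y))
    (fun y => (y_ i y * z_ j y) *: Hsec p (e_ i) (e_ j) (psi y)) x.
  by apply: sdiff_scale => //; exact: sdiff_Hsec.
have dH' i : sdiff (fun y => f (psi y))
    (fun y => \sum_j (y_ i y * z_ j y) *: Hsec p (e_ i) (e_ j) (psi y)) x.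
  exact: sdiff_sum.
split; first by apply: (sdiff_near E); exact: sdiff_sum.
rewrite -(covd_near _ v E) covd_sum // npart_sum // !covd_field //.
have HE i j : Hsec p (e_ i) (e_ j) p = hh f p (e_ i) (e_ j).
  by rewrite /Hsec /cfield !jac_id.
have yE i : y_ i x = Y x 0 i by rewrite /y_ shat_self.
have zE i : z_ i x = Z x 0 i by rewrite /z_ shat_self.
rewrite [in hh f p _ (Z x)](row_sum_delta (Z x)) [in hh f p (Y x) _](row_sum_delta (Y x)).
rewrite !hh_suml -big_split; apply: eq_bigr => i _ /=.
rewrite !hh_sumr covd_sum // npart_sum // -big_split; apply: eq_bigr => j _ /=.
rewrite covd_scale //; last exact: sdiff_Hsec.
rewrite covd_Hsec npartD // !npartZ // parallel_coord HE (npart_id f_imm (normal_hh f_imm _ _ _)).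
rewrite dv_mulf // yE zE hhZr hhZl !hhDl !hhDr !hhZl !hhZr.
move: (hh f p _ _) (hh f p _ _) (hh f p _ _) => A B C.
by apply/rowP => l; rewrite !mxE; ring.
Qed.

End AlongMap.

End ParallelSff.

(** * Parallel transport and frames *)

Section ConstantAlong.
Variable R : realType.

Lemma const_on_interval (J : set R) (u : R -> R) : is_interval J ->
  (forall t, J t -> differentiable (u : R^o -> R^o) t) ->
  (forall t, J t -> dv (1 : R^o) (u : R^o -> R^o) t = 0) ->
  forall s t, J s -> J t -> u s = u t.
Proof.
move=> iJ du Du s t; wlog st : s t / s <= t.
  by move=> H Js Jt; case: (leP s t) => [/H|/ltW /H h]; [apply|rewrite h].
move=> Js Jt.
have Jx x : s <= x <= t -> J x by move=> h; exact: (iJ s t Js Jt).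
have [| |c hc] := @MVT_segment R u (fun=> 0) s t st.
- move=> x; rewrite in_itv /= => /andP[sx xt].
  have Jxx : J x by apply: Jx; rewrite !ltW.
  have := Du x Jxx; rewrite dvE => <-.
  by apply: derivableP; apply/derivable1_diffP; exact: du.
- apply: derivable_within_continuous => x; rewrite in_itv /= => hx.
  by apply/derivable1_diffP/du/Jx.
- by rewrite mul0r => /eqP; rewrite subr_eq0 => /eqP ->.
Qed.

Variables (N : riemannian R) (F : R^o -> N) (J : set R).
Hypothesis iJ : is_interval J.
Hypothesis mF : forall t, J t -> mdiff F t.

Lemma inner_const (s s' : R^o -> 'rV[R]_(dim N)) :
  (forall t, J t -> [/\ sdiff F s t, sdiff F s' t &
     inner (F t) (covd F t 1 s) (s' t) + inner (F t) (s t) (covd F t 1 s') = 0]) ->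
  forall t u, J t -> J u -> inner (F t) (s t) (s' t) = inner (F u) (s u) (s' u).
Proof.
move=> H; apply: (const_on_interval iJ) => t Jt.
  by have [ds ds' _] := H t Jt; have [] := inner_along (mF Jt) ds ds'.
by have [ds ds' <-] := H t Jt; have [_ ->] := inner_along (mF Jt) ds ds'.
Qed.

(* Parallel sections have constant length, so a parallel section vanishes
   identically as soon as it vanishes at one point. *)
Lemma parallel_unique (s s' : R^o -> 'rV[R]_(dim N)) t0 : J t0 -> s t0 = s' t0 ->
  (forall t, J t -> [/\ sdiff F s t, sdiff F s' t & covd F t 1 s = covd F t 1 s']) ->
  forall t, J t -> s t = s' t.
Proof.
move=> J0 E0 H t Jt.
pose d (t : R^o) := s t + - s' t.
have dd u : J u -> sdiff F d u /\ covd F u 1 d = 0.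
  move=> Ju; have [ds ds' E] := H u Ju; have mFu := mF Ju.
  have dN := sdiffN mFu ds'; split; first exact: sdiffD.
  by rewrite covdD // covdN // E subrr.
have : inner (F t) (d t) (d t) = 0.
  rewrite (@inner_const d d _ t t0) //.
    by rewrite /d E0 subrr /inner inner_of0l.
  move=> u Ju; have [du ->] := dd u Ju; split=> //.
  by rewrite /inner inner_of0l inner_of0r addr0.
have [|nz] := eqVneq (d t) 0; first by move/eqP; rewrite subr_eq0 => /eqP.
by have := metric_pos (F t) nz; rewrite /inner => /[swap] ->; rewrite ltxx.
Qed.

End ConstantAlong.

(** * Isometries preserve covariant derivatives *)

Section Isometry.
Variables (R : realType) (M N : riemannian R) (g : M -> N).
Hypothesis g_isom : isometry g.

Lemma isometry_imm : isometric_immersion g.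
Proof. by case: g_isom => sg _ ig. Qed.

Lemma tm_surj q y : exists x, tm g q x = y.
Proof.
have [sg [g' [sg' gK g'K]] _] := g_isom.
exists (tm g' (g q) y).
have gg' : gdiff g (g' (g q)) by exact: smooth_gdiff.
have [_ E] := tm_comp y (smooth_gdiff (g q) sg') gg'.
have H := tm_id (g q) y; move: E; rewrite gK => <-.
rewrite -[RHS]H; congr (tm _ _ _); apply/funext => z; exact: g'K.
Qed.

(** The differential of an isometry is onto, so a vector normal to its image is orthogonal to
    itself. The Gauss formula then says that isometries commute with covariant differentiation. *)
Lemma isometry_hh0 q x y : hh g q x y = 0.
Proof.
have [z zE] := tm_surj q (hh g q x y).
have := hh_normal isometry_imm q x y z; rewrite zE.
have [//|nz] := eqVneq (hh g q x y) 0.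
by have := metric_pos (g q) nz; rewrite /inner => /[swap] ->; rewrite ltxx.
Qed.

Lemma covd_isometry (V : normedModType R) (psi : V -> M) Y x v :
  mdiff psi x -> sdiff psi Y x ->
  covd (fun y => g (psi y)) x v (fun y => tm g (psi y) (Y y)) =
  tm g (psi x) (covd psi x v Y).
Proof. by move=> mpsi dY; rewrite (gauss isometry_imm) // isometry_hh0 addr0. Qed.

End Isometry.

Section ChartCurve.
Variables (R : realType) (M : riemannian R) (p : M) (z : R^o -> 'rV[R]_(dim M)).

(* [ccurve] and [csec] are a curve and a field along it given by their coordinates
   in the chart at [p]. *)
Definition ccurve (t : R^o) : M := chartV p (z t).

Lemma mdiff_chartVz x : cim p x -> mdiff (chartV p) x.
Proof. by move=> [q pq <-]; exact: mdiff_chartV. Qed.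

Lemma ccurve_mdiff t : differentiable z t -> cim p (z t) -> mdiff ccurve t.
Proof. by move=> dz /mdiff_chartVz mz; have [] := mdiff_comp dz mz. Qed.

Lemma ccurve_dom t : cim p (z t) -> dom p (ccurve t).
Proof. by move=> /chart_imP[]. Qed.

Lemma near_ccurve t : differentiable z t -> cim p (z t) -> \forall s \near t, cim p (z s).
Proof.
move=> dz ct; apply: (differentiable_continuous dz).
by apply: open_nbhs_nbhs; split=> //; exact: chart_image_open.
Qed.

Lemma ccurve_vel t : differentiable z t -> cim p (z t) ->
  jac (ccurve t) p (ccurve t) (vel ccurve t 1) = dv (1 : R^o) z t.
Proof.
move=> dz ct; rewrite (vel_chart _ (ccurve_mdiff dz ct) (ccurve_dom ct)).
by apply: dv_near; apply: filterS (near_ccurve dz ct) => s /chart_imP[].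
Qed.

Definition csec (y : R^o -> 'rV[R]_(dim M)) t := jac p (ccurve t) (ccurve t) (y t).

Lemma csec_sdiff y t : differentiable z t -> cim p (z t) -> differentiable y t ->
  sdiff ccurve (csec y) t.
Proof.
move=> dz ct dy; apply: (sdiffI (ccurve_mdiff dz ct) (ccurve_dom ct)).
apply: differentiable_near dy; apply: filterS (near_ccurve dz ct) => s /ccurve_dom ds.
by rewrite /shat /csec jac_comp // jac_id.
Qed.

Lemma csec_covd y t : differentiable z t -> cim p (z t) -> differentiable y t ->
  jac (ccurve t) p (ccurve t) (covd ccurve t 1 (csec y)) =
  dv (1 : R^o) y t + Gam p (z t) (dv (1 : R^o) z t) (y t).
Proof.
move=> dz ct dy.
rewrite (covd_chart _ (ccurve_mdiff dz ct) (csec_sdiff dz ct dy) (ccurve_dom ct)).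
have yE s : cim p (z s) -> shat p ccurve (csec y) s = y s.
  by move=> /ccurve_dom ds; rewrite /shat /csec jac_comp // jac_id.
rewrite yE //; have [_ ->] := chart_imP ct; congr (_ + Gam _ _ _ _).
  by apply: dv_near; apply: filterS (near_ccurve dz ct) => s /yE.
by apply: dv_near; apply: filterS (near_ccurve dz ct) => s /chart_imP[].
Qed.

(** In the chart, parallelism of a field along [z] is the linear system [y' = - Gam p z z' y], whose
    coefficients are continuous on the closed interval. *)
Lemma ccurve_transport (U : set R^o) (a b : R) (e : 'rV[R]_(dim M)) : open U ->
  Cinfty U z -> U `<=` z @^-1` cim p -> a < 0 < b ->
  (forall t : R, a <= t <= b -> U t) ->
  exists Y : R^o -> 'rV[R]_(dim M), Y 0 = e /\
    forall t : R, a < t < b -> sdiff ccurve Y t /\ covd ccurve t 1 Y = 0.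
Proof.
move=> oU cz Uc ab Uab; have c0 : cim p (z 0).
  by apply/Uc/Uab; have /andP[? ?] := ab; rewrite !ltW.
pose w := fun t : R^o => dv (1 : R^o) z t.
pose A (i j : 'I_(dim M)) (t : R) : R := - Gam p (z t) (w t) (delta_mx 0 j) 0 i.
have cA i j t : a <= t <= b -> {for t, continuous (A i j)}.
  move=> /Uab Ut; apply: continuousN.
  have cG : Cinfty U (fun t : R^o => Gam p (z t) (w t) (delta_mx 0 j)).
    by apply: Gam_comp_smooth => //; [exact: Cinfty_dv|exact: Cinfty_cst].
  have := Cinfty_differentiable (Cinfty_entry i oU cG) Ut.
  exact: differentiable_continuous.
have [y [y0 dy]] := linear_ode_segment (fun i => jac (ccurve 0) p (ccurve 0) e 0 i) ab cA.
pose yv (t : R^o) : 'rV[R]_(dim M) := \row_i y i t.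
exists (csec yv); split.
  have -> : csec yv 0 = jac p (ccurve 0) (ccurve 0) (jac (ccurve 0) p (ccurve 0) e).
    by congr jac; apply/rowP => i; rewrite mxE y0.
  by rewrite jacK //; exact: ccurve_dom.
move=> t tab; have Ut : U t by apply: Uab; have /andP[? ?] := tab; rewrite !ltW.
have ct := Uc _ Ut; have dz := Cinfty_differentiable cz Ut.
have dyi i : differentiable (fun s => yv s 0 i : R^o) t.
  under eq_fun do rewrite mxE.
  by apply/derivable1_diffP; have [] := dy i t tab.
have dyv : differentiable yv t by exact: differentiable_row.
split; first exact: csec_sdiff.
apply: (can_inj (jacK (dom_self (ccurve t)) (ccurve_dom ct))).
rewrite csec_covd // jac0; apply/rowP => i; rewrite mxE dv_entry // [RHS]mxE.
have -> : dv (1 : R^o) (fun s => yv s 0 i : R^o) t = \sum_j A i j t * y j t.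
  rewrite dvE (_ : (fun s => yv s 0 i : R^o) = y i); last first.
    by apply/funext => s; rewrite mxE.
  by have [_ ->] := dy i t tab.
have [_ sE] := chart_imP ct; have pc := ccurve_dom ct.
have -> : Gam p (z t) (w t) (yv t) = \sum_j y j t *: Gam p (z t) (w t) (delta_mx 0 j).
  rewrite [in LHS](row_sum_delta (yv t)) -sE.
  rewrite (big_morph (Gam p (chart p (ccurve t)) (w t)) (id1 := 0) (op1 := +%R)).
  - by apply: eq_bigr => j _; rewrite GamZr // mxE.
  - by move=> x x'; rewrite GamDr.
  - by have := GamZr (w t) 0 0 pc; rewrite !scale0r.
rewrite summxE -big_split big1 // => j _ /=.
by rewrite [X in _ + X]mxE /A mulNr mulrC addNr.
Qed.

End ChartCurve.

Section ChartSegment.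
Variables (R : realType) (M : riemannian R) (p : M).
Variables (x0 : 'rV[R]_(dim M)) (rad : R) (u0 u1 : 'rV[R]_(dim M)).
Hypotheses (bu0 : ball x0 rad u0) (bu1 : ball x0 rad u1).

Definition seg (t : R^o) : 'rV[R]_(dim M) := u0 + t *: (u1 - u0).

(** The segment is prolonged beyond both ends so that the times [0] and [1] become interior. The
    room for this is [rad - m], where [m < rad] bounds the distances of the end points from the
    centre. *)
Lemma seg_ball : exists2 eta : R, 0 < eta &
  forall t, - eta <= t <= 1 + eta -> ball x0 rad (seg t).
Proof.
move: bu0 bu1; rewrite -ball_normE /ball_ /= => b0 b1.
pose m := Num.max `|x0 - u0| `|x0 - u1|.
have mr : m < rad by rewrite /m gt_max b0.
pose d := `|u1 - u0| + 1; have d0 : 0 < d by rewrite ltr_wpDl.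
exists ((rad - m) / d / 2); first by rewrite !divr_gt0 // subr_gt0.
set eta := _ / 2; have eta0 : 0 < eta by rewrite !divr_gt0 // subr_gt0.
have etad : eta * `|u1 - u0| < rad - m.
  have h : eta * d < rad - m.
    by rewrite /eta mulrAC divfK ?gt_eqF // ltr_pdivrMr // ltr_pMr ?subr_gt0 // ltr1n.
  by apply: le_lt_trans h; rewrite ler_wpM2l ?(ltW eta0) // /d lerDl.
have n0 : `|x0 - u0| <= m by rewrite /m le_max lexx.
have n1 : `|x0 - u1| <= m by rewrite /m le_max lexx orbT.
move=> t /andP[t1 t2].
have [th0|th0] := ltP t 0.
  rewrite /seg opprD addrA; apply: le_lt_trans (ler_normB _ _) _.
  rewrite -[X in _ < X](subrK m rad) [X in _ < X]addrC; apply: ler_ltD => //.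
  rewrite normrZ ltr0_norm //; apply: le_lt_trans etad.
  by rewrite ler_wpM2r // lerNl.
have [th1|th1] := ltP 1 t.
  have -> : seg t = u1 + (t - 1) *: (u1 - u0).
    by rewrite /seg; apply/rowP => i; rewrite !mxE; ring.
  rewrite opprD addrA; apply: le_lt_trans (ler_normB _ _) _.
  rewrite -[X in _ < X](subrK m rad) [X in _ < X]addrC; apply: ler_ltD => //.
  rewrite normrZ gtr0_norm ?subr_gt0 //; apply: le_lt_trans etad.
  by rewrite ler_wpM2r // lerBlDl.
apply: le_lt_trans mr.
have -> : x0 - seg t = (1 - t) *: (x0 - u0) + t *: (x0 - u1).
  by rewrite /seg; apply/rowP => i; rewrite !mxE; ring.
apply: le_trans (ler_normD _ _) _; rewrite !normrZ ger0_norm ?subr_ge0 // (ger0_norm th0).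
have -> : m = (1 - t) * m + t * m by ring.
by apply: lerD; rewrite ler_wpM2l // subr_ge0.
Qed.

Lemma seg_differentiable t : differentiable seg t.
Proof. exact: differentiable_line. Qed.

Lemma dv_seg t : dv (1 : R^o) seg t = u1 - u0.
Proof. by rewrite dvE; exact: derive_line. Qed.

Lemma seg_smooth (U : set R^o) : open U -> Cinfty U seg.
Proof.
move=> oU; apply: Cinfty_add => //; first exact: Cinfty_cst.
apply: Cinfty_scale_row => //; last exact: Cinfty_cst.
by move=> k; exact: Ck_id.
Qed.

End ChartSegment.

(** * Gram matrices and local frames *)

Section Gram.
Variables (R : realType) (N : riemannian R) (y : N).

Definition rows r (e : 'I_r -> 'rV[R]_(dim N)) : 'M[R]_(r, dim N) := \matrix_i e i.

Definition gram r (e : 'I_r -> 'rV[R]_(dim N)) : 'M[R]_r :=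
  \matrix_(i, j) inner y (e i) (e j).

Lemma mul_rows r (e : 'I_r -> 'rV[R]_(dim N)) (a : 'rV_r) :
  a *m rows e = \sum_i a 0 i *: e i.
Proof. by rewrite mulmx_sum_row; apply: eq_bigr => i _; rewrite rowK. Qed.

Lemma gramE r (e : 'I_r -> 'rV[R]_(dim N)) :
  gram e = rows e *m metric y *m (rows e)^T.
Proof.
apply/matrixP => i j; rewrite mxE /inner /inner_of.
have -> : e i = row i (rows e) by rewrite rowK.
have -> : e j = row j (rows e) by rewrite rowK.
by rewrite tr_row -!row_mul !mxE; apply: eq_bigr => k _; rewrite !mxE.
Qed.

Lemma metric_inj0 (u : 'rV[R]_(dim N)) : inner y u u = 0 -> u = 0.
Proof.
move=> u0; have [//|nz] := eqVneq u 0.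
by have := metric_pos y nz; rewrite -/(inner y u u) u0 ltxx.
Qed.

(** If [u *m gram e = 0], then [u *m rows e] has length [0], so both matrices have the same kernel.
    Hence the inner products of a family determine its rank. *)
Lemma rank_gram r (e : 'I_r -> 'rV[R]_(dim N)) : \rank (gram e) = \rank (rows e).
Proof.
have kE : (kermx (gram e) == kermx (rows e))%MS.
  apply/andP; split; apply/rV_subP => u /sub_kermxP ue; apply/sub_kermxP; last first.
    by rewrite gramE !mulmxA ue !mul0mx.
  apply: metric_inj0; rewrite /inner /inner_of trmx_mul !mulmxA.
  have -> : u *m rows e *m metric y *m (rows e)^T = u *m gram e.
    by rewrite gramE !mulmxA.
  by rewrite ue mul0mx mxE.
have := mxrank_ker (gram e); have := mxrank_ker (rows e).
rewrite (eqmxP kE) => -> /(congr1 (subn r)).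
by rewrite !subKn ?rank_leq_row.
Qed.

Lemma gram_unit r (e : 'I_r -> 'rV[R]_(dim N)) :
  (forall a : 'rV_r, \sum_i a 0 i *: e i = 0 -> a = 0) -> gram e \in unitmx.
Proof.
move=> H; rewrite -row_free_unit /row_free rank_gram -/(row_free _) -kermx_eq0.
apply/eqP/row_matrixP => i; rewrite row0; apply: H; rewrite -mul_rows.
by rewrite -row_mul mulmx_ker row0.
Qed.

(** On the span of an independent family these are the components of [v]. Written with inner
    products only, they inherit the regularity of [v] and of the family. *)
Definition coef r (e : 'I_r -> 'rV[R]_(dim N)) v : 'rV[R]_r :=
  (\row_j inner y v (e j)) *m invmx (gram e).

Lemma coefK r (e : 'I_r -> 'rV[R]_(dim N)) (a : 'rV_r) : gram e \in unitmx ->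
  coef e (\sum_i a 0 i *: e i) = a.
Proof.
move=> ue; apply: (canLR (mulmxK ue)); apply/rowP => j; rewrite !mxE /inner inner_of_suml.
by apply: eq_bigr => i _; rewrite inner_ofZl !mxE.
Qed.

End Gram.

Section Frames.
Variables (R : realType) (M N : riemannian R) (f : M -> N).
Hypothesis sf : smooth f.
Let cf : continuous f. Proof. by case: sf. Qed.
Let gf q : gdiff f q. Proof. exact: smooth_gdiff. Qed.

Lemma inner_smooth U s s' : open U -> smooth_sec f U s -> smooth_sec f U s' ->
  smooth_fun U (fun q => inner (f q) (s q) (s' q)).
Proof.
move=> oU /smooth_secP hs /smooth_secP hs' p; apply: Cinfty_local => _ [q [Uq pq] <-].
exists (sdom f U p (f q)); first by exists q => //; split=> //; exact: dom_self.
have oD := @sdom_open _ _ _ f cf U p (f q) oU.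
have sD : sdom f U p (f q) `<=` fdom f p (f q).
  by move=> _ [x [[Ux px] rx] <-]; exists x.
have cG : Cinfty_mx (sdom f U p (f q)) (fun z => gmx (f q) (fhat f p (f q) z)).
  have sF : Cinfty (sdom f U p (f q)) (fhat f p (f q)).
    by apply: Cinfty_sub sD _; case: sf => _; exact.
  move=> i j; apply: (Cinfty_comp oD (@chart_image_open _ _ (f q)) _ sF (@gmx_smooth _ N (f q) i j)).
  by move=> _ [x [[Ux px] rx] <-]; rewrite /= /fhat chartKd //; exists (f x).
apply: (@Cinfty_eq _ _ _ _ (fun z => inner_of (gmx (f q) (fhat f p (f q) z))
   (sechat f p (f q) s z) (sechat f p (f q) s' z) : R^o)) => //.
  by move=> _ [x [[Ux px] rx] <-]; rewrite /sechat /fhat /= chartKd // -inner_chart.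
under eq_fun do rewrite inner_ofE.
apply: Cinfty_sum => // i _; apply: Cinfty_sum => // j _.
by apply: Cinfty_mul => //; [apply: Cinfty_mul => //|]; exact: Cinfty_entry.
Qed.

Lemma gram_smooth U r (e : 'I_r -> M -> 'rV[R]_(dim N)) p : open U ->
  (forall i, smooth_sec f U (e i)) ->
  Cinfty_mx (chart p @` (U `&` dom p))
    (fun z => gram (f (chartV p z)) (fun i => e i (chartV p z))).
Proof.
move=> oU se i j; under eq_fun do rewrite mxE.
by have := inner_smooth oU (se i) (se j) p.
Qed.

Lemma vdom_nbhs (p q : M) (P : set 'rV[R]_(dim M)) : dom p q ->
  nbhs (chart p q) P -> \forall x \near q, dom p x /\ P (chart p x).
Proof.
move=> pq hP; have cq := chart_continuous pq; near=> x; split; last first.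
  by near: x; exact: cq.
by near: x; apply: open_nbhs_nbhs; split => //; exact: dom_open.
Unshelve. all: by end_near.
Qed.

Lemma near_gram_unit U r (e : 'I_r -> M -> 'rV[R]_(dim N)) p : open U -> U p ->
  (forall i, smooth_sec f U (e i)) -> gram (f p) (e^~ p) \in unitmx ->
  exists U', [/\ open U', U' p, U' `<=` U &
    forall q, U' q -> gram (f q) (e^~ q) \in unitmx].
Proof.
move=> oU Up se up.
have oD := @vdom_open _ M U p oU.
have cD : {for chart p p, continuous (fun z => \det (gram (f (chartV p z))
     (fun i => e i (chartV p z))) : R^o)}.
  apply: (Cinfty_continuous (U := vdom U p)); last by exists p.
  by apply: Cinfty_det => //; exact: gram_smooth.
have nz : \det (gram (f (chartV p (chart p p))) (fun i => e i (chartV p (chart p p)))) != 0.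
  by rewrite chartKd // -unitfE -[_ \is a _]/(_ \in unitmx).
have H := vdom_nbhs (dom_self p) (@cvgr_neq0 _ R^o _ _ (nbhs_filter _) _ _ cD nz).
pose P q := gram (f q) (e^~ q) \in unitmx.
exists (U `&` interior P); split => //.
- by apply: openI => //; exact: open_interior.
- split=> //; apply: filterS H => x [px].
  by rewrite chartKd // /P unitmxE unitfE.
- by move=> q [_ /interior_subset].
Qed.

(** A maximal independent subfamily at [p] stays independent nearby, since its Gram determinant is
    continuous; constancy of the rank forces it to span there. *)
Lemma const_rank_frame (E : M -> set 'rV[R]_(dim N)) U L (s : 'I_L -> M -> 'rV[R]_(dim N)) p :
  open U -> U p -> (forall i, smooth_sec f U (s i)) ->
  (forall q v, U q -> E q v <-> (v <= rows (s^~ q))%MS) ->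
  (forall q, U q -> \rank (rows (s^~ q)) = \rank (rows (s^~ p))) ->
  exists U' r (g : 'I_r -> 'I_L), [/\ U' `<=` U, U' p &
    local_frame f E U' (fun i => s (g i))].
Proof.
move=> oU Up ss EP rk; pose g := maxrankfun (rows (s^~ p)).
pose e i := s (g i).
have eE q : rows (e^~ q) = rowsub g (rows (s^~ q)).
  by apply/row_matrixP => i; rewrite row_rowsub !rowK.
have [|U' [oU' Up' UU uG]] := @near_gram_unit U _ e p oU Up (fun i => ss (g i)).
  by rewrite -row_free_unit /row_free rank_gram eE; have := maxrowsub_free (rows (s^~ p)).
have span q v : U' q -> E q v <-> (v <= rows (e^~ q))%MS.
  move=> Uq; have le : (rows (e^~ q) <= rows (s^~ q))%MS.
    by rewrite eE; apply/row_subP => i; rewrite row_rowsub row_sub.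
  rewrite EP; last exact: UU.
  suff ee : (rows (e^~ q) :=: rows (s^~ q))%MS by rewrite ee.
  apply/eqmxP; rewrite -(mxrank_leqif_eq le).2 rk; last exact: UU.
  have := uG _ Uq; rewrite -row_free_unit /row_free rank_gram => /eqP ->.
  by [].
exists U', _, g; split=> //; split=> //.
- move=> i; split=> //; last exact: smooth_sec_sub UU (ss _).
  by move=> q Uq; apply/span => //; have := row_sub i (rows (e^~ q)); rewrite rowK.
- by move=> q a Uq; apply/span => //; rewrite -(mul_rows (e^~ q)) submxMl.
- move=> q v Uq /(span q v Uq)/submxP[a ->]; exists a; split; first by rewrite mul_rows.
  move=> b; rewrite mul_rows => /(congr1 (coef (f q) (e^~ q))).
  by rewrite !coefK // uG.
Qed.

Lemma local_frame_gram (E : M -> set 'rV[R]_(dim N)) U r (e : 'I_r -> M -> 'rV[R]_(dim N)) q :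
  local_frame f E U e -> U q -> gram (f q) (e^~ q) \in unitmx.
Proof.
move=> [_ _ Ee He] Uq; apply: gram_unit => a a0.
have E0 : E q 0 by rewrite -a0; exact: Ee.
have [b [_ bu]] := He q 0 Uq E0.
by rewrite -(bu a (esym a0)); apply: bu; rewrite big1 // => i _; rewrite mxE scale0r.
Qed.

Lemma coef_smooth U r (e : 'I_r -> M -> 'rV[R]_(dim N)) s : open U ->
  (forall i, smooth_sec f U (e i)) -> smooth_sec f U s ->
  (forall q, U q -> gram (f q) (e^~ q) \in unitmx) ->
  forall i, smooth_fun U (fun q => coef (f q) (e^~ q) (s q) 0 i).
Proof.
move=> oU se ss uG i p; have oD := @vdom_open _ M U p oU.
have cG : Cinfty_mx (vdom U p) (fun z => coef (f (chartV p z)) (e^~ (chartV p z)) (s (chartV p z))).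
  apply: Cinfty_mulmx => //.
    by move=> k j; under eq_fun do rewrite mxE; have := inner_smooth oU ss (se j) p.
  apply: Cinfty_invmx => //; last exact: gram_smooth.
  by move=> _ [q [Uq pq] <-]; rewrite chartKd //; exact: uG.
exact: cG.
Qed.

End Frames.

Section Curves.
Variables (R : realType) (M : manifold R).

Lemma velocityE (c : R -> M) t : velocity c t = vel (c : R^o -> M) t (1 : R^o).
Proof. by rewrite /velocity /vel dvE derive1E. Qed.

Lemma smooth_curve_mdiff J (c : R -> M) t : smooth_curve J c -> J t ->
  mdiff (c : R^o -> M) t.
Proof.
move=> [cc sc] Jt; split; first exact: cc.
apply: (Cinfty_differentiable (sc (c t))); split=> //; exact: dom_self.
Qed.

End Curves.

(** * Parallel sections: frame coefficients versus covariant derivatives *)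

Section ParallelAlong.
Variables (R : realType) (M N : riemannian R) (f : M -> N).
Hypothesis sf : smooth f.
Let gf q : gdiff f q. Proof. exact: smooth_gdiff. Qed.
#[local] Hint Resolve gf : core.

(** [P] lets one argument serve both connections: it is the identity for the osculating bundle, and
    [npart] for the normal connection on the first normal bundle. *)
Variable P : M -> 'rV[R]_(dim N) -> 'rV[R]_(dim N).
Hypothesis P_lin : forall p a v w, P p (a *: v + w) = a *: P p v + P p w.
Let D p v s := P p (nabla f p v s).
Variable E : M -> set 'rV[R]_(dim N).
Hypothesis PE : forall p v, E p v -> P p v = v.

Lemma coef_differentiable (c : R^o -> M) (w : R^o -> 'rV[R]_(dim N)) U r
    (e : 'I_r -> M -> 'rV[R]_(dim N)) t i : mdiff c t -> open U -> U (c t) ->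
  (forall k, smooth_sec f U (e k)) -> sdiff (fun u => f (c u)) w t ->
  (forall q, U q -> gram (f q) (e^~ q) \in unitmx) ->
  differentiable (fun u => coef (f (c u)) (e^~ (c u)) (w u) 0 i : R^o) t.
Proof.
move=> mc oU Ut se ds uG; have [mfc _] := vel_map mc (gf (c t)).
have de k : sdiff (fun u => f (c u)) (fun u => e k (c u)) t.
  by have [] := covd_nabla (1 : R^o) mc (gf (c t)) (smooth_secdiff oU Ut (se k)).
pose p := c t; pose kap j z := invmx (gram (f (chartV p z)) (e^~ (chartV p z))) j i.
have oD := @vdom_open _ M U p oU.
have dk j : differentiable (kap j : _ -> R^o) (chart p (c t)).
  have cG : Cinfty_mx (vdom U p) (fun z => invmx (gram (f (chartV p z)) (e^~ (chartV p z)))).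
    apply: Cinfty_invmx => //; last exact: gram_smooth.
    by move=> _ [q [Uq pq] <-]; rewrite chartKd //; exact: uG.
  apply: (Cinfty_differentiable (cG j i)); exists p => //; split=> //; exact: dom_self.
have near_dom : \forall u \near t, dom p (c u).
  apply: (mc.1); apply: open_nbhs_nbhs; split; [exact: dom_open|exact: dom_self].
apply: (@differentiable_near _ _ _ (fun u => \sum_j inner (f (c u)) (w u) (e j (c u)) *
    kap j (chart p (c u)) : R^o)).
  apply: filterS near_dom => u pu; rewrite /coef mxE; apply: eq_bigr => j _.
  by rewrite mxE /kap chartKd.
apply: differentiable_sumf => j _; apply: differentiable_mulf.
  by have [] := inner_along mfc ds (de j).
exact: (differentiable_comp mc.2 (dk j)).
Qed.

Lemma P0 p : P p 0 = 0.
Proof. by have := P_lin p (-1) 0 0; rewrite scaler0 addr0 scaleN1r addNr. Qed.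

Lemma P_sum p I l (Q : pred I) (v : I -> 'rV_(dim N)) :
  P p (\sum_(i <- l | Q i) v i) = \sum_(i <- l | Q i) P p (v i).
Proof.
apply: (big_morph (P p)); last exact: P0.
by move=> x y; rewrite -[x]scale1r P_lin !scale1r.
Qed.

Lemma covd_frame (c : R^o -> M) t r (e : 'I_r -> M -> 'rV[R]_(dim N))
    (a : 'I_r -> R^o -> R^o) : mdiff c t -> (forall i, secdiff f (e i) (c t)) ->
  (forall i, differentiable (a i) t) ->
  sdiff (fun u => f (c u)) (fun u => \sum_i a i u *: e i (c u)) t /\
  covd (fun u => f (c u)) t 1 (fun u => \sum_i a i u *: e i (c u)) =
  \sum_i (dv (1 : R^o) (a i) t *: e i (c t)
           + a i t *: nab f (c t) (vel c t (1 : R^o)) (e i)).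
Proof.
move=> mc de da; have [mfc _] := vel_map mc (gf (c t)).
have H i := @covd_nabla _ _ _ f _ c (e i) t (1 : R^o) mc (gf (c t)) (de i).
have ds i : sdiff (fun u => f (c u)) (fun u => a i u *: e i (c u)) t.
  by apply: sdiff_scale => //; have [] := H i.
split; first exact: sdiff_sum.
rewrite covd_sum //; apply: eq_bigr => i _; rewrite covd_scale //.
  by have [_ ->] := H i.
by have [] := H i.
Qed.

Lemma parallel_along_covd J (s : R -> tot N E) : parallel_along f E D J s ->
  forall t, J t -> [/\ mdiff (bpt \o s : R^o -> M) t,
    sdiff (fun u : R^o => f (bpt (s u))) (fun u => vec (s u)) t &
    P (bpt (s t)) (covd (fun u : R^o => f (bpt (s u))) t 1 (fun u => vec (s u))) = 0].
Proof.
move=> [oJ iJ sc H] t Jt; have mc := smooth_curve_mdiff sc Jt.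
have [U [r [e [a [Uc [se oU _ _] sE da S0]]]]] := H t Jt.
have de i : secdiff f (e i) (bpt (s t)).
  by have [_ _ ss] := se i; exact: smooth_secdiff Uc ss.
have dai i : differentiable (a i : R^o -> R^o) t by apply/derivable1_diffP/da.
have [ds cE] := covd_frame mc de dai.
have sE' : \forall u \near (t : R^o), \sum_i a i u *: e i (bpt (s u)) = vec (s u).
  by apply: filterS sE => u ->.
split=> //; first exact: sdiff_near sE' ds.
rewrite -(covd_near _ _ sE') cE P_sum -[RHS]S0; apply: eq_bigr => i _.
rewrite P_lin PE; last by have [_ + _] := se i; apply.
by rewrite /D nablaE velocityE derive1E dvE -[a i t *: nab _ _ _ _]addr0 P_lin P0 addr0.
Qed.

(** A local frame exists by hypothesis; the coefficients of [s] in it are recovered through the Gram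
    matrix, which makes them differentiable as the definition of [parallel_along] demands. *)
Lemma covd_parallel_along (J : set R) (s : R -> tot N E) : is_subbundle f E ->
  open J -> is_interval J -> smooth_curve J (bpt \o s) ->
  (forall t, J t ->
    sdiff (fun u : R^o => f (bpt (s u))) (fun u => vec (s u)) t /\
    P (bpt (s t)) (covd (fun u : R^o => f (bpt (s u))) t 1 (fun u => vec (s u))) = 0) ->
  parallel_along f E D J s.
Proof.
move=> sE oJ iJ sc H; split=> // t Jt.
have [ds Ps] := H t Jt; have mc := smooth_curve_mdiff sc Jt.
have [U [r [e [Ut lf]]]] := sE (bpt (s t)); have [se oU Ee He] := lf.
have uG q : U q -> gram (f q) (e^~ q) \in unitmx by exact: local_frame_gram lf.
pose a i u := coef (f (bpt (s u))) (e^~ (bpt (s u))) (vec (s u)) 0 i.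
have Un : \forall u \near t, U (bpt (s u)).
  by apply: (sc.1 t Jt); apply: open_nbhs_nbhs.
have aE u : U (bpt (s u)) -> vec (s u) = \sum_i a i u *: e i (bpt (s u)).
  move=> Uu; have [b [bE _]] := He _ _ Uu (svalP (s u)).
  by rewrite {1}/vec bE; apply: eq_bigr => i _; rewrite /a {1}/vec bE coefK // uG.
have de i : secdiff f (e i) (bpt (s t)).
  by have [_ _ ss] := se i; exact: smooth_secdiff Ut ss.
have dai i : differentiable (a i : R^o -> R^o) t.
  refine (coef_differentiable i mc oU Ut _ ds uG).
  by move=> k; have [_ _] := se k.
exists U, r, e, a; split=> //.
- by apply: filterS Un => u /aE.
- by move=> i; apply/derivable1_diffP/dai.
have [_ cE] := covd_frame mc de dai.
have sE' : \forall u \near (t : R^o), \sum_i a i u *: e i (bpt (s u)) = vec (s u).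
  by apply: filterS Un => u /aE.
rewrite -[RHS]Ps -(covd_near _ _ sE') cE P_sum; apply: eq_bigr => i _.
rewrite P_lin PE; last by have [_ + _] := se i; apply.
by rewrite /D nablaE velocityE derive1E dvE -[a i t *: nab _ _ _ _]addr0 P_lin P0 addr0.
Qed.

End ParallelAlong.

Section ParallelFrame.
Variables (R : realType) (M : riemannian R).

(* a parallel frame [E] along [c]; [c] need not be a geodesic *)
Definition pframe (c : R^o -> M) (J : set R) (E : 'I_(dim M) -> R^o -> 'rV[R]_(dim M)) :=
  [/\ open J, is_interval J,
      forall t, J t -> mdiff c t /\ sdiff c (fun u => vel c u (1 : R^o)) t,
      forall t i, J t -> sdiff c (E i) t /\ covd c t 1 (E i) = 0 &
      forall t, J t -> rows (E^~ t) \in unitmx].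

Lemma rows_delta : rows (fun i : 'I_(dim M) => delta_mx 0 i) = 1%:M.
Proof. by apply/matrixP => i j; rewrite !mxE eqxx /= eq_sym. Qed.

Lemma gram_rows_unit (q : M) (b : 'I_(dim M) -> 'rV[R]_(dim M)) :
  (gram q b \in unitmx) = (rows b \in unitmx).
Proof. by rewrite -!row_free_unit /row_free rank_gram. Qed.

(** The standard basis is transported along the chart segment. Inner products of parallel fields are
    constant, so the Gram matrix stays invertible and the fields remain a basis. *)
Lemma ball_frame (p : M) x0 rad u0 u1 : ball x0 rad `<=` cim p ->
  ball x0 rad u0 -> ball x0 rad u1 -> exists (c : R^o -> M) (J : set R) E (a b : R),
    [/\ pframe c J E, smooth_curve J c, a < 0 /\ 1 < b,
        forall t, a <= t <= b -> J t &
        c 0 = chartV p u0 /\ c 1 = chartV p u1].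
Proof.
move=> sub b0 b1; have [eta eta0 segb] := seg_ball b0 b1.
pose c := ccurve p (seg u0 u1).
pose U : set R^o := seg u0 u1 @^-1` cim p.
have sd t : differentiable (seg u0 u1) t by exact: seg_differentiable.
have oU : open U.
  apply: open_comp; last exact: chart_image_open.
  by move=> t _; exact: differentiable_continuous.
have sU : Cinfty U (seg u0 u1) by exact: seg_smooth.
have Jc t : - eta <= t <= 1 + eta -> cim p (seg u0 u1 t) by move=> /segb/sub.
pose J : set R := `]- eta, 1 + eta[%classic.
have JE t : J t = (- eta < t < 1 + eta) by rewrite /J /= in_itv.
have JU t : J t -> cim p (seg u0 u1 t).
  by rewrite JE => /andP[? ?]; apply: Jc; rewrite !ltW.
have eta1 : - eta < 0 < 1 + eta by rewrite oppr_lt0 eta0 addr_gt0.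
have tr e := ccurve_transport e oU sU (fun=> id) eta1 Jc.
pose E (i : 'I_(dim M)) := sval (cid (tr (delta_mx 0 i))).
have E0 i : E i 0 = delta_mx 0 i by have [] := svalP (cid (tr (delta_mx 0 i))).
have EP t i : J t -> sdiff c (E i) t /\ covd c t 1 (E i) = 0.
  by rewrite JE; have [_] := svalP (cid (tr (delta_mx 0 i))); exact.
have mc t : J t -> mdiff c t by move=> /JU ct; exact: ccurve_mdiff.
(* Halving [eta] puts a closed interval around [[0, 1]] inside the open [J], as is needed to solve
   linear systems with coefficients known on [J] only. *)
exists c, J, E, (- (eta / 2)), (1 + eta / 2); split=> //.
- split=> //.
  + exact: interval_is_interval.
  + move=> t Jt; split; first exact: mc.
    have ct := JU t Jt.
    apply: (@sdiff_near _ _ _ _ (csec p (seg u0 u1) (fun=> u1 - u0))).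
      apply: filterS (near_ccurve (sd t) ct) => u cu.
      rewrite /csec -(dv_seg u0 u1 u) -(ccurve_vel (sd u) cu) jacK //.
      exact: ccurve_dom.
    exact: csec_sdiff.
  + move=> t Jt; rewrite -(gram_rows_unit (c t)).
    suff -> : gram (c t) (E^~ t) = gram (c 0) (E^~ 0).
      rewrite gram_rows_unit (_ : rows _ = 1%:M) ?unitmx1 // -rows_delta.
      by congr rows; apply/funext.
    apply/matrixP => i j; rewrite !mxE.
    apply: (@inner_const _ _ c J _ mc) => // [|u Ju]; first exact: interval_is_interval.
    have [di ci] := EP u i Ju; have [dj cj] := EP u j Ju; split=> //.
    by rewrite ci cj /inner inner_of0l inner_of0r addr0.
- split=> [t /mc[] //|q].
  have oJ : open (J `&` c @^-1` dom q : set R^o).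
    rewrite openE => t [Jt qt]; apply: filterI.
      by apply: open_nbhs_nbhs; split=> //; exact: interval_open.
    by have [cc _] := mc t Jt; exact: near_dom cc qt.
  have sJ : Cinfty (J `&` c @^-1` dom q) (seg u0 u1).
    by apply: Cinfty_sub sU => t [/JU].
  refine (Cinfty_comp_row oJ (@overlap_open _ _ p q) _ sJ (@transition_smooth _ _ p q)).
  by move=> t [/JU/chart_imP[pc cE] qc]; exists (c t).
- by rewrite oppr_lt0 ltrDl divr_gt0.
- by move=> t /andP[? ?]; rewrite JE; apply/andP; split; lra.
- rewrite /c /ccurve /seg scale0r addr0 scale1r; split=> //.
  by rewrite addrC subrK.
Qed.

End ParallelFrame.

(** * The first normal bundle, the osculating bundle and the normal connection *)

Section NormalSpans.
Variables (R : realType) (M N : riemannian R) (f : M -> N).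
Hypothesis f_imm : isometric_immersion f.
Hypothesis f_par : parallel_immersion f.
Implicit Types (p q : M).
Let sf : smooth f. Proof. by case: f_imm. Qed.
Let gf q : gdiff f q. Proof. exact: imm_gdiff. Qed.
#[local] Hint Resolve gf : core.
Notation n := (dim M).

Lemma inner_npart q w u : normal f q u -> inner (f q) w u = inner (f q) (npart f q w) u.
Proof.
move=> /normalP nu; rewrite /npart /inner inner_ofDl inner_ofNl.
by rewrite -/(inner (f q) (tm f q _) u) nu subr0.
Qed.

(** Against a normal vector only the normal part of a derivative counts, so vanishing normal
    derivatives suffice although the full covariant derivatives may be nonzero. *)
Lemma normal_const (c : R^o -> M) (J : set R) s s' : is_interval J ->
  (forall t, J t -> mdiff c t) ->
  (forall t, J t -> [/\ normal f (c t) (s t), normal f (c t) (s' t),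
     sdiff (fun u => f (c u)) s t /\ sdiff (fun u => f (c u)) s' t &
     npart f (c t) (covd (fun u => f (c u)) t 1 s) = 0 /\
     npart f (c t) (covd (fun u => f (c u)) t 1 s') = 0]) ->
  forall t u, J t -> J u ->
    inner (f (c t)) (s t) (s' t) = inner (f (c u)) (s u) (s' u).
Proof.
move=> iJ mc H.
apply: (@inner_const _ _ (fun u => f (c u)) J iJ) => t Jt; first exact: mdiff_imm (mc t Jt).
have [ns ns' [ds ds'] [cs cs']] := H t Jt; split=> //.
rewrite inner_npart // cs [X in _ + X]metricC [X in _ + X]inner_npart // cs'.
by rewrite /inner !inner_of0l addr0.
Qed.

Lemma frame_hh c J E : pframe c J E -> forall t i j, J t ->
  sdiff (fun u => f (c u)) (fun u => hh f (c u) (E i u) (E j u)) t /\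
  npart f (c t) (covd (fun u => f (c u)) t 1 (fun u => hh f (c u) (E i u) (E j u))) = 0.
Proof.
move=> [_ _ mc dE _] t i j Jt; have [mct _] := mc t Jt.
have [di ci] := dE t i Jt; have [dj cj] := dE t j Jt.
have [ds ->] := covd_hh f_imm f_par (1 : R^o) mct di dj.
by split=> //; rewrite ci cj hh0l // hh0r // addr0.
Qed.

Lemma frame_hh_const c J E : pframe c J E -> forall i j k l t u, J t -> J u ->
  inner (f (c t)) (hh f (c t) (E i t) (E j t)) (hh f (c t) (E k t) (E l t)) =
  inner (f (c u)) (hh f (c u) (E i u) (E j u)) (hh f (c u) (E k u) (E l u)).
Proof.
move=> fr i j k l; have [_ iJ mc _ _] := fr.
apply: (@normal_const c J (fun u => hh f (c u) (E i u) (E j u))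
  (fun u => hh f (c u) (E k u) (E l u)) iJ).
  by move=> t /mc[].
move=> t Jt; have [d1 c1] := frame_hh fr i j Jt; have [d2 c2] := frame_hh fr k l Jt.
exact: And4 (normal_hh f_imm _ _ _) (normal_hh f_imm _ _ _) (conj d1 d2) (conj c1 c2).
Qed.

Notation L := #|{: 'I_n * 'I_n}|.
Definition hrow q (b : 'I_n -> 'rV[R]_n) (k : 'I_L) : 'rV[R]_(dim N) :=
  hh f q (b (enum_val k).1) (b (enum_val k).2).

Lemma normal1_hh q x y : normal1 f q (hh f q x y).
Proof.
exists 1%N, (fun=> 1), (fun=> x), (fun=> y).
by rewrite big_ord_recl big_ord0 addr0 scale1r hE.
Qed.

Lemma rows_span (b : 'I_n -> 'rV[R]_n) x : rows b \in unitmx ->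
  exists a : 'rV[R]_n, x = \sum_i a 0 i *: b i.
Proof. by move=> ub; exists (x *m invmx (rows b)); rewrite -mul_rows mulmxKV. Qed.

Lemma normal1P q b v : rows b \in unitmx -> normal1 f q v <-> (v <= rows (hrow q b))%MS.
Proof.
move=> ub; split=> [[r [a [x [y ->]]]]|/submxP[a ->]]; last first.
  rewrite mul_rows; exists _, (a 0), (fun k => b (enum_val k).1), (fun k => b (enum_val k).2).
  by apply: eq_bigr => k _; rewrite hE.
apply: summx_sub => k _; apply: scalemx_sub; rewrite hE.
have [a' ->] := rows_span (x k) ub; have [b' ->] := rows_span (y k) ub.
rewrite hh_suml //; apply: summx_sub => i _; rewrite hh_sumr //; apply: summx_sub => j _.
rewrite hhZl // hhZr //; do 2!apply: scalemx_sub.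
have := row_sub (enum_rank (i, j)) (rows (hrow q b)).
by rewrite rowK /hrow enum_rankK.
Qed.

Lemma rank_hrow q b b' : rows b \in unitmx -> rows b' \in unitmx ->
  \rank (rows (hrow q b)) = \rank (rows (hrow q b')).
Proof.
move=> ub ub'; suff /eqmxP -> : (rows (hrow q b) == rows (hrow q b'))%MS by [].
by apply/andP; split; apply/row_subP => k; apply/(normal1P _ _ _); rewrite // rowK;
   exact: normal1_hh.
Qed.

Lemma rank_hrow_ball p x0 rad u0 u1 b b' : ball x0 rad `<=` cim p ->
  ball x0 rad u0 -> ball x0 rad u1 -> rows b \in unitmx -> rows b' \in unitmx ->
  \rank (rows (hrow (chartV p u0) b)) = \rank (rows (hrow (chartV p u1) b')).
Proof.
move=> sub b0 b1 ub ub'; have [c [J [E [x [y [fr _ [x0' y1] Jxy [<- <-]]]]]]] := ball_frame sub b0 b1.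
have J0 : J 0 by apply: Jxy; rewrite !ltW // (lt_trans _ y1).
have J1 : J 1 by apply: Jxy; rewrite !ltW // (lt_trans x0').
have [_ _ _ _ uE] := fr.
rewrite (rank_hrow _ ub (uE 0 J0)) (rank_hrow _ ub' (uE 1 J1)).
rewrite -(rank_gram (f (c 0))) -(rank_gram (f (c 1))); congr mxrank; apply/matrixP => i j; rewrite !mxE.
exact: (frame_hh_const fr).
Qed.

Lemma cfield_unit p q : dom p q -> rows (fun i : 'I_n => cfield p (delta_mx 0 i) q) \in unitmx.
Proof.
move=> pq; rewrite -(gram_rows_unit q); apply: gram_unit => a.
have -> : \sum_i a 0 i *: cfield p (delta_mx 0 i) q = jac p q q (\sum_i a 0 i *: delta_mx 0 i).
  by rewrite jac_sum //; apply: eq_bigr => i _; rewrite jacZ.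
rewrite -row_sum_delta => a0; by rewrite -(jacK pq (dom_self q) a) a0 jac0.
Qed.

Lemma chart_ball p : exists2 rad : R, 0 < rad & ball (chart p p) rad `<=` cim p.
Proof.
have : nbhs (chart p p) (cim p).
  by apply: open_nbhs_nbhs; split; [exact: chart_image_open|exists p].
by move=> /nbhs_ballP[rad r0 H]; exists rad.
Qed.

(** The frame is selected among the sections [Hsec], because their normal derivatives are known from
    parallelism. *)
Lemma normal1_frame p : exists U r (a b : 'I_r -> 'rV[R]_n), [/\ U `<=` dom p, U p &
  local_frame f (normal1 f) U (fun i => Hsec f p (a i) (b i))].
Proof.
have [rad r0 sub] := chart_ball p.
pose U : set M := dom p `&` chart p @^-1` ball (chart p p) rad.
have oU : open U.
  rewrite openE => q [pq bq]; apply: vdom_nbhs pq _.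
  by apply: open_nbhs_nbhs; split=> //; exact: ball_open.
have Up : U p by split=> //; exact: ballxx.
pose e i : 'rV[R]_n := delta_mx 0 i.
pose s (k : 'I_L) := Hsec f p (e (enum_val k).1) (e (enum_val k).2).
have sE q : s^~ q = hrow q (fun i => cfield p (e i) q) by [].
have [|q v [pq _]|q [pq bq]|U' [r [g [UU Up' lf]]]] :=
    @const_rank_frame _ _ _ f sf (normal1 f) U L s p oU Up.
- by move=> k; apply: smooth_sec_sub (Hsec_smooth f_imm _ _ _) => q [].
- by rewrite sE; apply: normal1P; exact: cfield_unit.
- have H := @rank_hrow_ball p (chart p p) rad _ _ _ _ sub bq (ballxx _ r0)
    (cfield_unit pq) (cfield_unit (dom_self p)).
  by move: H; rewrite !chartKd.
by exists U', r, (fun i => e (enum_val (g i)).1), (fun i => e (enum_val (g i)).2); split=> // q /UU[].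
Qed.

Lemma normal1_normal q v : normal1 f q v -> normal f q v.
Proof.
move=> [r [a [x [y ->]]]]; apply: (big_ind (normal f q)).
- by apply/normalP => z; rewrite /inner inner_of0r.
- by move=> u w; have := @normalPlin _ _ _ f q 1 u w; rewrite scale1r.
- move=> i _; have := @normalPlin _ _ _ f q (a i) (h f q (x i) (y i)) 0.
  rewrite addr0; apply; first by rewrite hE; exact: normal_hh.
  by apply/normalP => z; rewrite /inner inner_of0r.
Qed.

Let unit_delta : rows (fun i : 'I_n => delta_mx 0 i) \in unitmx.
Proof. by rewrite rows_delta unitmx1. Qed.

Lemma normal1_lin q a u v : normal1 f q u -> normal1 f q v -> normal1 f q (a *: u + v).
Proof.
move=> /(normal1P _ _ unit_delta) nu /(normal1P _ _ unit_delta) nv.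
by apply/(normal1P _ _ unit_delta); rewrite addmx_sub // scalemx_sub.
Qed.

Lemma normal1_0 q : normal1 f q 0.
Proof. by apply/(normal1P _ _ unit_delta); exact: sub0mx. Qed.

Lemma normal1_sum q I l (P : pred I) (v : I -> 'rV_(dim N)) :
  (forall i, P i -> normal1 f q (v i)) -> normal1 f q (\sum_(i <- l | P i) v i).
Proof.
move=> H; apply: big_ind => //; first exact: normal1_0.
by move=> u w nu nw; rewrite -[u]scale1r; exact: normal1_lin.
Qed.

Lemma normal1_subbundle : is_subbundle f (normal1 f).
Proof. move=> p; have [U [r [a [b [_ Up lf]]]]] := normal1_frame p; exists U, r.
by exists (fun i => Hsec f p (a i) (b i)). Qed.

Lemma tangD q u v : tang f q (u + v) = tang f q u + tang f q v.
Proof. by have := tangPl f_imm q 1 u v; rewrite !scale1r. Qed.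

Lemma oscP q v : osc f q v <-> exists x xi, normal1 f q xi /\ v = tm f q x + xi.
Proof.
by split=> [] [x [xi [nxi vE]]]; exists x, xi; split=> //; rewrite vE tmapE.
Qed.

(** The frame joins the pushed-forward coordinate fields to a frame of the first normal bundle;
    uniqueness of coefficients follows by taking tangential and normal parts separately. *)
Lemma osc_subbundle : is_subbundle f (osc f).
Proof.
move=> p; have [U [r [a [b [Ud Up [sH oU Hs Hu]]]]]] := normal1_frame p.
pose e i : 'rV[R]_n := delta_mx 0 i; pose H k := Hsec f p (a k) (b k).
pose F (k : 'I_(n + r)) q := match fintype.split k with
  inl i => tm f q (cfield p (e i) q) | inr j => H j q end.
have FE (x : 'rV[R]_(n + r)) q : U q -> \sum_k x 0 k *: F k q =
    tm f q (\sum_i lsubmx x 0 i *: cfield p (e i) q) + \sum_j rsubmx x 0 j *: H j q.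
  move=> Uq; rewrite big_split_ord /= tm_sum //; congr (_ + _); apply: eq_bigr => i _.
    by rewrite /F (unsplitK (inl i)) tmZ // mxE.
  by rewrite /F (unsplitK (inr i)) mxE.
exists U, (n + r)%N, F; split=> //; split=> //.
- move=> k; rewrite /F; case: fintype.split => i.
    split=> //.
      move=> q Uq; apply/oscP; exists (cfield p (e i) q), 0; rewrite addr0; split=> //.
      exact: normal1_0.
    by apply: tm_smooth => //; apply: smooth_sec_sub (coord_smooth p (e i)) => q /Ud.
  have [_ Hn ss] := sH i; split=> // q Uq; apply/oscP; exists 0, (H i q); rewrite tm0 // add0r.
  by split=> //; exact: Hn.
- move=> q x Uq; rewrite FE //; apply/oscP; exists (\sum_i lsubmx x 0 i *: cfield p (e i) q).
  exists (\sum_j rsubmx x 0 j *: H j q); split=> //; exact: Hs.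
- move=> q v Uq /oscP[x [xi [nxi ->]]].
  have uc := cfield_unit (Ud _ Uq); have [y xE] := rows_span x uc.
  have [z [zE zu]] := Hu q xi Uq nxi.
  exists (row_mx y z); split; first by rewrite FE // row_mxKl row_mxKr -xE -zE.
  move=> w; rewrite FE // => wE.
  have nH (u : 'rV[R]_r) : normal f q (\sum_j u 0 j *: H j q) by apply: normal1_normal; exact: Hs.
  rewrite -[w]hsubmxK; congr row_mx.
    have := congr1 (tang f q) wE; rewrite !tangD !tang_tm // !tang_normal //; last first.
      exact: normal1_normal.
    rewrite !addr0 xE => /(congr1 (coef q (fun i => cfield p (e i) q))).
    by rewrite !coefK // gram_rows_unit.
  apply: zu; have := congr1 (npart f q) wE; rewrite !npartD // !npart_tm // !add0r.
  by rewrite !npart_id //; exact: normal1_normal.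
Qed.

Lemma nabD p v s s' : secdiff f s p -> secdiff f s' p ->
  nab f p v (fun q => s q + s' q) = nab f p v s + nab f p v s'.
Proof. by move=> ds ds'; rewrite /nab covdD //; have [] := gf p. Qed.

Lemma nab_frame p v r (e : 'I_r -> M -> 'rV[R]_(dim N)) (k : 'I_r -> M -> R) :
  (forall i, secdiff f (e i) p) ->
  (forall i, differentiable (fun z => k i (chartV p z) : R^o) (chart p p)) ->
  nab f p v (fun q => \sum_i k i q *: e i q) =
  \sum_i (dv v (fun z => k i (chartV p z) : R^o) (chart p p) *: e i p
           + k i p *: nab f p v (e i)).
Proof.
move=> de dk; have [_ mf] := gf p.
have ds i : secdiff f (fun q => k i q *: e i q) p by exact: sdiff_scale (dk i) (de i).
rewrite /nab covd_sum //; apply: eq_bigr => i _.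
exact: nab_scale (dk i) (de i).
Qed.

(** In a frame of sections [Hsec], the derivative of a section consists of multiples of the frame
    and of normal derivatives of its members; parallelism turns the latter into values of h
    again. *)
Lemma nabla_normal_normal1 U p v s : section_over f (normal1 f) U s -> U p ->
  normal1 f p (nabla_normal f p v s).
Proof.
move=> [oU ns ss] Up; rewrite /nabla_normal normal_partE // nablaE.
have [U' [r [a [b [Ud Up' lf]]]]] := normal1_frame p.
have [sH oU' _ Hu] := lf.
have uG q : U' q -> gram (f q) ((fun i => Hsec f p (a i) (b i))^~ q) \in unitmx.
  by exact: local_frame_gram lf.
pose V := U `&` U'; have oV : open V by exact: openI.
have Vp : V p by [].
pose k i q := coef (f q) (fun i => Hsec f p (a i) (b i) q) (s q) 0 i.
have sk i : smooth_fun V (k i).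
  have sHV j : smooth_sec f V (Hsec f p (a j) (b j)).
    by have [_ _] := sH j; apply: smooth_sec_sub => q [].
  have ssV : smooth_sec f V s by apply: smooth_sec_sub ss => q [].
  by refine (@coef_smooth _ _ _ f sf V r _ s oV sHV ssV _ i) => q [_ /uG].
rewrite (@nab_local _ _ _ f p v s (fun q => \sum_i k i q *: Hsec f p (a i) (b i) q) V) //.
  rewrite nab_frame.
  - rewrite npart_sum //; apply: normal1_sum => i _; rewrite npartP // npart_id //; last first.
      by apply: normal1_normal; exact: normal1_hh.
    apply: normal1_lin; first exact: normal1_hh.
    rewrite npartZ // parallel_coord // -[_ *: _]addr0; apply: normal1_lin.
      by rewrite -[hh f p _ _]scale1r; apply: normal1_lin; exact: normal1_hh.
    exact: normal1_0.
  - by move=> i; exact: Hsec_secdiff.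
  - by move=> i; apply: (Cinfty_differentiable (sk i p)); exists p.
move=> q [Uq Uq']; have [c [cE _]] := Hu q _ Uq' (ns q Uq).
by rewrite {1}cE; apply: eq_bigr => i _; rewrite /k cE coefK // uG.
Qed.

Lemma normal_connection : is_connection f (normal1 f) (nabla_normal f).
Proof.
have nE p v s : nabla_normal f p v s = npart f p (nab f p v s).
  by rewrite /nabla_normal normal_partE // nablaE.
split.
- by move=> U p v s sE Up; exact: nabla_normal_normal1 sE Up.
- move=> U p a v w s [oU _ ss] Up; rewrite !nE nabP //; last exact: smooth_secdiff Up ss.
  by rewrite npartP.
- move=> U p v s s' [oU _ ss] [_ _ ss'] Up.
  by rewrite !nE nabD ?npartD //; exact: smooth_secdiff Up _.
- move=> U p v s phi [oU ns ss] sphi Up.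
  have dphi : differentiable (fun z => phi (chartV p z) : R^o) (chart p p).
    by apply: (Cinfty_differentiable (sphi p)); exists p.
  rewrite !nE nab_scale //; last exact: smooth_secdiff Up ss.
  by rewrite npartP // npartZ // npart_id ?dvE //; apply: normal1_normal; exact: ns.
split.
- by move=> U p v s s' [oU _ _] _ Up E; rewrite !nE; congr npart; exact: nab_local E.
- move=> U X s [oU ns ss] sX.
  have -> : (fun q => nabla_normal f q (X q) s) = (fun q => npart f q (nab f q (X q) s)).
    by apply/funext => q; rewrite nE.
  exact: (npart_smooth f_imm oU (nab_smooth f_imm oU sX ss)).
Qed.

End NormalSpans.

(** * Rigidity of parallel bundle maps *)

Section FibreMaps.
Variables (R : realType) (M N : riemannian R) (f : M -> N).
Variable E : M -> set 'rV[R]_(dim N).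
Implicit Types (Phi : tot N E -> tot N E) (q : M).

Definition mktot q v (Ev : E q v) : tot N E := exist _ (q, v) Ev.

Lemma totP (e : tot N E) : E (bpt e) (vec e).
Proof. exact: (svalP e). Qed.

Lemma mktotK e (Ev : E (bpt e) (vec e)) : mktot Ev = e.
Proof. by case: e Ev => [[q v] H] /= Ev; congr exist; exact: Prop_irrelevance. Qed.

Lemma tot_eq (e e' : tot N E) : bpt e = bpt e' -> vec e = vec e' -> e = e'.
Proof.
case: e e' => [[q v] H] [[q' v'] H']; rewrite /bpt /vec /= => qq vv.
by subst q' v'; congr exist; exact: Prop_irrelevance.
Qed.

(** The fibre map of [Phi] on bare vectors, extended by [0] outside the fibre, so that linear
    algebra can be done without carrying membership proofs. *)
Definition fib Phi q v : 'rV[R]_(dim N) :=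
  if pselect (E q v) is left Ev then vec (Phi (mktot Ev)) else 0.

Lemma fibE Phi e : vec (Phi e) = fib Phi (bpt e) (vec e).
Proof.
rewrite /fib; case: pselect => [Ev|]; first by rewrite mktotK.
by case; exact: (svalP e).
Qed.

Lemma fib_mktot Phi q v (Ev : E q v) : fib Phi q v = vec (Phi (mktot Ev)).
Proof. by rewrite fibE. Qed.

Hypothesis E0 : forall q, E q 0.
Hypothesis E_lin : forall q a u v, E q u -> E q v -> E q (a *: u + v).

Section Linear.
Variables (sigma : M -> M) (Phi : tot N E -> tot N E).
Hypothesis Phi_hom : bundle_hom f E sigma Phi.

Lemma fib_lin q a u v : E q u -> E q v ->
  fib Phi q (a *: u + v) = a *: fib Phi q u + fib Phi q v.
Proof.
move=> Eu Ev; have Euv := E_lin a Eu Ev; have [_ L _] := Phi_hom.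
rewrite (fib_mktot Phi Eu) (fib_mktot Phi Ev) (fib_mktot Phi Euv).
by apply: L.
Qed.

Lemma fib0 q : fib Phi q 0 = 0.
Proof.
have := fib_lin (-1) (E0 q) (E0 q); rewrite scaler0 addr0 scaleN1r => {1}->.
by rewrite addNr.
Qed.

Lemma fib_sum q I l (P : pred I) (a : I -> R) (v : I -> 'rV_(dim N)) :
  (forall i, E q (v i)) ->
  E q (\sum_(i <- l | P i) a i *: v i) /\
  fib Phi q (\sum_(i <- l | P i) a i *: v i) = \sum_(i <- l | P i) a i *: fib Phi q (v i).
Proof.
move=> Ev; elim: l => [|i l [IE IH]]; first by rewrite !big_nil fib0.
rewrite !big_cons; case: ifP => // _; split; first exact: E_lin.
by rewrite fib_lin // IH.
Qed.

Lemma bpt_hom e : bpt (Phi e) = sigma (bpt e).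
Proof. by have [+ _ _] := Phi_hom; apply. Qed.

Lemma fib_smooth U s : section_over f E U s ->
  smooth_sec (f \o sigma) U (fun q => fib Phi q (s q)).
Proof.
move=> sE; have [_ _ S] := Phi_hom.
by apply: (S U s _ sE) => e Ue ve; rewrite fibE ve.
Qed.

Lemma fib_isometric q u v : fibre_isometric f Phi -> E q u -> E q v ->
  inner (f (sigma q)) (fib Phi q u) (fib Phi q v) = inner (f q) u v.
Proof.
move=> iP Eu Ev; rewrite (fib_mktot Phi Eu) (fib_mktot Phi Ev).
by have := iP (mktot Eu) (mktot Ev) erefl; rewrite bpt_hom.
Qed.

End Linear.
End FibreMaps.

(** * The linear system for parallel sections in the generators *)

Section FrameSystem.
Variables (R : realType) (M N : riemannian R) (f : M -> N).
Hypothesis f_imm : isometric_immersion f.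
Hypothesis f_par : parallel_immersion f.
Implicit Types (p q : M).
Let sf : smooth f. Proof. by case: f_imm. Qed.
Let gf q : gdiff f q. Proof. exact: imm_gdiff. Qed.
#[local] Hint Resolve gf : core.
Notation n := (dim M).
Notation I := ('I_n + 'I_n * 'I_n)%type.

Definition vgen q (b : 'I_n -> 'rV[R]_n) (i : I) : 'rV[R]_(dim N) :=
  match i with inl k => tm f q (b k) | inr kl => hh f q (b kl.1) (b kl.2) end.

(** The components in the basis [b] of [- A (b m)], where [A] is the shape operator of the normal
    vector [h(b i, b j)]. *)
Definition shp q (b : 'I_n -> 'rV[R]_n) i j m : 'rV[R]_n :=
  - (\row_l inner (f q) (hh f q (b i) (b j)) (hh f q (b m) (b l))) *m invmx (gram q b).

(* [sysB] is the matrix of the connection in the generators [vgen] of the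
   osculating bundle built from a parallel frame; [gam] is the velocity of the
   curve and [T] the shape operator in that frame. *)
Definition sysB (gam : 'rV[R]_n) (T : 'I_n -> 'I_n -> 'I_n -> 'rV[R]_n) (i j : I) : R :=
  match i, j with
  | inl k, inr ml => if k == ml.2 then gam 0 ml.1 else 0
  | inr kl, inl l' => \sum_m gam 0 m * T kl.1 kl.2 m 0 l'
  | _, _ => 0
  end.

Lemma coef_span q (b : 'I_n -> 'rV[R]_n) x : rows b \in unitmx ->
  \sum_i coef q b x 0 i *: b i = x.
Proof.
move=> ub; have [a ->] := rows_span x ub.
by rewrite coefK // gram_rows_unit.
Qed.

(** For a parallel field [E k], the derivative of df(E_k) is purely normal by the Gauss formula.
    That of h(E_k, E_l) is purely tangential by parallelism, and Weingarten's equation gives its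
    components. *)
Lemma frame_system c J E t i : pframe c J E -> J t ->
  sdiff (fun u => f (c u)) (fun u => vgen (c u) (E^~ u) i) t /\
  covd (fun u => f (c u)) t 1 (fun u => vgen (c u) (E^~ u) i) =
  \sum_j sysB (coef (c t) (E^~ t) (vel c t (1 : R^o))) (shp (c t) (E^~ t)) i j
         *: vgen (c t) (E^~ t) j.
Proof.
move=> fr Jt; have [oJ iJ mc dE uE] := fr; have [mct _] := mc t Jt.
set gam := coef _ _ _.
have velE : vel c t (1 : R^o) = \sum_m gam 0 m *: E m t by rewrite coef_span // uE.
have tmE l : sdiff (fun u => f (c u)) (fun u => tm f (c u) (E l u)) t /\
    covd (fun u => f (c u)) t 1 (fun u => tm f (c u) (E l u)) =
    \sum_m gam 0 m *: hh f (c t) (E m t) (E l t).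
  have [dl cl] := dE t l Jt; split; first exact: sdiff_tm.
  rewrite (gauss f_imm (1 : R^o) mct dl) cl tm0 // add0r velE hh_suml //.
  by apply: eq_bigr => m _; rewrite hhZl.
rewrite big_sumType /=; case: i => [k|[k l]] /=.
  have [dk ->] := tmE k; split=> //.
  rewrite [X in _ = X + _]big1 ?add0r => [|j _]; last by rewrite scale0r.
  rewrite -(pair_bigA _ (fun m l => (if k == l then gam 0 m else 0) *: hh f (c t) (E m t) (E l t))) /=.
  apply: eq_bigr => m _; rewrite (bigD1 k) //= eqxx big1 ?addr0 // => l /negPf lk.
  by rewrite eq_sym lk scale0r.
have [dkl nkl] := frame_hh f_imm f_par fr k l Jt; split=> //.
rewrite [X in _ + X]big1 ?addr0 => [|j _]; last by rewrite scale0r.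
set w := covd _ _ _ _ in nkl *.
have -> : w = tm f (c t) (tang f (c t) w).
  by apply/eqP; rewrite -subr_eq0; move/eqP: nkl.
rewrite -[tang _ _ _](coef_span (c t) _ (uE t Jt)) tm_sum //.
apply: eq_bigr => l' _; rewrite tmZ //; congr (_ *: _).
(* Differentiating the orthogonality of h(E_k, E_l) and df(E_m) moves the derivative onto df(E_m),
   where the Gauss formula is available. *)
have wE m : inner (f (c t)) w (tm f (c t) (E m t)) =
   - \sum_i gam 0 i * inner (f (c t)) (hh f (c t) (E k t) (E l t)) (hh f (c t) (E i t) (E m t)).
  have [dm cm] := tmE m; have mfc := mdiff_imm f_imm mct.
  have [_ H] := inner_along mfc dkl dm.
  have := H (1 : R^o); rewrite (_ : dv _ _ _ = 0); last first.
    rewrite -[RHS](dv_cst (1 : R^o) (0 : R^o) t); apply: dv_near.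
    by apply: filterS (filterT) => u _; rewrite metricC hh_normal.
  move=> /esym/eqP; rewrite addr_eq0 => /eqP ->; congr (- _).
  rewrite cm /inner inner_of_sumr; apply: eq_bigr => j _.
  by rewrite inner_ofZr.
have -> : coef (c t) (E^~ t) (tang f (c t) w) =
    \sum_m gam 0 m *: shp (c t) (E^~ t) k l m.
  rewrite /coef /shp; under [RHS]eq_bigr do rewrite scalemxAl.
  rewrite -mulmx_suml; congr (_ *m _); apply/rowP => m.
  rewrite mxE tangP // metricC wE summxE -sumrN; apply: eq_bigr => j _.
  by rewrite !mxE mulrN.
by rewrite summxE; apply: eq_bigr => m _; rewrite mxE.
Qed.

Lemma frame_gram_const (c : R^o -> M) J E t u : pframe c J E -> J t -> J u ->
  gram (c t) (E^~ t) = gram (c u) (E^~ u).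
Proof.
move=> [oJ iJ mc dE uE] Jt Ju; apply/matrixP => i j; rewrite !mxE.
have mc' s : J s -> mdiff c s by move=> /mc[].
apply: (@inner_const _ _ c J iJ mc') => // s Js.
have [di ci] := dE s i Js; have [dj cj] := dE s j Js; split=> //.
by rewrite ci cj /inner inner_of0l inner_of0r addr0.
Qed.

Lemma frame_shp_const (c : R^o -> M) J E t u : pframe c J E -> J t -> J u ->
  shp (c t) (E^~ t) = shp (c u) (E^~ u).
Proof.
move=> fr Jt Ju; apply/funext => i; apply/funext => j; apply/funext => m.
rewrite /shp (frame_gram_const fr Jt Ju); congr (- _ *m _); apply/rowP => l.
by rewrite !mxE; exact: (frame_hh_const f_imm f_par fr).
Qed.

Lemma frame_vel_coef (c : R^o -> M) J E t m : pframe c J E -> J t ->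
  differentiable (fun u : R^o => coef (c u) (E^~ u) (vel c u (1 : R^o)) 0 m : R^o) t.
Proof.
move=> fr Jt; have [oJ iJ mc dE uE] := fr.
have [mct dvel] := mc t Jt.
apply: (@differentiable_near _ _ _ (fun u : R^o => \sum_l
   inner (c u) (vel c u (1 : R^o)) (E l u) * invmx (gram (c t) (E^~ t)) l m : R^o)).
  have nJ : \forall u \near t, J u by apply: open_nbhs_nbhs.
  apply: filterS nJ => u Ju; rewrite mxE (frame_gram_const fr Ju Jt).
  by apply: eq_bigr => l _; rewrite mxE.
apply: differentiable_sumf => l _; apply: differentiable_mulf.
  by have [dl _] := dE t l Jt; have [] := inner_along mct dvel dl.
exact: differentiable_cst.
Qed.

(** The transposed system with the opposite sign: it is exactly what makes the combination of the
    generators with coefficients [y] parallel, whether or not the generators are independent. *)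
Definition solves c E a b (y : I -> R -> R) := forall t, a < t < b -> forall i,
  differentiable (y i : R^o -> R^o) t /\ dv (1 : R^o) (y i : R^o -> R^o) t =
   - \sum_j sysB (coef (c t) (E^~ t) (vel c t (1 : R^o))) (shp (c t) (E^~ t)) j i * y j t.

Lemma system_solution c J E a b (y0 : I -> R) : pframe c J E -> a < 0 < b ->
  (forall t, a <= t <= b -> J t) ->
  exists y : I -> R -> R, (forall i, y i 0 = y0 i) /\ solves c E a b y.
Proof.
move=> fr ab Jab; have J0 : J 0 by apply: Jab; have /andP[? ?] := ab; rewrite !ltW.
(* The shape components are frozen at time [0], which is legitimate as they are constant along the
   curve; only the velocity coefficients still depend on [t]. *)
pose A (i j : I) (t : R) : R :=
  - sysB (coef (c t) (E^~ t) (vel c t (1 : R^o))) (shp (c 0) (E^~ 0)) j i.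
have cA i j t : a <= t <= b -> {for t, continuous (A i j)}.
  move=> /Jab Jt; apply: continuousN.
  have cc m := @frame_vel_coef c J E t m fr Jt.
  suff : differentiable (fun u : R^o =>
      sysB (coef (c u) (E^~ u) (vel c u (1 : R^o))) (shp (c 0) (E^~ 0)) j i : R^o) t.
    exact: differentiable_continuous.
  case: j i => [k|[k l]] [i|[m j]] /=; try exact: differentiable_cst.
    by case: eqP => _; [exact: cc|exact: differentiable_cst].
  apply: differentiable_sumf => m _.
  by apply: differentiable_mulf; [exact: cc|exact: differentiable_cst].
have [y [yy0 dy]] := linear_ode_segment y0 ab cA.
exists y; split=> // t tab i; have [d1 d2] := dy i t tab.
have Jt : J t by apply: Jab; have /andP[? ?] := tab; rewrite !ltW.
split; first exact/derivable1_diffP.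
rewrite dvE d2 -sumrN; apply: eq_bigr => j _.
by rewrite /A (frame_shp_const fr Jt J0) mulNr.
Qed.

Lemma solution_parallel c J E a b y : pframe c J E -> (forall t, a < t < b -> J t) ->
  solves c E a b y -> forall t, a < t < b ->
  sdiff (fun u => f (c u)) (fun u => \sum_i y i u *: vgen (c u) (E^~ u) i) t /\
  covd (fun u => f (c u)) t 1 (fun u => \sum_i y i u *: vgen (c u) (E^~ u) i) = 0.
Proof.
move=> fr Jab sy t tab; have Jt := Jab t tab; have [_ _ mc _ _] := fr.
have [mct _] := mc t Jt; have mfc := mdiff_imm f_imm mct.
have ds i : sdiff (fun u => f (c u)) (fun u => y i u *: vgen (c u) (E^~ u) i) t.
  by apply: sdiff_scale => //; [have [] := sy t tab i|have [] := frame_system i fr Jt].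
split; first exact: sdiff_sum.
rewrite covd_sum // (eq_bigr (fun i => dv (1 : R^o) (y i : R^o -> R^o) t *: vgen (c t) (E^~ t) i +
    y i t *: covd (fun u => f (c u)) t 1 (fun u => vgen (c u) (E^~ u) i))); last first.
  move=> i _; apply: covd_scale => //; [by have [] := sy t tab i|].
  by have [] := frame_system i fr Jt.
rewrite big_split /= [X in _ + X](eq_bigr (fun i => \sum_j
   (y i t * sysB (coef (c t) (E^~ t) (vel c t (1 : R^o))) (shp (c t) (E^~ t)) i j)
     *: vgen (c t) (E^~ t) j)); last first.
  move=> i _; have [_ ->] := frame_system i fr Jt; rewrite scaler_sumr.
  by apply: eq_bigr => j _; rewrite scalerA.
rewrite exchange_big /= -big_split big1 //= => i _.
rewrite -scaler_suml -scalerDl; have [_ ->] := sy t tab i.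
rewrite (eq_bigr (fun j => y j t * sysB (coef (c t) (E^~ t) (vel c t (1 : R^o)))
   (shp (c t) (E^~ t)) j i)) ?addNr ?scale0r // => j _; exact: mulrC.
Qed.

End FrameSystem.

Section IsometryFrame.
Variables (R : realType) (M : riemannian R) (sigma : M -> M).
Hypothesis s_isom : isometry sigma.

Let s_imm := isometry_imm s_isom.

Lemma gram_isometry r q (b : 'I_r -> 'rV[R]_(dim M)) :
  gram (sigma q) (fun i => tm sigma q (b i)) = gram q b.
Proof. by apply/matrixP => i j; rewrite !mxE; exact: tm_isometric. Qed.

Lemma coef_isometry r q (b : 'I_r -> 'rV[R]_(dim M)) x :
  coef (sigma q) (fun i => tm sigma q (b i)) (tm sigma q x) = coef q b x.
Proof.
rewrite /coef gram_isometry; congr (_ *m _); apply/rowP => i; rewrite !mxE.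
exact: tm_isometric.
Qed.

Lemma isometry_frame c J E : pframe c J E ->
  pframe (fun t => sigma (c t)) J (fun i t => tm sigma (c t) (E i t)).
Proof.
move=> [oJ iJ mc dE uE]; split=> //.
- move=> t Jt; have [mct dv] := mc t Jt; split; first exact: mdiff_imm.
  have nJ : \forall u \near t, J u by apply: open_nbhs_nbhs.
  apply: (@sdiff_near _ _ _ _ (fun u : R^o => tm sigma (c u) (vel c u (1 : R^o)))).
    by apply: filterS nJ => u /mc[mcu _]; rewrite vel_imm.
  exact: sdiff_tm.
- move=> t i Jt; have [mct _] := mc t Jt; have [di ci] := dE t i Jt.
  split; first exact: sdiff_tm.
  by rewrite covd_isometry // ci tm0.
- by move=> t Jt; rewrite -(gram_rows_unit (sigma (c t))) gram_isometry gram_rows_unit uE.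
Qed.

End IsometryFrame.

Section Rigidity.
Variables (R : realType) (M N : riemannian R) (f : M -> N).
Hypothesis f_imm : isometric_immersion f.
Hypothesis f_par : parallel_immersion f.
Implicit Types (p q : M).
Let sf : smooth f. Proof. by case: f_imm. Qed.
Notation n := (dim M).
Notation I := ('I_n + 'I_n * 'I_n)%type.

Lemma osc_tm q x : osc f q (tm f q x).
Proof. by apply/oscP; exists x, 0; rewrite addr0; split=> //; exact: normal1_0. Qed.

Lemma osc_hh q x y : osc f q (hh f q x y).
Proof.
apply/oscP; exists 0, (hh f q x y); rewrite tm0 // add0r; split=> //.
exact: normal1_hh.
Qed.

Lemma osc_vgen q b i : osc f q (vgen f q b i).
Proof. by case: i => [k|[k l]]; [exact: osc_tm|exact: osc_hh]. Qed.

Lemma osc0 q : osc f q 0.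
Proof. by have := osc_tm q 0; rewrite tm0. Qed.

Lemma osc_lin q a u v : osc f q u -> osc f q v -> osc f q (a *: u + v).
Proof.
move=> /oscP[x [xi [nxi ->]]] /oscP[y [eta [neta ->]]]; apply/oscP.
exists (a *: x + y), (a *: xi + eta); split; first exact: normal1_lin.
by rewrite tmP ?scalerDr; [rewrite addrACA|exact: imm_gdiff].
Qed.

Variables (sigma : M -> M) (Phi : tot N (osc f) -> tot N (osc f)).
Hypothesis s_isom : isometry sigma.
Hypothesis Phi_hom : bundle_hom f (osc f) sigma Phi.
Hypothesis Phi_isom : fibre_isometric f Phi.
Hypothesis Phi_par : parallel_map f (osc f) (nabla f) Phi.
Notation fibre := (fib Phi).

(* [Phi] is the map induced by the differential of [sigma] in the fibre at [q]. *)
Definition natural_at q :=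
  (forall x, fibre q (tm f q x) = tm f (sigma q) (tm sigma q x)) /\
  (forall x y, fibre q (hh f q x y) = hh f (sigma q) (tm sigma q x) (tm sigma q y)).

Lemma natural_sum q b (y : I -> R) : natural_at q ->
  fibre q (\sum_i y i *: vgen f q b i) =
  \sum_i y i *: vgen f (sigma q) (fun k => tm sigma q (b k)) i.
Proof.
move=> [H1 H2]; have [_ ->] := fib_sum osc0 osc_lin Phi_hom (index_enum _) xpredT y (osc_vgen q b).
by apply: eq_bigr => -[k|[k l]] _ /=; rewrite ?H1 ?H2.
Qed.

(** Particular coefficients recover the two clauses: components of a vector on the tangential
    generators, and products [a k * a' l] on the values of h. *)
Lemma sum_natural q b : rows b \in unitmx -> (forall y : I -> R,
  fibre q (\sum_i y i *: vgen f q b i) =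
  \sum_i y i *: vgen f (sigma q) (fun k => tm sigma q (b k)) i) -> natural_at q.
Proof.
move=> ub H; have gs := imm_gdiff (isometry_imm s_isom) q.
have s_imm := isometry_imm s_isom.
split=> [x|x x'].
  have [a ->] := rows_span x ub.
  have := H (fun i => match i with inl k => a 0 k | inr _ => 0 end).
  rewrite !big_sumType /= [X in _ + X]big1 ?addr0 => [|i _]; last by rewrite scale0r.
  rewrite [X in _ = _ + X -> _]big1 ?addr0 => [|i _]; last by rewrite scale0r.
  under eq_bigr do rewrite -tmZ //; rewrite -tm_sum // => ->.
  under eq_bigr do rewrite -tmZ // -tmZ //.
  by rewrite -tm_sum // -tm_sum.
have [a ->] := rows_span x ub; have [a' ->] := rows_span x' ub.
have := H (fun i => match i with inl k => 0 | inr kl => a 0 kl.1 * a' 0 kl.2 end).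
rewrite !big_sumType /= [X in X + _]big1 ?add0r => [|i _]; last by rewrite scale0r.
rewrite [X in _ = X + _ -> _]big1 ?add0r => [|i _]; last by rewrite scale0r.
have E (g : M -> N) (g_imm : isometric_immersion g) r (c : 'I_n -> 'rV[R]_n) :
    \sum_(kl : 'I_n * 'I_n) (a 0 kl.1 * a' 0 kl.2) *: hh g r (c kl.1) (c kl.2) =
    hh g r (\sum_i a 0 i *: c i) (\sum_i a' 0 i *: c i).
  rewrite hh_suml // -(pair_bigA _ (fun k l => (a 0 k * a' 0 l) *: hh g r (c k) (c l))) /=.
  apply: eq_bigr => k _; rewrite hh_sumr //; apply: eq_bigr => l _.
  by rewrite hhZl // hhZr // scalerA.
have E1 := E f f_imm q b; have E2 := E f f_imm (sigma q) (fun k => tm sigma q (b k)).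
rewrite /= in E2; rewrite E1 E2 => ->; congr (hh f _ _ _); rewrite tm_sum //; apply: eq_bigr => i _; exact/esym/tmZ.
Qed.

Lemma natural_inner q x y x' y' : natural_at q ->
  inner (f (sigma q)) (hh f (sigma q) (tm sigma q x) (tm sigma q y))
    (hh f (sigma q) (tm sigma q x') (tm sigma q y')) =
  inner (f q) (hh f q x y) (hh f q x' y').
Proof. by move=> [_ H]; rewrite -!H (fib_isometric Phi_hom) //; exact: osc_hh. Qed.

Lemma natural_shp q b : natural_at q ->
  shp f (sigma q) (fun k => tm sigma q (b k)) = shp f q b.
Proof.
move=> nq; apply/funext => i; apply/funext => j; apply/funext => m.
rewrite /shp gram_isometry //; congr (- _ *m _); apply/rowP => l; rewrite !mxE.
exact: natural_inner.
Qed.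

(** Arbitrary coefficients [y0] at time [0] are continued to a solution [y], which solves the system
    of the image curve as well. So [Phi] applied to the parallel section [w], and the combination
    with the same [y] along the image curve, are both parallel. They agree at time [1] by naturality
    there, hence at time [0], and [y0] was arbitrary. *)
Lemma natural_step p x0 rad u0 u1 : ball x0 rad `<=` cim p ->
  ball x0 rad u0 -> ball x0 rad u1 ->
  natural_at (chartV p u1) -> natural_at (chartV p u0).
Proof.
move=> sub b0 b1; have [c [J [E [a [b [fr sc [a0 b1'] Jab [<- <-]]]]]]] := ball_frame sub b0 b1.
move=> n1; have ab : a < 0 < b by rewrite a0 (lt_trans ltr01).
have Jab' t : a < t < b -> J t by move=> /andP[? ?]; apply: Jab; rewrite !ltW.
have J0 : J 0 by apply: Jab'.
have J1 : J 1 by apply: Jab'; rewrite b1' (lt_trans a0).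
have fr' := isometry_frame s_isom fr; have [oJ iJ mc _ uE] := fr.
apply: (sum_natural (uE 0 J0)) => y0.
have [y [y00 sy]] := system_solution f_imm f_par y0 fr ab Jab.
have sy' : solves f (fun t => sigma (c t)) (fun i t => tm sigma (c t) (E i t)) a b y.
  move=> t tab i; have [dy ->] := sy t tab i; split=> //.
  have Jt := Jab' t tab; have [mct _] := mc t Jt.
  (* The shape components of the two curves are compared at time [1], where naturality and the
     isometry of [Phi] identify them; along each curve they are constant. *)
  have shpE : shp f (sigma (c t)) (fun i => tm sigma (c t) (E i t)) = shp f (c t) (E^~ t).
    have := frame_shp_const f_imm f_par fr' Jt J1 => /= ->.
    by rewrite natural_shp // (frame_shp_const f_imm f_par fr Jt J1).
  have gamE : coef (sigma (c t)) (fun i => tm sigma (c t) (E i t))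
      (vel (fun t => sigma (c t)) t (1 : R^o)) = coef (c t) (E^~ t) (vel c t (1 : R^o)).
    by rewrite (vel_imm (isometry_imm s_isom)) // coef_isometry.
  by rewrite gamE shpE.
have Pw := solution_parallel f_imm f_par fr Jab' sy.
have Pw' := solution_parallel f_imm f_par fr' Jab' sy'.
pose w (u : R^o) := \sum_i y i u *: vgen f (c u) (E^~ u) i.
pose J' : set R := `]a, b[%classic.
have J'E t : J' t = (a < t < b) by rewrite /J' /= in_itv.
have ow u : osc f (c u) (w u).
  by have [] := fib_sum osc0 osc_lin Phi_hom (index_enum _) xpredT (y^~ u) (osc_vgen (c u) (E^~ u)).
pose s u : tot N (osc f) := mktot (ow u).
have ps : parallel_along f (osc f) (nabla f) J' s.
  apply: (@covd_parallel_along _ _ _ f sf (fun _ v => v)) => //.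
  - exact: osc_subbundle.
  - exact: interval_is_interval.
  - have [cc sq] := sc; split=> [t|q]; first by rewrite J'E => /Jab'; exact: cc.
    by apply: Cinfty_sub (sq q) => t []; rewrite J'E => /Jab'.
have bE u : bpt (Phi (s u)) = sigma (c u) by rewrite (bpt_hom Phi_hom).
have vE u : vec (Phi (s u)) = fibre (c u) (w u) by rewrite fibE.
have J'1 : J' 1 by rewrite J'E b1' (lt_trans a0).
have J'0 : J' 0 by rewrite J'E.
have H0 := @parallel_along_covd _ _ _ f sf (fun _ v => v) (fun _ _ _ _ => erefl) (osc f)
   (fun _ _ _ => erefl) J' (Phi \o s) (Phi_par ps).
have fE : (fun u : R^o => f (bpt ((Phi \o s) u))) = (fun u => f (sigma (c u))).
  by apply/funext => u /=; rewrite bE.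
have gE : (fun u : R^o => vec ((Phi \o s) u)) = (fun u => fibre (c u) (w u)).
  by apply/funext => u /=; rewrite vE.
rewrite fE gE in H0.
have iJ' : is_interval J' by exact: interval_is_interval.
have mJ' t : J' t -> mdiff (fun u : R^o => f (sigma (c u))) t.
  rewrite J'E => /Jab' /mc[mct _].
  have mst : mdiff (fun u : R^o => sigma (c u)) t
    by apply: mdiff_imm => //; exact: isometry_imm.
  by apply: (@mdiff_imm _ M N) mst.
have H := @parallel_unique R N (fun u => f (sigma (c u))) J' iJ' mJ'
  (fun u => fibre (c u) (w u))
  (fun u => \sum_i y i u *: vgen f (sigma (c u)) (fun k => tm sigma (c u) (E k u)) i)
  1 J'1 (natural_sum _ _ n1) _ 0 J'0.
have wE0 : w 0 = \sum_i y0 i *: vgen f (c 0) (E^~ 0) i.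
  by apply: eq_bigr => i _; rewrite y00.
rewrite -wE0 H; first by apply: eq_bigr => i _; rewrite y00.
move=> t Jt; have [_ d1 c1] := H0 t Jt; have tab : a < t < b by rewrite -J'E.
by have [d2 c2] := Pw' t tab; split=> //; rewrite c2; exact: c1.
Qed.

Lemma natural_open (P : set M) : (forall p x0 rad u0 u1, ball x0 rad `<=` cim p ->
    ball x0 rad u0 -> ball x0 rad u1 -> P (chartV p u1) -> P (chartV p u0)) -> open P.
Proof.
move=> H; rewrite openE => p Pp; have [rad r0 sub] := chart_ball p.
have := vdom_nbhs (dom_self p) (nbhsx_ballx (chart p p) _ r0).
apply: filterS => q [pq bq]; rewrite -(chartKd pq).
by apply: (H p _ rad _ (chart p p) sub bq (ballxx _ r0)); rewrite chartKd.
Qed.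

(** By [natural_step], naturality holds at all points of a chart ball or at none, so the set of
    natural points and its complement are both open. *)
Lemma natural_everywhere p0 : connected [set: M] -> natural_at p0 -> forall q, natural_at q.
Proof.
move=> cM n0 q; have -> // : natural_at q = [set: M] q.
rewrite -(cM natural_at) //; first by exists p0.
- exists natural_at; last by rewrite setTI.
  by apply: natural_open => p x0 rad u0 u1; exact: natural_step.
- exists natural_at; last by rewrite setTI.
  rewrite -openC; apply: natural_open => p x0 rad u0 u1 sub b0 b1 n1 n0'; apply: n1.
  exact: natural_step sub b1 b0 n0'.
Qed.

End Rigidity.

(** * The action of Sym(M) *)

Section SmoothComposition.
Variables (R : realType) (M N P : manifold R).

Lemma smooth_id : smooth (idfun : M -> M).
Proof. by split=> [|p q]; [exact: continuous_idfun|exact: transition_smooth]. Qed.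

Lemma smooth_comp (g : N -> P) (k : M -> N) : smooth g -> smooth k -> smooth (g \o k).
Proof.
move=> [cg sg] [ck sk]; have cgk : continuous (g \o k).
  by move=> x; apply: continuous_comp; [exact: ck|exact: cg].
split=> // p r; apply: Cinfty_local => _ [q [pq rq] <-].
pose y := k q; pose B := dom p `&` (k @^-1` (dom y `&` g @^-1` dom r)).
have oB : open B.
  apply: openI; first exact: dom_open.
  apply: open_comp; first by move=> ? _; exact: ck.
  apply: openI; first exact: dom_open.
  by apply: open_comp; [move=> ? _; exact: cg|exact: dom_open].
have oD : open (chart p @` B) by apply: chart_im_open => // ? [].
have oD' : open (chart y @` (dom y `&` g @^-1` dom r)).
  apply: chart_im_open; last by move=> ? [].
  apply: openI; first exact: dom_open.
  by apply: open_comp; [move=> ? _; exact: cg|exact: dom_open].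
exists (chart p @` B); first by exists q => //; split=> //; split=> //; exact: dom_self.
have ck' : Cinfty (chart p @` B) (chart y \o k \o chartV p).
  by apply: Cinfty_sub (sk p y) => _ [x [px [yx _]] <-]; exists x.
have H := Cinfty_comp_row oD oD' _ ck' (sg y r).
apply: (Cinfty_eq oD _ (H _)).
  by move=> _ [x [px [yx rx]] <-] /=; rewrite !chartKd.
by move=> _ [x [px [yx rx]] <-] /=; rewrite chartKd //; exists (k x).
Qed.

Variable F : N -> P.
Hypothesis cF : continuous F.

Lemma smooth_sec_comp (k : M -> N) U s : smooth k -> open U -> smooth_sec F U s ->
  smooth_sec (F \o k) (k @^-1` U) (s \o k).
Proof.
move=> [ck sk] oU /smooth_secP ss.
apply/smooth_secP => p r; apply: Cinfty_local => _ [q [[Uq pq] rq] <-].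
pose y := k q; pose B' := U `&` dom y `&` F @^-1` dom r; pose B := dom p `&` (k @^-1` B').
have oB' : open B'.
  apply: openI; first by apply: openI => //; exact: dom_open.
  by apply: open_comp; [move=> ? _; exact: cF|exact: dom_open].
have oB : open B.
  apply: openI; first exact: dom_open.
  by apply: open_comp => // ? _; exact: ck.
have oD : open (chart p @` B) by apply: chart_im_open => // ? [].
have oD' : open (sdom F U y r) by exact: sdom_open.
exists (chart p @` B).
  by exists q => //; split=> //; split=> //; split=> //; exact: dom_self.
have ck' : Cinfty (chart p @` B) (chart y \o k \o chartV p).
  by apply: Cinfty_sub (sk p y) => _ [x [px [[_ yx] _]] <-]; exists x.
have H := Cinfty_comp_row oD oD' _ ck' (ss y r).
apply: (Cinfty_eq oD _ (H _)).
  by move=> _ [x [px [[_ yx] rx]] <-] /=; rewrite /sechat /= !chartKd.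
by move=> _ [x [px [[Ux yx] rx]] <-] /=; rewrite chartKd //; exists (k x).
Qed.

End SmoothComposition.

Section IsometryGroup.
Variables (R : realType) (M : riemannian R).
Implicit Types g h : M -> M.

Lemma isometry_gdiff g q : isometry g -> gdiff g q.
Proof. by move=> [sg _ _]; exact: smooth_gdiff. Qed.

Lemma isometry_id : isometry (idfun : M -> M).
Proof.
split; [exact: smooth_id|by exists idfun; split=> //; exact: smooth_id|].
by move=> p x y; rewrite !tmapE !tm_id.
Qed.

Lemma isometry_comp g h : isometry g -> isometry h -> isometry (g \o h).
Proof.
move=> ig ih; have [sg [g' [sg' gK g'K]] eg] := ig; have [sh [h' [sh' hK h'K]] eh] := ih.
split; first exact: smooth_comp.
  exists (h' \o g'); split; first exact: smooth_comp.
    by move=> x /=; rewrite gK hK.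
  by move=> x /=; rewrite h'K g'K.
move=> p x y; rewrite !tmapE.
have C z := (tm_comp z (isometry_gdiff p ih) (isometry_gdiff (h p) ig)).2.
by rewrite [tm _ _ x]C [tm _ _ y]C -!tmapE /= eg eh.
Qed.

Lemma tm_cancel g g' q x : isometry g -> smooth g' -> cancel g g' ->
  tm g' (g q) (tm g q x) = x.
Proof.
move=> ig sg' gK; have [_ <-] := tm_comp x (isometry_gdiff q ig) (smooth_gdiff (g q) sg').
by rewrite (_ : (fun q => g' (g q)) = (fun q => q)) ?tm_id //; apply/funext => z; rewrite gK.
Qed.

Lemma isometry_inv g g' : isometry g -> cancel g g' -> cancel g' g -> isometry g'.
Proof.
move=> ig gK g'K; have [sg [k [sk gk kg]] eg] := ig.
have kE : k = g' by apply/funext => x; rewrite -{1}(g'K x) gk.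
rewrite kE in sk gk kg; split; [exact: sk|by exists g|].
have H q x : tmap g (g' q) (tmap g' q x) = x.
  rewrite !tmapE; have gs : gdiff g (g' q) by exact: isometry_gdiff.
  have [_ <-] := tm_comp x (smooth_gdiff q sk) gs.
  by rewrite (_ : (fun q => g (g' q)) = (fun q => q)) ?tm_id //; apply/funext => z; rewrite g'K.
by move=> p x y; rewrite -eg !H g'K.
Qed.

End IsometryGroup.

(** * Natural lifts of isometries to the osculating bundle *)

Section Lifts.
Variables (R : realType) (M : symmetric_space R) (N : riemannian R) (f : M -> N).
Hypothesis f_imm : isometric_immersion f.
Let sf : smooth f. Proof. by case: f_imm. Qed.
Let cf : continuous f. Proof. by case: sf. Qed.
Implicit Types (g : M -> M) (Phi : tot N (osc f) -> tot N (osc f)).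

Lemma Sym_isometry g : Sym M g -> isometry g.
Proof.
elim=> [p||? ? _ IHg _ IHh|h h' _ IH hK h'K].
- exact: sym_isometry.
- exact: isometry_id.
- exact: isometry_comp.
- exact: isometry_inv IH hK h'K.
Qed.

(** Naturality is demanded at every point, so that uniqueness and composition of lifts are fibrewise
    algebra. *)
Definition lifts g Phi := [/\ bundle_hom f (osc f) g Phi, fibre_isometric f Phi,
  parallel_map f (osc f) (nabla f) Phi & forall q, natural_at g Phi q].

Lemma fib_normal1 g Phi q v : lifts g Phi -> normal1 f q v ->
  normal1 f (g q) (fib Phi q v).
Proof.
move=> [Ph _ _ nP] [r [a [x [y ->]]]]; have [_ nh] := nP q.
have oh i : osc f q (h f q (x i) (y i)) by rewrite hE; exact: osc_hh.
have [_ ->] := fib_sum (osc0 f_imm) (osc_lin f_imm) Ph (index_enum _) xpredT a oh.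
apply: normal1_sum => // i _; rewrite hE nh -[_ *: _]addr0.
by apply: normal1_lin => //; [exact: normal1_hh|exact: normal1_0].
Qed.

Lemma lift_uniq g Phi Psi : lifts g Phi -> lifts g Psi -> Phi = Psi.
Proof.
move=> [Ph _ _ nP] [Qh _ _ nQ]; apply/funext => e; apply: tot_eq.
  by rewrite (bpt_hom Ph) (bpt_hom Qh).
rewrite !fibE; have : osc f (bpt e) (vec e) := svalP e.
move: (bpt e) (vec e) => q v /oscP[x [xi [nxi ->]]]; have [Pt Phh] := nP q; have [Qt Qhh] := nQ q.
rewrite -[tm f q x]scale1r !(fib_lin (osc_lin f_imm) Ph, fib_lin (osc_lin f_imm) Qh);
  try exact: osc_tm; try by apply/oscP; exists 0, xi; rewrite tm0 // add0r.
rewrite Pt Qt; congr (_ + _).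
have [r [a [y [z ->]]]] := nxi.
have oh i : osc f q (h f q (y i) (z i)) by rewrite hE; exact: osc_hh.
have [_ ->] := fib_sum (osc0 f_imm) (osc_lin f_imm) Ph (index_enum _) xpredT a oh.
have [_ ->] := fib_sum (osc0 f_imm) (osc_lin f_imm) Qh (index_enum _) xpredT a oh.
by apply: eq_bigr => i _; rewrite hE Phh Qhh.
Qed.

Lemma lift_id : lifts idfun idfun.
Proof.
split=> //; first split=> //.
- move=> U s s' [oU os ss] H; apply: (smooth_sec_eq cf oU _ ss) => q Uq.
  by rewrite -[LHS]/(vec (mktot (os q Uq))) H.
- have nid q v : osc f q v -> fib (idfun : tot N (osc f) -> _) q v = v.
    by move=> ov; rewrite (fib_mktot _ ov).
  by move=> q; split=> [x|x y]; rewrite ?tm_id nid //; [exact: osc_tm|exact: osc_hh].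
Qed.

Lemma lift_comp g h Phi Psi : isometry g -> isometry h -> lifts g Phi -> lifts h Psi ->
  lifts (g \o h) (Phi \o Psi).
Proof.
move=> ig ih [Ph Pi Pp nP] [Qh Qi Qp nQ].
have fibC q v : osc f q v -> fib (Phi \o Psi) q v = fib Phi (h q) (fib Psi q v).
  by move=> ov; rewrite !(fib_mktot _ ov) /= fibE (bpt_hom Qh).
split.
- split.
  + by move=> e; rewrite /= (bpt_hom Ph) (bpt_hom Qh).
  + move=> a e1 e2 e3 b12 b23 E; have [_ LP _] := Ph; have [_ LQ _] := Qh.
    apply: LP; rewrite ?(bpt_hom Qh) ?b12 ?b23 //.
    exact: LQ.
  + move=> U s s' [oU os ss] H.
    have [sh [h' [sh' hK h'K]] _] := ih.
    have oU' : open (h' @^-1` U) by apply: open_comp => // ? _; case: sh' => + _; exact.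
    (* [Psi] yields a section along [f \o h], whereas smoothness of [Phi] concerns sections along
       [f]. So the section is moved by the inverse [h'] of [h], mapped by [Phi], and pulled back
       along [h]. *)
    pose s1 q := fib Psi q (s q).
    have ss1 : smooth_sec (f \o h) U s1.
      exact: (fib_smooth Qh (And3 oU os ss)).
    pose s2 := s1 \o h'.
    have ss2 : smooth_sec f (h' @^-1` U) s2.
      have cfh : continuous (f \o h).
        move=> x; apply: continuous_comp; last exact: cf.
        by case: sh => + _; exact.
      have := smooth_sec_comp cfh sh' oU ss1.
      by rewrite (_ : (f \o h) \o h' = f) //; apply/funext => x /=; rewrite h'K.
    have os2 q : (h' @^-1` U) q -> osc f q (s2 q).
      move=> Uq; rewrite /s2 /s1 /= (fib_mktot Psi (os _ Uq)).
      by have := svalP (Psi (mktot (os _ Uq))); rewrite -/(bpt _) (bpt_hom Qh) /= h'K.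
    pose s3 q := fib Phi q (s2 q).
    have ss3 : smooth_sec (f \o g) (h' @^-1` U) s3.
      exact: (fib_smooth Ph (And3 oU' os2 ss2)).
    have cfg : continuous (f \o g).
      move=> x; apply: continuous_comp; last exact: cf.
      by case: ig => -[+ _] _ _; exact.
    have := smooth_sec_comp cfg sh oU' ss3.
    rewrite (_ : h @^-1` (h' @^-1` U) = U); last first.
      by apply/seteqP; split=> x /=; rewrite hK.
    apply: smooth_sec_eq => // [|q Uq].
      move=> x; apply: continuous_comp; last exact: cfg.
      by case: sh => + _; exact.
    rewrite /= /s3 /s2 /s1 /= hK -fibC; last exact: os.
    by rewrite (fib_mktot _ (os q Uq)) H.
- move=> e1 e2 b12 /=; rewrite Pi ?Qi // !(bpt_hom Qh); congr h; exact: b12.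
- by move=> J s ps; apply: (Pp J (Psi \o s)); exact: Qp.
move=> q; have [Pt Phh] := nP (h q); have [Qt Qhh] := nQ q.
have C z := (tm_comp z (isometry_gdiff q ih) (isometry_gdiff (h q) ig)).2.
split=> [x|x y].
  by rewrite fibC ?Qt ?Pt; [congr tm; exact/esym/C|exact: osc_tm].
rewrite fibC ?Qhh ?Phh; last exact: osc_hh.
by congr hh; exact/esym/C.
Qed.

End Lifts.

Section SymActions.
Variables (R : realType) (M : symmetric_space R) (N : manifold R).
Variables (F : M -> N) (E : M -> set 'rV[R]_(dim N)).

Lemma Sym_inverse (g : M -> M) : Sym M g ->
  exists g', [/\ Sym M g', cancel g g' & cancel g' g].
Proof.
move=> sg; have [_ [g' [_ gK g'K]] _] := Sym_isometry sg.
by exists g'; split=> //; exact: Sym_inv gK g'K.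
Qed.

(** The inverse bundle map is [beta] of the inverse group element, so invertibility follows from the
    group law. *)
Lemma Sym_bundle_action (beta : {g | Sym M g} -> tot N E -> tot N E) :
  (forall g, bundle_hom F E (sval g) (beta g)) ->
  (forall g e, sval g = idfun -> beta g e = e) ->
  (forall g h gh e, sval gh = sval g \o sval h -> beta gh e = beta g (beta h e)) ->
  bundle_action F E (Sym M) beta.
Proof.
move=> bh b1 bc; split=> // g; split=> //.
have [g' [sg' gK g'K]] := Sym_inverse (svalP g).
pose gi : {g | Sym M g} := exist _ g' sg'; pose g1 : {g | Sym M g} := exist _ idfun (Sym_id M).
exists g', (beta gi); split=> [|e|e]; first exact: (bh gi).
  rewrite -(bc gi g g1) ?b1 //; apply/funext => x /=; exact/esym/gK.
rewrite -(bc g gi g1) ?b1 //; apply/funext => x /=; exact/esym/g'K.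
Qed.

End SymActions.

Section SigmaLifts.
Variables (R : realType) (M : symmetric_space R) (N : riemannian R) (f : M -> N).
Hypothesis f_imm : isometric_immersion f.
Hypothesis f_par : parallel_immersion f.
Variable Sigma : M -> tot N (osc f) -> tot N (osc f).
Hypothesis SigmaP : forall p, is_Sigma p (Sigma p).

(** Agreement with [Sigma p] is assumed over [p] only, because this is all that is known about the
    maps of a competing action. *)
Lemma natural_sym p Phi : (forall e, bpt e = p -> Phi e = Sigma p e) ->
  natural_at (sym p) Phi p.
Proof.
move=> PS; have [_ _ _ _ Sp] := SigmaP p.
have tms x : tm (sym p) p x = - x by rewrite -tmapE sym_reflection.
split=> [x|x y]; rewrite sym_fix !tms.
  rewrite (fib_mktot _ (osc_tm f_imm p x)) PS // tmN //.
  by apply: (Sp _ _).2 => //; rewrite tmapE.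
have -> : hh f p (- x) (- y) = hh f p x y.
  by rewrite -[- x]scaleN1r -[- y]scaleN1r hhZl // hhZr // scalerA mulrNN mul1r scale1r.
rewrite (fib_mktot _ (osc_hh f p x y)) PS //.
by apply: (Sp _ _).1 => //; exact: normal1_hh.
Qed.

Lemma lift_sym p : lifts (sym p) (Sigma p).
Proof.
have [_ hS iS pS _] := SigmaP p; split=> //.
apply: (natural_everywhere f_imm f_par (sym_isometry p) hS iS pS (p0 := p)).
  exact: sspace_connected.
exact: natural_sym.
Qed.

(** Read off from [Sigma p] on base points; the zero vector over [q] supplies an element of the
    bundle to apply it to. *)
Lemma sym_involutive (p : M) : involutive (sym p).
Proof.
move=> q; have [SK hS _ _ _] := SigmaP p.
have := congr1 bpt (SK (mktot (osc0 f_imm q))).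
by rewrite !(bpt_hom hS).
Qed.

(** The induction carries a lift of the inverse along with the lift of [g]. It starts because
    [sym p] is its own inverse, and it makes the case of inverses a mere exchange. *)
Lemma lift_exists g : Sym M g -> exists Phi : tot N (osc f) -> tot N (osc f), lifts g Phi.
Proof.
suff H : Sym M g -> exists g' (Phi Phi' : tot N (osc f) -> tot N (osc f)),
    [/\ cancel g g', cancel g' g, lifts g Phi & lifts g' Phi'].
  by move=> /H[g' [Phi [_ [_ _ lP _]]]]; exists Phi.
elim=> [p||{}g h sg [g' [P [P' [gK g'K lP lP']]]] sh [h' [Q [Q' [hK h'K lQ lQ']]]]|
  {}g g1 sg [g' [P [P' [gK g'K lP lP']]]] gK1 g1K].
- exists (sym p), (Sigma p), (Sigma p); split; try exact: sym_involutive; exact: lift_sym.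
- by exists idfun, idfun, idfun; split=> //; exact: lift_id.
- have [ig ih] := (Sym_isometry sg, Sym_isometry sh).
  exists (h' \o g'), (P \o Q), (Q' \o P'); split=> [x|x||] /=.
  + by rewrite gK hK.
  + by rewrite h'K g'K.
  + exact: lift_comp.
  + exact: (lift_comp f_imm (isometry_inv ih hK h'K) (isometry_inv ig gK g'K) lQ' lP').
- exists g, P', P; split=> //.
  by rewrite (_ : g1 = g') //; apply/funext => x; rewrite -{1}(g'K x) gK1.
Qed.

Variable alpha : {g | Sym M g} -> tot N (osc f) -> tot N (osc f).
Hypothesis alphaP : forall g, lifts (sval g) (alpha g).

Lemma alpha1 g e : sval g = idfun -> alpha g e = e.
Proof.
move=> g1; have := alphaP g; rewrite g1 => l1.
by rewrite (lift_uniq f_imm l1 (lift_id f_imm)).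
Qed.

Lemma alphaM g h gh e : sval gh = sval g \o sval h -> alpha gh e = alpha g (alpha h e).
Proof.
move=> ghE; have := alphaP gh; rewrite ghE => l1.
have l2 := lift_comp f_imm (Sym_isometry (svalP g)) (Sym_isometry (svalP h)) (alphaP g) (alphaP h).
by rewrite (lift_uniq f_imm l1 l2).
Qed.

Lemma alpha_natural : natural_action Sigma alpha.
Proof.
split.
- apply: Sym_bundle_action => [g||]; [by have [] := alphaP g|exact: alpha1|exact: alphaM].
- by move=> g; have [] := alphaP g.
- by move=> g; have [] := alphaP g.
- move=> p g e gp _; have := alphaP g; rewrite gp => l1.
  by rewrite (lift_uniq f_imm l1 (lift_sym p)).
Qed.

(** At the generators, rigidity extends the agreement with [Sigma p] from the fibre over [p] to all
    fibres, so uniqueness of lifts applies; the group law covers composites and inverses. *)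
Lemma natural_action_uniq alpha' : natural_action Sigma alpha' -> alpha' = alpha.
Proof.
move=> [[aiso a1 aM] ai ap aS].
(* Quantifying over every membership proof [sg] lets the induction hypotheses apply to the elements
   assembled from the subderivations. *)
suff H (g : M -> M) : Sym M g -> forall sg, alpha' (exist _ g sg) = alpha (exist _ g sg).
  by apply/funext => -[g sg]; exact: H.
elim=> {g} [p||g h sg IHg sh IHh|g g' sg IHg gK g'K] Sg.
- pose sp : {g | Sym M g} := exist _ (sym p) Sg.
  have [hp _] := aiso sp.
  apply: (@lift_uniq _ _ _ f f_imm (sym p)); last exact: (alphaP sp).
  split; [exact: hp|exact: (ai sp)|exact: (ap sp)|].
  apply: (natural_everywhere f_imm f_par (sym_isometry p) hp (ai sp) (ap sp) (p0 := p)).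
    exact: sspace_connected.
  by apply: natural_sym => e; exact: aS.
- by apply/funext => e; rewrite a1 ?alpha1.
- pose g0 : {g | Sym M g} := exist _ g sg; pose h0 : {g | Sym M g} := exist _ h sh.
  apply/funext => e; rewrite (aM g0 h0) // (@alphaM g0 h0) //.
  by rewrite /g0 /h0 IHg IHh.
- pose g0 : {g | Sym M g} := exist _ g sg; pose g1 : {g | Sym M g} := exist _ g' Sg.
  pose id0 : {g | Sym M g} := exist _ idfun (Sym_id M).
  have E1 : sval id0 = sval g1 \o sval g0 by apply/funext => x /=; exact/esym/gK.
  have E2 : sval id0 = sval g0 \o sval g1 by apply/funext => x /=; exact/esym/g'K.
  apply/funext => e; have eE : e = alpha g0 (alpha g1 e) by rewrite -(alphaM _ E2) alpha1.
  by rewrite -/g1 {1}eE -(IHg sg) -(aM g1 g0 id0 _ E1) a1.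
Qed.

Definition alphaT (g : {g | Sym M g}) (x : tot M (tangent M)) : tot M (tangent M) :=
  @mktot R M M (tangent M) (sval g (bpt x)) (tm (sval g) (bpt x) (vec x)) Logic.I.

Definition alphaN (g : {g | Sym M g}) (xi : tot N (normal1 f)) : tot N (normal1 f) :=
  mktot (fib_normal1 f_imm (alphaP g) (totP xi)).

Lemma normal1_osc q v : normal1 f q v -> osc f q v.
Proof. by move=> nv; apply/oscP; exists 0, v; rewrite tm0 // add0r. Qed.

Lemma alphaT_action : bundle_action (idfun : M -> M) (tangent M) (Sym M) alphaT.
Proof.
apply: Sym_bundle_action.
- move=> g; have ig := Sym_isometry (svalP g).
  split=> //.
    move=> a e1 e2 e3 b12 b23 E; rewrite /alphaT /vec /= -!/(vec _) E b12 b23.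
    exact: (tmP _ _ _ (isometry_gdiff _ ig)).
  move=> U s s' [oU _ ss] H.
  have st := tm_smooth (isometry_imm ig) oU ss.
  have cg : continuous (sval g) by case: ig => -[].
  apply: (smooth_sec_eq cg oU _ st) => q Uq.
  by rewrite -(H (@mktot R M M (tangent M) q (s q) Logic.I)).
- by move=> g e g1; apply: tot_eq; rewrite /alphaT /bpt /vec /= g1 ?tm_id.
- move=> g h gh e E; have ig := Sym_isometry (svalP g); have ih := Sym_isometry (svalP h).
  apply: tot_eq; rewrite /alphaT /vec /bpt /= E //=.
  by have [_ ->] := tm_comp (vec e) (isometry_gdiff (bpt e) ih) (isometry_gdiff (sval h (bpt e)) ig).
Qed.

Lemma vec_alphaN g xi : vec (alphaN g xi) = fib (alpha g) (bpt xi) (vec xi).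
Proof. by []. Qed.

Lemma alphaN_action : bundle_action f (normal1 f) (Sym M) alphaN.
Proof.
have aE g q v (ov : osc f q v) : fib (alpha g) q v = vec (alpha g (mktot ov)).
  exact: fib_mktot.
apply: Sym_bundle_action.
- move=> g; have [ah _ _ _] := alphaP g; split=> //.
    move=> a e1 e2 e3 b12 b23 E; rewrite !vec_alphaN E b12 b23.
    have n1 : normal1 f (bpt e3) (vec e1) by rewrite -b23 -b12; exact: totP.
    have n2 : normal1 f (bpt e3) (vec e2) by rewrite -b23; exact: totP.
    exact: (fib_lin (osc_lin f_imm) ah _ (normal1_osc n1) (normal1_osc n2)).
  move=> U s s' [oU ns ss] H.
  have sc : continuous (f \o sval g).
    have [[cg _] _ _] := Sym_isometry (svalP g).
    move=> x; apply: continuous_comp; first exact: cg.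
    by case: f_imm => -[+ _] _; exact.
  have os q : U q -> osc f q (s q) by move=> /ns; exact: normal1_osc.
  apply: (smooth_sec_eq sc oU _ (fib_smooth ah (And3 oU os ss))) => q Uq.
  by rewrite -(H (mktot (ns q Uq))).
- move=> g e g1; apply: tot_eq; rewrite ?vec_alphaN /bpt /= ?g1 //.
  by rewrite (aE _ _ _ (normal1_osc (totP e))) alpha1.
- move=> g h gh e E; apply: tot_eq; first by rewrite /bpt /= E.
  rewrite !vec_alphaN; have oe := normal1_osc (svalP e).
  rewrite (aE _ _ _ oe) (alphaM _ E) fibE; have [hh _ _ _] := alphaP h.
  by rewrite (bpt_hom hh) fibE.
Qed.

Lemma alpha_split g (w : tot N (osc f)) (x : tot M (tangent M)) (xi : tot N (normal1 f)) :
  bpt x = bpt w -> bpt xi = bpt w -> vec w = tmap f (bpt w) (vec x) + vec xi ->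
  vec (alpha g w) = tmap f (sval g (bpt w)) (vec (alphaT g x)) + vec (alphaN g xi).
Proof.
move=> xw xiw; rewrite !tmapE => E; have [ah _ _ nP] := alphaP g.
rewrite fibE E -[tm f _ _]scale1r (fib_lin (osc_lin f_imm) ah); first last.
- by rewrite -xiw; apply: normal1_osc; exact: totP.
- exact: osc_tm.
have [-> _] := nP (bpt w).
by rewrite scale1r vec_alphaN xiw /alphaT /vec /= xw.
Qed.

Lemma alpha_sff g (x y : tot M (tangent M)) (xi : tot N (normal1 f)) :
  bpt x = bpt y -> bpt xi = bpt x -> vec xi = h f (bpt x) (vec x) (vec y) ->
  vec (alphaN g xi) = h f (sval g (bpt x)) (vec (alphaT g x)) (vec (alphaT g y)).
Proof.
move=> xy xix E; rewrite vec_alphaN E xix !hE; have [_ _ _ nP] := alphaP g.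
by have [_ ->] := nP (bpt x); rewrite /alphaT /vec /= -xy.
Qed.

Variable I0_Sym : isom0 M `<=` Sym M.

Lemma normal1_homogeneous :
  homogeneous_via f (normal1 f) (isom0 M) (restrict_action I0_Sym alphaN).
Proof.
split; first exact: normal1_subbundle.
have [biso b1 bM] := alphaN_action.
pose emb (g : {g | isom0 M g}) : {g | Sym M g} := exist _ (sval g) (I0_Sym (proj2_sig g)).
split=> [g|g e|g h gh e].
- exact: (biso (emb g)).
- exact: (b1 (emb g)).
- exact: (bM (emb g) (emb h) (emb gh)).
Qed.

End SigmaLifts.

(** * Transvections *)

Section Gronwall.
Variable R : realType.

Lemma is_derive_expR_scale (k x : R) :
  is_derive x 1 (fun x : R => expR (k * x)) (k * expR (k * x)).
Proof.
have dk : is_derive x 1 (fun x : R => k * x) k.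
  by have := @is_deriveZ R R R id k x 1 1 (is_derive_id _ _); rewrite /GRing.scale /= mulr1.
have H := @is_derive1_comp R expR (fun x => k * x) x _ _ (is_derive_expR _) dk.
by refine (is_derive_eq H _); rewrite mulrC.
Qed.

(** By the bound on [D'], the function [expR (K * t) * D t] increases and [expR (- K * t) * D t]
    decreases. The first handles times before [t0], the second those after it. *)
Lemma gronwall (J : set R) (K : R) (D D' : R -> R) t0 : is_interval J -> J t0 ->
  (forall t, J t -> is_derive t 1 D (D' t)) -> (forall t, 0 <= D t) -> D t0 = 0 ->
  (forall t, J t -> `|D' t| <= K * D t) -> forall t, J t -> D t = 0.
Proof.
move=> iJ J0 dD D0 Dt0 bD.
have dphi (k x : R) : J x -> is_derive x 1 (fun x => expR (k * x) * D x)
    (expR (k * x) * (k * D x + D' x)).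
  move=> Jx; have H := @is_deriveM R R _ _ x 1 _ _ (is_derive_expR_scale k x) (dD x Jx).
  by refine (is_derive_eq H _); rewrite /GRing.scale /=; ring.
have mono (phi phi' : R -> R) s t : J s -> J t -> s <= t ->
    (forall x, J x -> is_derive x 1 phi (phi' x) /\ 0 <= phi' x) -> phi s <= phi t.
  move=> Js Jt st H; have Jx x : s <= x <= t -> J x by move=> h; exact: (iJ s t Js Jt).
  apply: (@ger0_derive1_le_cc R phi s t _) => //.
  - move=> x; rewrite in_itv /= => /andP[sx xt].
    have [|+ _] := H x; first by apply: Jx; rewrite !ltW.
    by case.
  - move=> x; rewrite in_itv /= => /andP[sx xt].
    have [|[_ +] ?] := H x; first by apply: Jx; rewrite !ltW.
    by rewrite -derive1E => ->.
  - apply: derivable_within_continuous => x; rewrite in_itv /= => /Jx /H[+ _].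
    by case.
  - by rewrite in_itv /= lexx.
  - by rewrite in_itv /= st lexx.
move=> t Jt; apply/eqP; rewrite eq_le D0 andbT.
have [tt|tt] := leP t t0.
  have : expR (K * t) * D t <= expR (K * t0) * D t0.
    apply: (mono (fun x => expR (K * x) * D x)
      (fun x => expR (K * x) * (K * D x + D' x))) => // x Jx.
    split; first exact: dphi.
    rewrite mulr_ge0 ?expR_ge0 //.
    by move: (bD x Jx); rewrite ler_norml => /andP[h _]; rewrite -lerBlDl sub0r.
  by rewrite Dt0 mulr0 pmulr_rle0 ?expR_gt0.
have : - (expR (- K * t0) * D t0) <= - (expR (- K * t) * D t).
  apply: (mono (fun x => - (expR (- K * x) * D x))
    (fun x => - (expR (- K * x) * (- K * D x + D' x)))) => // [|x Jx]; first exact: ltW.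
  split; first exact: is_deriveN (dphi (- K) x Jx).
  rewrite -mulrN mulr_ge0 ?expR_ge0 // oppr_ge0.
  by move: (bD x Jx); rewrite ler_norml => /andP[_ h]; rewrite mulNr addrC subr_le0.
by rewrite Dt0 mulr0 oppr0 oppr_ge0 pmulr_rle0 ?expR_gt0.
Qed.

Lemma row_entry_norm n (x : 'rV[R]_n) i : `|x 0 i| <= `|x|.
Proof.
have [-> |x0] := eqVneq x 0; first by rewrite mxE normr0.
rewrite [leRHS]/Num.norm /= mx_normrE.
by apply: (le_trans _ (le_bigmax _ (fun ij : 'I_1 * 'I_n => `|x ij.1 ij.2|) (0, i))).
Qed.

(** The partial derivatives are bounded on a small ball, which is convex, so the mean value theorem
    along segments gives the estimate. *)
Lemma Cinfty_lipschitz n m (U : set 'rV[R]_n) (F : 'rV[R]_n -> 'rV[R]_m) x0 :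
  open U -> Cinfty U F -> U x0 -> exists rad L : R, [/\ 0 < rad, 0 <= L,
    ball x0 rad `<=` U & forall x y, ball x0 rad x -> ball x0 rad y -> forall i,
    `|F y 0 i - F x 0 i| <= L * `|y - x|].
Proof.
move=> oU cF Ux.
pose P i j z : R^o := dv (delta_mx 0 j) (fun z => F z 0 i : R^o) z.
(* One continuous function dominating all partial derivatives: [|P| <= P * P + 1 <= S + 1], and [S]
   stays within [1] of [S x0] near [x0]. This is the origin of the constant [|S x0| + 2]. *)
pose S z : R^o := \sum_i \sum_j P i j z * P i j z.
have cS : Cinfty U S.
  apply: Cinfty_sum => // i _; apply: Cinfty_sum => // j _.
  have cP : Cinfty U (P i j) by apply/Cinfty_dv/Cinfty_entry.
  exact: Cinfty_mul.
have nS : \forall z \near x0, `|S x0 - S z| < 1.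
  have /cvgrPdist_lt := Cinfty_continuous cS Ux; exact.
have : \forall z \near x0, U z /\ `|S x0 - S z| < 1.
  by apply: filterS2 nS (open_nbhs_nbhs (conj oU Ux)) => z.
move=> /nbhs_ballP[rad r0 H].
pose C := `|S x0| + 2.
exists rad, (n%:R * C); split=> //; first by rewrite mulr_ge0 // addr_ge0.
  by move=> z /H[].
have bP i j z : ball x0 rad z -> `|P i j z| <= C.
  move=> /H[_ h]; have : `|P i j z| <= S z + 1.
    have h1 : P i j z * P i j z <= S z.
      rewrite /S (bigD1 i) //= (bigD1 j) //= -addrA lerDl addr_ge0 //.
        by apply: sumr_ge0 => k _; rewrite -expr2 sqr_ge0.
      by apply: sumr_ge0 => k _; apply: sumr_ge0 => l _; rewrite -expr2 sqr_ge0.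
    have h2 : `|P i j z| <= P i j z * P i j z + 1.
      rewrite -[X in _ <= X + _](@normr_idP R _ _) ?normrM; last by rewrite -expr2 sqr_ge0.
      move: `|P i j z| => a; nra.
    by apply: le_trans h2 _; rewrite lerD2r.
  move=> h1; apply: le_trans h1 _; rewrite /C.
  have := ler_norm (S x0); move: h; rewrite ltr_norml => /andP[h _].
  move: (S z) (S x0) h => a b; lra.
move=> x y bx bY i.
have bz t : 0 <= t <= 1 -> ball x0 rad (x + t *: (y - x)).
  move=> /andP[t0 t1]; move: bx bY; rewrite -ball_normE /ball_ /= => bx bY.
  have -> : x0 - (x + t *: (y - x)) = (1 - t) *: (x0 - x) + t *: (x0 - y).
    by apply/rowP => k; rewrite !mxE; ring.
  apply: le_lt_trans (ler_normD _ _) _; rewrite !normrZ ger0_norm ?subr_ge0 // (ger0_norm t0).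
  set a := `|x0 - x| in bx *; set b := `|x0 - y| in bY *.
  have h : Num.max a b < rad by rewrite gt_max bx.
  apply: le_lt_trans h; have -> : Num.max a b = (1 - t) * Num.max a b + t * Num.max a b by ring.
  by apply: lerD; rewrite ler_wpM2l ?subr_ge0 // le_max lexx ?orbT.
have dF z : ball x0 rad z -> differentiable (fun z => F z 0 i : R^o) z.
  by move=> /H[Uz _]; exact: (Cinfty_differentiable (Cinfty_entry i oU cF) Uz).
have [t ht] := MVT_line (v := y - x) ler01 (fun t ht => dF _ (bz t ht)).
have -> : x + 1 *: (y - x) = y by rewrite scale1r addrC subrK.
rewrite mul1r => ->.
rewrite -dvE dv_row; last exact: dF (bz t ht).
apply: le_trans (ler_norm_sum _ _ _) _.
have -> : n%:R * C * `|y - x| = \sum_(j < n) C * `|y - x|.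
  by rewrite sumr_const card_ord -mulrA mulr_natl.
apply: ler_sum => j _; rewrite normrM mulrC; apply: ler_pM => //; first exact: bP (bz t ht).
exact: row_entry_norm.
Qed.

(** The sum of squares [D] replaces the norm of [u - v] because it is differentiable; the Lipschitz
    bound gives [|D'| <= 2 * L * n * D], and Gronwall's lemma applies. *)
Lemma ode_unique_local n (U : set 'rV[R]_n) (F : 'rV[R]_n -> 'rV[R]_n)
    (u v : R^o -> 'rV[R]_n) (t0 : R) : open U -> Cinfty U F -> U (u t0) -> u t0 = v t0 ->
  (\forall t \near t0, differentiable u t /\ dv (1 : R^o) u t = F (u t)) ->
  (\forall t \near t0, differentiable v t /\ dv (1 : R^o) v t = F (v t)) ->
  \forall t \near t0, u t = v t.
Proof.
move=> oU cF Ux uv Hu Hv; have [rad [L [r0 L0 sub lip]]] := Cinfty_lipschitz oU cF Ux.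
have nb (w : R^o -> 'rV[R]_n) : w t0 = u t0 ->
    (\forall t \near t0, differentiable w t /\ dv (1 : R^o) w t = F (w t)) ->
    \forall t \near t0, (differentiable w t /\ dv (1 : R^o) w t = F (w t)) /\ ball (u t0) rad (w t).
  move=> w0 Hw; have [dw _] := nbhs_singleton Hw.
  have := differentiable_continuous dw; rewrite /prop_for /continuous_at w0.
  by move=> /(_ _ (nbhsx_ballx _ _ r0)) h; apply: filterS2 Hw h.
have := @filterI _ _ (nbhs_filter (t0 : R^o)) _ _ (nb u erefl Hu) (nb v (esym uv) Hv).
move=> /nbhs_ballP[del d0 H].
pose J : set R := ball t0 del.
have J0 : J t0 by exact: ballxx.
have iJ : is_interval J.
  move=> a b; rewrite /J -ball_normE /ball_ /= => Ja Jb c /andP[ac cb].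
  move: Ja Jb; rewrite !ltr_norml => /andP[? ?] /andP[? ?]; apply/andP; split; lra.
pose w t i := u t 0 i - v t 0 i.
pose D (t : R) : R := \sum_i w t i ^+ 2.
pose D' (t : R) : R := \sum_i 2 * w t i * (F (u t) 0 i - F (v t) 0 i).
have D0 t : 0 <= D t by apply: sumr_ge0 => i _; exact: sqr_ge0.
have dD t : J t -> is_derive t 1 D (D' t).
  move=> /H[[[du Eu] _] [[dv' Ev] _]].
  have dwi i : differentiable (fun s : R^o => w s i : R^o) t.
    by apply: differentiable_subf; exact: differentiable_entry.
  have dwE i : dv (1 : R^o) (fun s : R^o => w s i : R^o) t = F (u t) 0 i - F (v t) 0 i.
    rewrite /w dv_addf; [|exact: differentiable_entry|].
      rewrite dv_oppf; last exact: differentiable_entry.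
      by rewrite -!dv_entry // Eu Ev.
    by apply: differentiable_oppf; exact: differentiable_entry.
  have DE : D = (fun s => \sum_i w s i * w s i).
    by apply/funext => s; apply: eq_bigr => i _; rewrite expr2.
  have dDt : differentiable (D : R^o -> R^o) t.
    by rewrite DE; apply: differentiable_sumf => i _; exact: differentiable_mulf.
  have <- : dv (1 : R^o) (D : R^o -> R^o) t = D' t.
    rewrite DE dv_sumf => [|i _]; last exact: differentiable_mulf.
    apply: eq_bigr => i _; rewrite dv_mulf // dwE; ring.
  by rewrite dvE; apply: derivableP; apply/derivable1_diffP.
have nw t : `|u t - v t| ^+ 2 <= D t.
  have sD : `|u t - v t| <= Num.sqrt (D t).
    apply: rV_norm_le => [|i]; first exact: sqrtr_ge0.
    rewrite -sqrtr_sqr ler_sqrt //; have -> : (u t - v t) 0 i = w t i by rewrite !mxE.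
    by rewrite /D (bigD1 i) //= lerDl; apply: sumr_ge0 => k _; exact: sqr_ge0.
  rewrite -[leRHS]sqr_sqrtr //; move: (normr_ge0 (u t - v t)) sD; nra.
have bD t : J t -> `|D' t| <= (2 * L * n%:R) * D t.
  move=> /H[[_ bu] [_ bv]]; apply: le_trans (ler_norm_sum _ _ _) _.
  have -> : 2 * L * n%:R * D t = \sum_(i < n) 2 * L * D t.
    by rewrite sumr_const card_ord -mulr_natr; ring.
  apply: ler_sum => i _; have := lip _ _ bv bu i; have := nw t.
  have : `|w t i| <= `|u t - v t|.
    by have := row_entry_norm (u t - v t) i; rewrite !mxE.
  rewrite !normrM (ger0_norm (ler0n _ 2)).
  move: (normr_ge0 (w t i)) (normr_ge0 (F (u t) 0 i - F (v t) 0 i)) (normr_ge0 (u t - v t)).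
  move: `|w t i| `|F (u t) 0 i - F (v t) 0 i| `|u t - v t| (D t) => a b c d a0 b0 c0 ac cd bL.
  have h1 : a * b <= c * (L * c) by apply: ler_pM.
  have h2 : c * (L * c) <= L * d by rewrite mulrCA -expr2 ler_wpM2l.
  by rewrite -!mulrA; move: h1 h2; move: (a * b) (c * (L * c)) (L * d) => x y z; lra.
have Dt0 : D t0 = 0.
  by rewrite /D big1 // => i _; rewrite /w uv subrr expr0n.
have Z := gronwall iJ J0 dD D0 Dt0 bD.
have : \forall t \near t0, J t by exact: nbhsx_ballx.
apply: filterS => t /Z Dt; apply/rowP => i; apply/eqP; rewrite -subr_eq0 -sqrf_eq0.
by rewrite eq_le sqr_ge0 andbT -Dt /D (bigD1 i) //= lerDl; apply: sumr_ge0 => k _; exact: sqr_ge0.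
Qed.

End Gronwall.

Section OppositeDirection.
Variables (R : realType) (V : normedModType R).

Lemma vel_opp (M : manifold R) (F : V -> M) x v : mdiff F x -> vel F x (- v) = - vel F x v.
Proof.
move=> mF; have := velP (-1) v 0 mF; rewrite addr0 !scaleN1r => ->.
by rewrite [vel F x 0]dv0 addr0.
Qed.

Lemma covd_opp (N : riemannian R) (F : V -> N) x v s : mdiff F x -> sdiff F s x ->
  covd F x (- v) s = - covd F x v s.
Proof.
move=> mF ds; have := covdP (-1) v 0 mF ds; rewrite addr0 !scaleN1r => ->.
have := covdP (-1) 0 0 mF ds; rewrite scaler0 addr0 scaleN1r addNr => ->.
by rewrite addr0.
Qed.

End OppositeDirection.

Section IntegralCurves.
Variables (R : realType) (M : manifold R) (X : M -> 'rV[R]_(dim M)).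
Hypothesis sX : smooth_sec (idfun : M -> M) setT X.

Definition integral_curve (u : R^o -> M) :=
  forall t : R, mdiff u t /\ vel u t (1 : R^o) = X (u t).

Lemma integral_curve_chart u p (t : R) : integral_curve u -> dom p (u t) ->
  \forall s \near t, dom p (u s) /\ (differentiable (fun s : R^o => chart p (u s)) s /\
    dv (1 : R^o) (fun s : R^o => chart p (u s)) s = vhat p X (chart p (u s))).
Proof.
move=> iu pu; have [[cu _] _] := iu t.
apply: filterS (near_dom cu pu) => s ps; split=> //; have [ms vs] := iu s.
split; first exact: mdiff_chart ms ps.
by rewrite vhat_chart // -vs (vel_chart _ ms ps).
Qed.

(** The set of times at which the curves coincide is open by local uniqueness in a chart and closed
    because M is Hausdorff. *)
Lemma integral_unique u v : integral_curve u -> integral_curve v -> u 0 = v 0 ->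
  forall t, u t = v t.
Proof.
move=> iu iv uv0 t; pose A := [set t : R | u t = v t].
suff AT : A = setT by have : A t by rewrite AT.
have cR : connected [set: R] by apply/connected_intervalP.
apply: cR; first by exists 0.
- exists A; last by rewrite setTI.
  rewrite openE => t0 At0; pose p := u t0.
  have pv : dom p (v t0) by rewrite -At0; exact: dom_self.
  have Hu := integral_curve_chart iu (dom_self p).
  have Hv := integral_curve_chart iv pv.
  have oU := @vdom_open _ M setT p openT.
  have Up : vdom setT p (chart p (u t0)) by exists (u t0) => //; split=> //; exact: dom_self.
  have uv : chart p (u t0) = chart p (v t0) by rewrite At0.
  have H := @ode_unique_local _ _ _ _ (fun s => chart p (u s)) (fun s => chart p (v s)) t0
    oU (@field_hat _ M setT X p sX) Up uv.
  have snd (A' B : set R) : (\forall s \near t0, A' s /\ B s) -> \forall s \near t0, B s.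
    by apply: filterS => s [].
  have {}H := H (snd _ _ Hu) (snd _ _ Hv).
  apply: filterS3 H Hu Hv => s E [pu _] [pv' _].
  by rewrite /A /= -(chartKd pu) E chartKd.
- exists A; last by rewrite setTI.
  move=> t0 ct0; apply: (@manifold_hausdorff _ M) => B C nB nC.
  have [[cu _] _] := iu t0; have [[cv _] _] := iv t0.
  have [s [As [Bs Cs]]] := ct0 _ (@filterI _ (nbhs t0) _ (u @^-1` B) (v @^-1` C) (cu _ nB) (cv _ nC)).
  by exists (u s); split=> //; rewrite As.
Qed.

End IntegralCurves.

(** * Parallel fields along the orbit of a transvection group *)

Section Transvections.
Variables (R : realType) (M : symmetric_space R) (o : M).
Variables (X : M -> 'rV[R]_(dim M)) (theta : R -> M -> M).
Hypothesis sym_inv : involutive (sym o).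
Hypothesis flow : isometric_flow X theta.
Hypothesis X_p : forall q, tmap (sym o) q (X q) = - X (sym o q).

Let sX : smooth_sec (idfun : M -> M) setT X. Proof. by case: flow. Qed.
Let isoT t : isometry (theta t). Proof. by case: flow. Qed.
Let isoS : isometry (sym o). Proof. exact: sym_isometry. Qed.
Let theta0 q : theta 0 q = q. Proof. by have [_ _ -> _ _] := flow. Qed.
Let thetaD t u q : theta (t + u) q = theta t (theta u q).
Proof. by have [_ _ _ -> _] := flow. Qed.
Let thetaK t : cancel (theta t) (theta (- t)).
Proof. by move=> q; rewrite -thetaD addNr theta0. Qed.

Lemma flow_integral q : integral_curve X (theta^~ q : R^o -> M).
Proof.
move=> t; have [_ _ _ _ /(_ q)[sc vX]] := flow.
have mt : mdiff (theta^~ q : R^o -> M) t by exact: smooth_curve_mdiff sc _.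
by split=> //; rewrite -velocityE vX.
Qed.

Lemma dv_affine (a k t : R) : differentiable (fun t : R^o => a + k * t : R^o) t /\
  dv (1 : R^o) (fun t : R^o => a + k * t : R^o) t = k.
Proof.
have H := differentiable_line (a : R^o) (k : R^o) (t : R^o).
have E : (fun t : R^o => a + k * t : R^o) = (fun t : R^o => (a : R^o) + t *: (k : R^o)).
  by apply/funext => s; rewrite /GRing.scale /= mulrC.
by rewrite E dvE; split=> //; exact: derive_line.
Qed.

(* [sym o] conjugates the flow of a field in the (-1)-eigenspace to its inverse,
   since both sides are integral curves of the same field. *)
Lemma flow_sym t q : sym o (theta t q) = theta (- t) (sym o q).
Proof.
suff H r q' : sym o (theta (0 + -1 * r) (sym o q')) = theta r q'.
  by have := H (- t) (sym o q); rewrite sym_inv add0r mulN1r opprK.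
pose u (t : R^o) := sym o (theta (0 + -1 * t) (sym o q')).
have iu : integral_curve X u.
  move=> {}r; have [dl dlE] := dv_affine 0 (-1) r.
  have [mt vt] := flow_integral (sym o q') (0 + -1 * r).
  have [mc vc] := mdiff_comp dl mt.
  have [mu vu] := vel_map mc (isometry_gdiff (theta (0 + -1 * r) (sym o q')) isoS).
  split=> //; rewrite vu vc dlE.
  by rewrite vel_opp // vt tmN -?tmapE ?X_p ?opprK //; exact: isometry_imm.
by apply: (integral_unique sX iu (flow_integral q')); rewrite /u mulr0 addr0 !theta0 sym_inv.
Qed.

Notation c := (theta^~ o : R^o -> M).

(** The chart at [o] provides a parallel field for short times only. This is enough, since the group
    law of the flow spreads the result to all times. *)
Lemma flow_local_parallel x : exists (P : R^o -> 'rV[R]_(dim M)) (eps : R),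
  [/\ 0 < eps, P 0 = x & forall t : R, `|t| < eps -> sdiff c P t /\ covd c t 1 P = 0].
Proof.
have [_ _ _ _ /(_ o)[sc vX]] := flow; have [cc sq] := sc.
pose U : set R^o := setT `&` c @^-1` dom o.
have oU : open U.
  apply: openI; first exact: openT.
  by apply: open_comp => [t _|]; [exact: cc|exact: dom_open].
have U0 : U 0 by split=> //; rewrite /= theta0; exact: dom_self.
have /nbhs_ballP[d d0 H] := open_nbhs_nbhs (conj oU U0); rewrite /= in d0.
have Ub t : - (d / 2) <= t <= d / 2 -> U t.
  move=> /andP[? ?]; apply: H; rewrite -ball_normE /ball_ /= sub0r normrN.
  by rewrite ltr_norml; apply/andP; split; lra.
have Uc : U `<=` (chart o \o c) @^-1` cim o by move=> t [_ ?]; exists (c t).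
have ab : - (d / 2) < 0 < d / 2 by rewrite oppr_lt0 divr_gt0.
have [P [P0 HP]] := ccurve_transport x oU (sq o) Uc ab Ub.
exists P, (d / 2); split=> // [|t]; first by rewrite divr_gt0.
rewrite ltr_norml => /[dup] /andP[h1 h2] /HP[dP cP].
have Ut : U t by apply: Ub; rewrite !ltW.
have E : \forall s \near (t : R^o), ccurve o (chart o \o c) s = c s.
  by apply: filterS (open_nbhs_nbhs (conj oU Ut)) => s [_ ps]; exact: chartKd.
by split; [exact: sdiff_near_map E dP|rewrite -(covd_near_map _ _ E)].
Qed.

(* The isometry [tau] reverses the orbit about its point at time [s] and acts as -1
   there, so it maps parallel fields along the orbit to their negatives. *)
Lemma flow_transport (P : R^o -> 'rV[R]_(dim M)) (eps s : R) : `|2 * s| < eps ->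
  (forall t : R, `|t| < eps -> sdiff c P t /\ covd c t 1 P = 0) ->
  tm (theta (2 * s)) o (P 0) = P (2 * s).
Proof.
move=> se HP.
pose tau q := theta s (sym o (theta (- s) q)).
have isoST := isometry_comp isoS (isoT (- s)).
have isoTau : isometry tau := isometry_comp (isoT s) isoST.
have mc t : mdiff c t by have [] := flow_integral o t.
have tauc t : tau (c t) = c (2 * s + -1 * t).
  rewrite /tau -thetaD flow_sym sym_fix -thetaD; congr (theta _ o); ring.
have gd (g : M -> M) q : isometry g -> gdiff g q by exact: isometry_gdiff.
have tmTau z : tm tau (c s) z = - z.
  have [_ E1] := tm_comp z (gd _ (c s) isoST) (gd _ _ (isoT s)).
  have [_ E3] := tm_comp z (gd _ (c s) (isoT (- s))) (gd _ _ isoS).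
  rewrite [LHS]E1 [tm _ (c s) z]E3 /= thetaK sym_fix -(tmapE (sym o)) sym_reflection.
  rewrite (tmN (isometry_imm (isoT s))); congr (- _).
  have [sT _ _] := isoT s; have := tm_cancel (c s) z (isoT (- s)) sT.
  by rewrite thetaK; apply => q; have := thetaK (- s) q; rewrite opprK.
have E2 : (fun t : R^o => tau (c t)) = (fun t : R^o => c (2 * s + -1 * t)).
  by apply/funext => t; exact: tauc.
(* The times for which both [t] and its reflection [2 * s - t] lie where [P] is known to be
   parallel. [J] contains [0] and [s]: the fields are compared at [s] and the conclusion is drawn at
   [0]. *)
pose J : set R := [set t | `|t| < eps /\ `|2 * s - t| < eps].
have iJ : is_interval J.
  move=> a b [a1 a2] [b1 b2] t /andP[ta tb].
  move: a1 a2 b1 b2; rewrite /J /= !ltr_norml => /andP[? ?] /andP[? ?] /andP[? ?] /andP[? ?].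
  by split; apply/andP; split; lra.
have e0 : 0 < eps by exact: le_lt_trans se.
have J0 : J 0 by rewrite /J /= normr0 subr0.
have Js : J s.
  have sE : `|s| < eps.
    apply: le_lt_trans se; rewrite normrM ger0_norm //; move: (normr_ge0 s); lra.
  by split=> //; rewrite (_ : 2 * s - s = s) //; ring.
have mF t : J t -> mdiff (fun t : R^o => tau (c t)) t.
  by move=> _; apply: mdiff_imm => //; exact: isometry_imm.
have H := @parallel_unique R M (fun t => tau (c t)) J iJ mF
  (fun t => tm tau (c t) (P t)) (fun t => - P (2 * s + -1 * t)) s Js _ _ 0 J0.
have := H; rewrite theta0 mulr0 addr0 => {}H.
have HP0 : tm tau o (P 0) = - P (2 * s).
  apply: H.
    by rewrite tmTau; congr (- P _); ring.
  move=> t [t1 t2]; have [dP cP] := HP t t1.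
  have [da daE] := dv_affine (2 * s) (-1) t.
  have t2' : `|2 * s + -1 * t| < eps by rewrite mulN1r.
  have [dQ' cQ'] := HP _ t2'.
  have [dQ0 cQ0] := covd_comp (1 : R^o) da (mc (2 * s + -1 * t)) dQ'.
  have mct : mdiff (fun t : R^o => c (2 * s + -1 * t)) t by have [] := mdiff_comp da (mc (2 * s + -1 * t)).
  have dQ : sdiff (fun t : R^o => c (2 * s + -1 * t)) (fun t => - P (2 * s + -1 * t)) t by exact: sdiffN.
  have cQ : covd (fun t : R^o => c (2 * s + -1 * t)) t 1 (fun t => - P (2 * s + -1 * t)) = 0.
    by rewrite covdN // cQ0 daE covd_opp // cQ' !oppr0.
  split; first by apply: sdiff_tm => //; exact: isometry_imm.
    by rewrite E2.
  by rewrite (covd_isometry isoTau (1 : R^o) (mc t) dP) cP tm0 E2 cQ.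
(* The transvection is a product of two symmetries, [tau] and [sym o]; the signs that they
   contribute cancel. *)
have thE : theta (2 * s) = (fun q => tau (sym o q)).
  apply/funext => q; rewrite /tau -flow_sym sym_inv -thetaD; congr (theta _ q); ring.
have [_ E] := tm_comp (P 0) (gd _ o isoS) (gd _ _ isoTau).
rewrite thE [LHS]E sym_fix -(tmapE (sym o)) sym_reflection (tmN (isometry_imm isoTau)) HP0.
exact: opprK.
Qed.

(** Near time [0] the field coincides with the local parallel field [P]. At time [t], it is the
    image under the isometry [theta t] of the field near [0], reparametrized by a shift. *)
Lemma flow_parallel x (t : R) :
  sdiff c (fun u => tm (theta u) o x) t /\ covd c t 1 (fun u => tm (theta u) o x) = 0.
Proof.
have mc s : mdiff c s by have [] := flow_integral o s.
have gd (g : M -> M) q : isometry g -> gdiff g q by exact: isometry_gdiff.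
have [P [eps [e0 P0 HP]]] := flow_local_parallel x.
have near0 : \forall u \near (0 : R^o), P u = tm (theta u) o x.
  apply: filterS (nbhsx_ballx (0 : R^o) _ e0) => u; rewrite -ball_normE /ball_ /= sub0r normrN => ue.
  have E : 2 * (u / 2) = u by field.
  have := @flow_transport P eps (u / 2); rewrite E => /(_ ue HP).
  by rewrite P0.
have [|dP cP] := HP 0; first by rewrite normr0.
have d0 := sdiff_near near0 dP.
have c0 : covd c 0 1 (fun u => tm (theta u) o x) = 0 by rewrite -(covd_near _ _ near0).
have [da daE] := dv_affine (- t) 1 t.
have at0 : - t + 1 * t = 0 by ring.
have cE : (fun u : R^o => theta t (c (- t + 1 * u))) = c.
  by apply/funext => u; rewrite -thetaD; congr (theta _ o); ring.
have YE : (fun u : R^o => tm (theta t) (c (- t + 1 * u)) (tm (theta (- t + 1 * u)) o x)) =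
    (fun u => tm (theta u) o x).
  apply/funext => u.
  have [_ <-] := tm_comp x (gd _ o (isoT (- t + 1 * u))) (gd _ _ (isoT t)).
  congr (tm _ o x); apply/funext => q; rewrite -thetaD; congr (theta _ q); ring.
have i0 := isometry_imm (isoT t).
have mtc : mdiff (fun u : R^o => theta t (c u)) 0 by exact: mdiff_imm i0 _ _ _ (mc 0).
have ds := sdiff_tm i0 (mc 0) d0.
have cs := covd_isometry (isoT t) (1 : R^o) (mc 0) d0.
rewrite c0 tm0 in cs; rewrite -{1}at0 in mtc; rewrite -{1}at0 in ds.
have [] := covd_comp (1 : R^o) da mtc ds; rewrite cE YE => h1 h2; split=> //.
by rewrite h2 daE at0; exact: cs.
Qed.

End Transvections.

Lemma smooth_curve_comp (R : realType) (M N : manifold R) (g : M -> N) (J : set R) (c : R -> M) :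
  smooth g -> open J -> smooth_curve J c -> smooth_curve J (g \o c).
Proof.
move=> [cg sg] oJ [cc sc]; split=> [t Jt|q].
  by apply: continuous_comp; [exact: cc|exact: cg].
apply: Cinfty_local => t [Jt qt]; pose p := c t; pose B := dom p `&` g @^-1` dom q.
have oB : open B.
  apply: openI; first exact: dom_open.
  by apply: open_comp; [move=> ? _; exact: cg|exact: dom_open].
pose U : set R^o := J `&` c @^-1` B.
have oU : open U.
  rewrite openE => u [Ju Bu]; apply: filterI; first by apply: open_nbhs_nbhs.
  by apply: (cc u Ju); apply: open_nbhs_nbhs.
have oD : open (chart p @` B) by apply: chart_im_open => // ? [].
exists U; first by split=> //; split=> //; exact: dom_self.
have sU : Cinfty U (chart p \o c) by apply: Cinfty_sub (sc p) => u [Ju [pu _]].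
have H := Cinfty_comp_row oU oD _ sU (sg p q).
apply: (Cinfty_eq oU _ (H _)) => u [Ju [pu Bu]]; first by rewrite /= chartKd.
by exists (c u).
Qed.

(** * The canonical connection on the first normal bundle *)

Section CanonicalConnection.
Variables (R : realType) (M : symmetric_space R) (N : riemannian R) (f : M -> N).
Hypothesis f_imm : isometric_immersion f.
Hypothesis f_par : parallel_immersion f.
Variable o : M.
Hypothesis sym_inv : involutive (sym o).
Let sf : smooth f. Proof. by case: f_imm. Qed.

(** The isometry [g] carries the parallel fields along the orbit of [o] to parallel fields along the
    translated orbit. As [s] is a combination with constant coefficients of values of h on such
    fields, its normal derivative vanishes. *)
Lemma normal_along_flow X theta (g : M -> M) (s : R -> tot N (normal1 f))
    r (a : 'I_r -> R) (x y : 'I_r -> 'rV[R]_(dim M)) :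
  cartan_p o X -> isometric_flow X theta -> isometry g ->
  (forall t, bpt (s t) = g (theta t o)) ->
  (forall t, vec (s t) = \sum_i a i *: hh f (g (theta t o))
     (tm (fun q => g (theta t q)) o (x i)) (tm (fun q => g (theta t q)) o (y i))) ->
  parallel_along f (normal1 f) (nabla_normal f) setT s.
Proof.
move=> [_ Xp] fl ig bs vs.
have -> : nabla_normal f = (fun p v s => npart f p (nabla f p v s)).
  by apply/funext => p; apply/funext => v; apply/funext => e; exact: normal_partE.
have [_ iT _ _ orb] := fl; have [so _] := orb o.
have gd (k : M -> M) q : isometry k -> gdiff k q by exact: isometry_gdiff.
pose c (t : R^o) := g (theta t o).
have mo t : mdiff (theta^~ o : R^o -> M) t by exact: smooth_curve_mdiff so _.
have mc t : mdiff c t by have [] := vel_map (mo t) (gd g _ ig).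
pose Y z (t : R^o) := tm g (theta t o) (tm (theta t) o z).
have dY z t : sdiff c (Y z) t /\ covd c t 1 (Y z) = 0.
  have [d0 c0] := flow_parallel sym_inv fl Xp z t.
  split; first by apply: sdiff_tm => //; exact: isometry_imm.
  by rewrite [LHS](covd_isometry ig (1 : R^o) (mo t) d0) c0 tm0.
have bE : bpt \o s = c by apply/funext => t; exact: bs.
have vE : (fun u : R^o => vec (s u)) = (fun t => \sum_i a i *: hh f (c t) (Y (x i) t) (Y (y i) t)).
  apply/funext => t; rewrite vs; apply: eq_bigr => i _.
  have tmE z := (tm_comp z (gd _ o (iT t)) (gd g _ ig)).2.
  by rewrite !tmE.
apply: (covd_parallel_along sf (npartP f_imm)).
- by move=> p v nv; apply: npart_id => //; exact: normal1_normal.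
- exact: normal1_subbundle.
- exact: openT.
- by [].
- rewrite bE; have [sg _ _] := ig.
  exact: (smooth_curve_comp sg openT so).
- move=> t _; rewrite vE bs.
  have -> : (fun u : R^o => f (bpt (s u))) = (fun u => f (c u)).
    by apply/funext => u; rewrite bs.
  have mfc := mdiff_imm f_imm (mc t).
  have dh i : sdiff (fun u => f (c u)) (fun u => hh f (c u) (Y (x i) u) (Y (y i) u)) t /\
      npart f (c t) (covd (fun u => f (c u)) t 1 (fun u => hh f (c u) (Y (x i) u) (Y (y i) u))) = 0.
    have [d1 c1] := dY (x i) t; have [d2 c2] := dY (y i) t.
    have [dd ->] := covd_hh f_imm f_par (1 : R^o) (mc t) d1 d2.
    by split=> //; rewrite c1 c2 hh0l // hh0r // addr0.
  have dk i : differentiable (fun=> a i : R^o) t by exact: differentiable_cst.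
  have ds i : sdiff (fun u => f (c u)) (fun u => a i *: hh f (c u) (Y (x i) u) (Y (y i) u)) t.
    by have [d _] := dh i; exact: (sdiff_scale mfc (dk i) d).
  split; first exact: sdiff_sum.
  rewrite covd_sum // npart_sum // big1 // => i _; have [d nE] := dh i.
  by rewrite (covd_scale (1 : R^o) mfc (dk i) d) dv_cst scale0r add0r npartZ // nE scaler0.
Qed.

End CanonicalConnection.

Lemma normal1_canonical (R : realType) (M : symmetric_space R) (N : riemannian R) (f : M -> N)
    (f_imm : isometric_immersion f) (f_par : parallel_immersion f)
    (Sigma : M -> tot N (osc f) -> tot N (osc f)) (SigmaP : forall p, is_Sigma p (Sigma p))
    (alpha : {g | Sym M g} -> tot N (osc f) -> tot N (osc f))
    (alphaP : forall g, lifts (sval g) (alpha g)) (I0_Sym : isom0 M `<=` Sym M) (o : M) :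
  canonical_connection o f (restrict_action I0_Sym (alphaN f_imm alphaP)) (nabla_normal f).
Proof.
split; first exact: normal_connection.
move=> g X theta gamma v Xp fl gE vo.
have ig : isometry (sval g) by apply: Sym_isometry; exact: I0_Sym (proj2_sig g).
have [r [a [x [y vE]]]] := totP v; rewrite vo in vE.
apply: (@normal_along_flow _ _ _ f f_imm f_par o _ X theta (sval g) _ r a x y Xp fl ig).
- by move=> q; exact: (sym_involutive f_imm SigmaP).
- by move=> t; rewrite /restrict_action /alphaN /bpt /= -/(bpt v) vo gE.
- move=> t; rewrite /restrict_action vec_alphaN vo vE.
  set gt := exist _ _ _; have [ah _ _ nP] := alphaP gt.
  have oh i : osc f o (h f o (x i) (y i)) by rewrite hE; exact: osc_hh.
  have [_ ->] := fib_sum (osc0 f_imm) (osc_lin f_imm) ah (index_enum _) xpredT a oh.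
  have [_ nh] := nP o; apply: eq_bigr => i _; rewrite hE nh.
  by rewrite /gt /= gE.
Qed.

Theorem proposition10 (R : realType) (N M : symmetric_space R)
    (k : nat) (Mi : 'I_k -> symmetric_space R) (f : M -> N) (o : M)
    (k_gt0 : (0 < k)%N)
    (M_sc : simply_connected R M)
    (Mi_irr : forall i, irreducible_space (Mi i))
    (M_prod : isometric_to_product M Mi)
    (f_imm : isometric_immersion f)
    (f_par : parallel_immersion f)
    (Sigma : M -> tot N (osc f) -> tot N (osc f))
    (SigmaP : forall p, is_Sigma p (Sigma p))
    (I0_Sym : isom0 M `<=` Sym M) :
  exists alpha : {g | Sym M g} -> tot N (osc f) -> tot N (osc f),
    (* (a) *)
    (natural_action Sigma alpha /\
     forall alpha', natural_action Sigma alpha' -> alpha' = alpha) /\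
    exists (alphaT : {g | Sym M g} ->
                     tot M (tangent M) -> tot M (tangent M))
           (alphaN : {g | Sym M g} -> tot N (normal1 f) -> tot N (normal1 f)),
    [/\ (* (b) *)
        [/\ bundle_action (idfun : M -> M) (tangent M) (Sym M) alphaT /\
            bundle_action f (normal1 f) (Sym M) alphaN,
            forall g (w : tot N (osc f)) (x : tot M (tangent M))
                   (xi : tot N (normal1 f)),
              bpt x = bpt w -> bpt xi = bpt w ->
              vec w = tmap f (bpt w) (vec x) + vec xi ->
              vec (alpha g w) =
                tmap f (sval g (bpt w)) (vec (alphaT g x)) + vec (alphaN g xi),
            forall g (x : tot M (tangent M)),
              vec (alphaT g x) = tmap (sval g) (bpt x) (vec x) &
            forall g (x y : tot M (tangent M)) (xi : tot N (normal1 f)),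
              bpt x = bpt y -> bpt xi = bpt x ->
              vec xi = h f (bpt x) (vec x) (vec y) ->
              vec (alphaN g xi) =
                h f (sval g (bpt x)) (vec (alphaT g x)) (vec (alphaT g y))],
        (* (c) *)
        homogeneous_via f (normal1 f) (isom0 M) (restrict_action I0_Sym alphaN) &
        (* (d) *)
        canonical_connection o f (restrict_action I0_Sym alphaN)
          (nabla_normal f)].
Proof.
have ex (g : {g | Sym M g}) := lift_exists f_imm f_par SigmaP (proj2_sig g).
(* Lifts are chosen independently for each [g]; since they are unique, the choices automatically
   respect the group law. *)
pose alpha g := sval (cid (ex g)).
have alphaP g : lifts (sval g) (alpha g) by exact: svalP (cid (ex g)).
exists alpha; split.
  split; first exact: alpha_natural.
  by move=> alpha'; exact: natural_action_uniq.
exists (@alphaT R M), (alphaN f_imm alphaP); split.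
- split.
  + split; [exact: alphaT_action|exact: alphaN_action].
  + by move=> g w x xi; exact: alpha_split.
  + by move=> g x; rewrite tmapE.
  + by move=> g x y xi; exact: alpha_sff.
- exact: normal1_homogeneous.
- exact: normal1_canonical SigmaP _ alphaP _ _.
Qed.
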